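(* Every irreducible almost-coherent family is almost-equivalent to a unique (up to isomorphism) irreducible semi-simple coherent family.
   Context: $\mathfrak g$ is a finite-dimensional simple complex Lie algebra (of type $A$ or $C$) with Cartan subalgebra $\mathfrak h$ and root system $\Delta$; $U(\cdot)$ is the universal enveloping algebra; $\mathcal A=U(\mathfrak g)_0$ is the commutant of $U(\mathfrak h)$ in $U(\mathfrak g)$. A weight module is a $\mathfrak g$-module that is the direct sum of its $\mathfrak h$-weight spaces, all finite dimensional. A $\mathfrak g$-module is semi-simple if it is a direct sum of finitely or infinitely many simple $\mathfrak g$-modules. A subset of $\mathfrak h^*$ is cofinite if its complement is finite. A coherent family of degree $d$ is a weight module $\mathcal M$ with $\dim\mathcal M_\lambda=d$ for all $\lambda\in\mathfrak h^*$ and such that for every $u\in\mathcal A$ the map $\lambda\mapsto\operatorname{tr}(u|_{\mathcal M_\lambda})$ is polynomial on $\mathfrak h^*$. It is irreducible if $\mathcal M_\lambda$ is a simple $\mathcal A$-module for some $\lambda\in\mathfrak h^*$. For a cofinite $U\subseteq\mathfrak h^*$, a $U$-coherent family of degree $d$ is a weight module $\mathcal M$ with $\dim\mathcal M_\lambda=d$ for all $\lambda\in U$ and such that for every $u\in\mathcal A$ the map $\lambda\mapsto\operatorname{tr}(u|_{\mathcal M_\lambda})$ coincides on $U$ with a polynomial function. It is irreducible if $\mathcal M_\lambda$ is a simple $\mathcal A$-module for some $\lambda\in\mathfrak h^*$ with $\lambda+\mathbb Z\Delta\subseteq U$. An (irreducible) almost-coherent family is an (irreducible) $U$-coherent family for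 some cofinite $U$. Two weight modules $M,N$ are almost-equivalent, $M\sim N$, if there is a cofinite $U\subseteq\mathfrak h^*$ such that $\operatorname{tr}(u|_{M_\lambda})=\operatorname{tr}(u|_{N_\lambda})$ for all $\lambda\in U$, $u\in\mathcal A$. *)

(* Defs.v *)
From HB Require Import structures.
From mathcomp Require Import all_boot all_algebra.
From mathcomp Require Import finmap.
From mathcomp Require Import boolp classical_sets cardinality reals.
From mathcomp Require Import complex.
From mathcomp.multinomials Require Import monalg.
From mathcomp.multinomials Require mpoly.

Set Implicit Arguments.
Unset Strict Implicit.
Unset Printing Implicit Defensive.

Import GRing.Theory.
Local Open Scope classical_set_scope.
Local Open Scope quotient_scope.
Local Open Scope ring_scope.

HB.mixin Record isLie (K : fieldType) g of Vector K g := {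
  lie : g -> g -> g;
  lieDl : forall x y z, lie (x + y) z = lie x z + lie y z;
  lieZl : forall (a : K) x z, lie (a *: x) z = a *: lie x z;
  liexx : forall x, lie x x = 0;
  lie_jacobi : forall x y z,
    lie x (lie y z) + lie y (lie z x) + lie z (lie x y) = 0
}.

#[short(type="lieAlgType")]
HB.structure Definition LieAlgebra (K : fieldType) :=
  { g of Vector K g & isLie K g }.

HB.mixin Record isLieModule (K : fieldType) (g : lieAlgType K) M
    of GRing.Lmodule K M := {
  lact : g -> M -> M;
  lactDl : forall x y m, lact (x + y) m = lact x m + lact y m;
  lactZl : forall (a : K) x m, lact (a *: x) m = a *: lact x m;
  lactDr : forall x m n, lact x (m + n) = lact x m + lact x n;
  lactZr : forall (a : K) x m, lact x (a *: m) = a *: lact x m;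
  lact_lie : forall x y m, lact (lie x y) m = lact x (lact y m) - lact y (lact x m)
}.

#[short(type="lieModType")]
HB.structure Definition LieModule (K : fieldType) (g : lieAlgType K) :=
  { M of GRing.Lmodule K M & isLieModule K g M }.

Section Envelope.
Variables (K : fieldType) (g : lieAlgType K).

(* The free associative unital K-algebra on the underlying set of g; U(g) is
   its quotient by the relations making the generators linear in g and
   turning the bracket into the commutator. *)
Local Notation freeAlg := {malg K[{fmonom g}]}.

Definition fgen (x : g) : freeAlg := << fmu x >>.

Definition env_rel : set freeAlg :=
  [set p | (exists x y, p = fgen (x + y) - (fgen x + fgen y))
        \/ (exists a x, p = fgen (a *: x) - a *: fgen x)
        \/ (exists x y, p = fgen (lie x y) - (fgen x * fgen y - fgen y * fgen x))].

Definition two_sided_ideal (I : set freeAlg) : Prop :=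
  [/\ I 0, forall p q, I p -> I q -> I (p - q),
      forall p q, I q -> I (p * q) & forall p q, I p -> I (p * q)].

Definition env_ideal : {pred freeAlg} :=
  fun p => `[< smallest two_sided_ideal env_rel p >].

Lemma env_idealP p : reflect (smallest two_sided_ideal env_rel p) (p \in env_ideal).
Proof. exact: asboolP. Qed.

Lemma smallest_two_sided_ideal : two_sided_ideal (smallest two_sided_ideal env_rel).
Proof.
split=> [I [[]]//|p q Ip Iq I HI|p q Iq I HI|p q Ip I HI].
- by case: (HI) => -[_ h _ _ _]; apply: h; [apply: Ip|apply: Iq].
- by case: (HI) => -[_ _ h _ _]; apply: h; apply: Iq.
- by case: (HI) => -[_ _ _ h _]; apply: h; apply: Ip.
Qed.

Lemma env_ideal_zmod_closed : zmod_closed env_ideal.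
Proof.
have [I0 IB _ _] := smallest_two_sided_ideal.
by split=> [|p q /env_idealP Ip /env_idealP Iq]; apply/env_idealP => //; apply: IB.
Qed.

HB.instance Definition _ := GRing.isZmodClosed.Build freeAlg env_ideal
  env_ideal_zmod_closed.

Lemma env_idealMl p q : q \in env_ideal -> p * q \in env_ideal.
Proof.
by move=> /env_idealP Iq; apply/env_idealP; have [_ _ + _] := smallest_two_sided_ideal; exact.
Qed.

Lemma env_idealMr p q : p \in env_ideal -> p * q \in env_ideal.
Proof.
by move=> /env_idealP Ip; apply/env_idealP; have [_ _ _] := smallest_two_sided_ideal; exact.
Qed.

Lemma env_ideal_sub (J : set freeAlg) :
  two_sided_ideal J -> env_rel `<=` J -> forall p, p \in env_ideal -> J p.
Proof. by move=> HJ sJ p /env_idealP; apply: smallest_sub. Qed.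

Lemma mcoeff1_fgen x : (fgen x)@_(@mone _) = 0.
Proof. by rewrite mcoeffU1 /= /mone /= fmuE fmoneE. Qed.

Lemma counitM (p q : freeAlg) :
  (p * q)@_(@mone _) = p@_(@mone _) * q@_(@mone _).
Proof. by have [h _] := mcoeff1g_is_multiplicative {fmonom g} K; exact: h. Qed.

Lemma env_ideal1 : 1 \notin env_ideal.
Proof.
apply/negP => /(@env_ideal_sub [set p : freeAlg | p@_(@mone _) = 0]) /=.
have H : (1 : freeAlg)@_(@mone _) <> 0 by rewrite mcoeff1 eqxx; apply/eqP/oner_neq0.
move=> H'; apply/H/H' => {H H'}.
  split=> [|p q|p q|p q] /=; rewrite ?mcoeff0 ?mcoeffB ?counitM //.
  - by move=> -> ->; rewrite subr0.
  - by move=> ->; rewrite mulr0.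
  - by move=> ->; rewrite mul0r.
move=> p [[x [y ->]]|[[a [x ->]]|[x [y ->]]]] /=.
- by rewrite mcoeffB mcoeffD !mcoeff1_fgen addr0 subr0.
- by rewrite mcoeffB mcoeffZ !mcoeff1_fgen mulr0 subr0.
- by rewrite !mcoeffB !counitM /= !mcoeff1_fgen mulr0 !subr0.
Qed.

Definition Uenv := Quotient.quot env_ideal.
HB.instance Definition _ := GRing.Zmodule.on Uenv.
HB.instance Definition _ := EqQuotient.on Uenv.

Implicit Types (u v : Uenv).

Local Notation Upi := (\pi_Uenv).

Definition Uone : Uenv := Upi 1.
Definition Umul u v : Uenv := Upi (repr u * repr v).
Definition Uscale (a : K) u : Uenv := Upi (a *: repr u).

Lemma Upi_eqP (p q : freeAlg) :
  reflect (Upi p = Upi q :> Uenv) (p - q \in env_ideal).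
Proof. by rewrite Quotient.idealrBE; apply: eqP. Qed.

Lemma UpiD (p q : freeAlg) : Upi (p + q) = Upi p + Upi q :> Uenv.
Proof. by rewrite !piE. Qed.

Lemma Urepr (p : freeAlg) : repr (Upi p) - p \in env_ideal.
Proof. by apply/Upi_eqP; rewrite reprK. Qed.

Lemma UpiM (p q : freeAlg) : Umul (Upi p) (Upi q) = Upi (p * q).
Proof.
apply/Upi_eqP; set p' := repr _; set q' := repr _.
have -> : p' * q' - p * q = (p' - p) * q' + p * (q' - q).
  by rewrite mulrBl mulrBr addrA subrK.
by apply: rpredD; [apply/env_idealMr/Urepr|apply/env_idealMl/Urepr].
Qed.

Lemma UpiZ a (p : freeAlg) : Uscale a (Upi p) = Upi (a *: p).
Proof.
apply/Upi_eqP; rewrite -scalerBr -[_ - _]mul1r scalerAl.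
exact/env_idealMl/Urepr.
Qed.

Lemma UmulA : associative Umul.
Proof.
elim/quotW => x; elim/quotW => y; elim/quotW => z.
by rewrite (UpiM y z) (UpiM x y) (UpiM x) (UpiM _ z) mulrA.
Qed.
Lemma Umul1u : left_id Uone Umul.
Proof. by elim/quotW => x; rewrite (UpiM 1 x) mul1r. Qed.
Lemma Umulu1 : right_id Uone Umul.
Proof. by elim/quotW => x; rewrite (UpiM x 1) mulr1. Qed.
Lemma UmulDl : left_distributive Umul +%R.
Proof.
elim/quotW => x; elim/quotW => y; elim/quotW => z.
by rewrite -UpiD (UpiM _ z) (UpiM x z) (UpiM y z) mulrDl UpiD.
Qed.
Lemma UmulDr : right_distributive Umul +%R.
Proof.
elim/quotW => x; elim/quotW => y; elim/quotW => z.
by rewrite -UpiD (UpiM x) (UpiM x y) (UpiM x z) mulrDr UpiD.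
Qed.
Lemma Uone_neq0 : Uone != 0.
Proof.
have -> : 0 = Upi 0 by rewrite !piE.
by apply/eqP => /Upi_eqP; rewrite subr0; apply/negP/env_ideal1.
Qed.

HB.instance Definition _ := GRing.Zmodule_isNzRing.Build Uenv
  UmulA Umul1u Umulu1 UmulDl UmulDr Uone_neq0.

Lemma UscaleA a b u : Uscale a (Uscale b u) = Uscale (a * b) u.
Proof. by elim/quotW: u => x; rewrite (UpiZ b) (UpiZ a) UpiZ scalerA. Qed.
Lemma Uscale1 : left_id 1 Uscale.
Proof. by elim/quotW => x; rewrite UpiZ scale1r. Qed.
Lemma UscaleDr : right_distributive Uscale +%R.
Proof.
by move=> a; elim/quotW => x; elim/quotW => y; rewrite -UpiD !UpiZ scalerDr UpiD.
Qed.
Lemma UscaleDl u : {morph Uscale^~ u : a b / a + b}.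
Proof. by elim/quotW: u => x a b; rewrite !UpiZ scalerDl UpiD. Qed.

HB.instance Definition _ := GRing.Zmodule_isLmodule.Build K Uenv
  UscaleA Uscale1 UscaleDr UscaleDl.

Lemma UscaleAl a u v : a *: (u * v) = (a *: u) * v.
Proof.
elim/quotW: u => x; elim/quotW: v => y.
change (Uscale a (Umul (Upi x) (Upi y)) = Umul (Uscale a (Upi x)) (Upi y)).
by rewrite (UpiM x y) (UpiZ a x) (UpiM _ y) (UpiZ a _) scalerAl.
Qed.

HB.instance Definition _ := GRing.Lmodule_isLalgebra.Build K Uenv UscaleAl.

Lemma mulr_malgC a (p : freeAlg) : p * a%:MP = a *: p.
Proof.
rewrite malgM_def malgZ_def fgmulgU; apply/eq_bigr => /= k _.
by rewrite mulm1 mulrC.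
Qed.

Lemma UscaleAr a u v : a *: (u * v) = u * (a *: v).
Proof.
elim/quotW: u => x; elim/quotW: v => y.
change (Uscale a (Umul (Upi x) (Upi y)) = Umul (Upi x) (Uscale a (Upi y))).
rewrite (UpiM x y) (UpiZ a y) (UpiM x) (UpiZ a _); congr (Upi _).
by rewrite -mul_malgC mulrA mul_malgC -mulr_malgC -mulrA mul_malgC.
Qed.

HB.instance Definition _ := GRing.Lalgebra_isAlgebra.Build K Uenv UscaleAr.

Definition Uin (x : g) : Uenv := Upi (fgen x).

Lemma UinD x y : Uin (x + y) = Uin x + Uin y.
Proof.
rewrite -UpiD; apply/Upi_eqP/env_idealP; apply: sub_gen_smallest.
by left; exists x, y.
Qed.

Lemma UinZ a x : Uin (a *: x) = a *: Uin x.
Proof.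
rewrite [RHS](UpiZ a (fgen x)); apply/Upi_eqP/env_idealP; apply: sub_gen_smallest.
by right; left; exists a, x.
Qed.

Lemma Uin_lie x y : Uin (lie x y) = Uin x * Uin y - Uin y * Uin x.
Proof.
have -> : Uin x * Uin y - Uin y * Uin x = Upi (fgen x * fgen y - fgen y * fgen x).
  rewrite [Uin x * _](UpiM (fgen x) (fgen y)) [Uin y * _](UpiM (fgen y) (fgen x)).
  by rewrite !piE.
apply/Upi_eqP/env_idealP; apply: sub_gen_smallest.
by right; right; exists x, y.
Qed.

Variable M : lieModType g.
Implicit Types (m : M) (p q : freeAlg).

Definition wact (w : seq g) m : M := foldr (fun x n => lact x n) m w.

Definition tact p m : M := \sum_(w <- msupp p) p@_w *: wact (fmonom_val w) m.

Definition uact u m : M := tact (repr u) m.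

Lemma wact_cons x w m : wact (x :: w) m = lact x (wact w m).
Proof. by []. Qed.

Lemma wactD w : {morph wact w : m n / m + n}.
Proof. by elim: w => // x w IH m n; rewrite !wact_cons IH lactDr. Qed.

Lemma wactZ w a : {morph wact w : m / a *: m}.
Proof. by elim: w => // x w IH m; rewrite !wact_cons IH lactZr. Qed.

Lemma wact0 w : wact w 0 = 0.
Proof. by have := wactZ w 0 0; rewrite !scale0r. Qed.

Lemma tactEw (d : {fset {fmonom g}}) p m : (msupp p `<=` d)%fset ->
  tact p m = \sum_(w <- d) p@_w *: wact (fmonom_val w) m.
Proof.
move=> le; rewrite /tact (big_fset_incl _ le) => //= x _ /mcoeff_outdom ->.
by rewrite scale0r.
Qed.

Lemma tactU c w m : tact << c *g w >> m = c *: wact (fmonom_val w) m.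
Proof. by rewrite (tactEw _ (@msuppU_le _ _ _ _)) big_seq_fset1 mcoeffUU. Qed.

Lemma tactD p q m : tact (p + q) m = tact p m + tact q m.
Proof.
pose d := (msupp p `|` msupp q)%fset.
rewrite (@tactEw d p) ?fsubsetUl // (@tactEw d q) ?fsubsetUr //.
rewrite (@tactEw d (p + q)) ?msuppD_le // -big_split /=.
by apply: eq_bigr => w _; rewrite mcoeffD scalerDl.
Qed.

Lemma tactZ a p m : tact (a *: p) m = a *: tact p m.
Proof.
rewrite (tactEw _ (msuppZ_le _ _)) /tact scaler_sumr.
by apply: eq_bigr => w _; rewrite mcoeffZ scalerA.
Qed.

Lemma tactB p q m : tact (p - q) m = tact p m - tact q m.
Proof. by rewrite tactD -scaleN1r tactZ scaleN1r. Qed.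

Lemma tact0 m : tact 0 m = 0.
Proof. by rewrite -(subrr 0) tactB subrr. Qed.

Lemma tactDr p : {morph tact p : m n / m + n}.
Proof.
move=> m n; rewrite /tact -big_split /=.
by apply: eq_bigr => w _; rewrite wactD scalerDr.
Qed.

Lemma tactZr p a : {morph tact p : m / a *: m}.
Proof.
move=> m; rewrite /tact scaler_sumr.
by apply: eq_bigr => w _; rewrite wactZ !scalerA mulrC.
Qed.

Lemma tactr0 p : tact p 0 = 0.
Proof. by have := tactZr p 0 0; rewrite !scale0r. Qed.

Lemma tactM p q m : tact (p * q) m = tact p (tact q m).
Proof.
rewrite malgME (big_morph (fun r => tact r m) (fun r s => tactD r s m) (tact0 m)).
rewrite [RHS]/tact; apply: eq_bigr => w _.
rewrite (big_morph (fun r => tact r m) (fun r s => tactD r s m) (tact0 m)).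
rewrite [tact q m]/tact (big_morph (wact w) (wactD w) (wact0 w)) scaler_sumr.
apply: eq_bigr => v _; rewrite tactU wactZ scalerA; congr (_ *: _).
by rewrite /mmul /= fmmulE /wact foldr_cat.
Qed.

Lemma tact1 m : tact 1 m = m.
Proof. by rewrite tactU scale1r /mone /= fmoneE. Qed.

Lemma tact_fgen x m : tact (fgen x) m = lact x m.
Proof. by rewrite tactU scale1r fmuE. Qed.

Lemma tact_env_ideal p m : p \in env_ideal -> tact p m = 0.
Proof.
move=> Ip; have : (fun p => forall m, tact p m = 0) p; last exact.
move: p Ip {m}; apply: env_ideal_sub.
  split=> [m|p q Hp Hq m|p q Hq m|p q Hp m]; first exact: tact0.
  - by rewrite tactB Hp Hq subrr.
  - by rewrite tactM Hq tactr0.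
  - by rewrite tactM Hp.
move=> p [[x [y ->]]|[[a [x ->]]|[x [y ->]]]] m.
- by rewrite tactB tactD !tact_fgen lactDl subrr.
- by rewrite tactB tactZ !tact_fgen lactZl subrr.
- by rewrite !tactB !tactM !tact_fgen lact_lie subrr.
Qed.

Lemma uactE p m : uact (Upi p) m = tact p m.
Proof. by apply/subr0_eq; rewrite -tactB; apply/tact_env_ideal/Urepr. Qed.

Lemma uact_in x m : uact (Uin x) m = lact x m.
Proof. by rewrite uactE tact_fgen. Qed.

Lemma uact1 m : uact 1 m = m.
Proof. by rewrite [LHS](uactE 1) tact1. Qed.

Lemma uactM u v m : uact (u * v) m = uact u (uact v m).
Proof.
elim/quotW: u => p; elim/quotW: v => q.
by rewrite [_ * _](UpiM p q) !uactE tactM.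
Qed.

Lemma uactD u v m : uact (u + v) m = uact u m + uact v m.
Proof. by elim/quotW: u => p; elim/quotW: v => q; rewrite -UpiD !uactE tactD. Qed.

Lemma uactZ a u m : uact (a *: u) m = a *: uact u m.
Proof. by elim/quotW: u => p; rewrite [_ *: _](UpiZ a p) !uactE tactZ. Qed.

Lemma uactDr u : {morph uact u : m n / m + n}.
Proof. exact: tactDr. Qed.

Lemma uactZr u a : {morph uact u : m / a *: m}.
Proof. exact: tactZr. Qed.

End Envelope.

(* Linear algebra in possibly infinite-dimensional spaces; subspaces are sets. *)
Section Subspaces.
Variables (K : fieldType) (M : lmodType K).
Implicit Types (V W : set M) (E : set (M -> M)).

Definition linear_subspace V : Prop :=
  V 0 /\ forall (a : K) m n, V m -> V n -> V (a *: m + n).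

Definition is_basis V d (b : 'I_d -> M) : Prop :=
  (forall i, V (b i)) /\
  forall m, V m -> exists! c : 'rV[K]_d, m = \sum_i c 0 i *: b i.

Definition has_dim V (d : nat) : Prop := exists b : 'I_d -> M, is_basis V b.

Definition is_trace V (f : M -> M) (t : K) : Prop :=
  exists d (b : 'I_d -> M) (A : 'M[K]_d),
    [/\ is_basis V b, forall i, f (b i) = \sum_j A i j *: b j & t = \tr A].

(* The value 0 is junk, for V not finite-dimensional or not stable under f. *)
Definition trace_on V f : K := xget 0 [set t | is_trace V f t].

Definition direct_sum (I : choiceType) (V : I -> set M) : Prop :=
  (forall m, exists (s : seq I) (f : I -> M),
     [/\ uniq s, {in s, forall i, V i (f i)} & m = \sum_(i <- s) f i]) /\
  (forall (s : seq I) (f : I -> M), uniq s -> {in s, forall i, V i (f i)} ->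
     \sum_(i <- s) f i = 0 -> {in s, forall i, f i = 0}).

Definition submodule_for E V : Prop :=
  linear_subspace V /\ forall f, E f -> forall m, V m -> V (f m).

Definition simple_for E V : Prop :=
  [/\ submodule_for E V, V <> [set 0]
    & forall W, submodule_for E W -> W `<=` V -> W = [set 0] \/ W = V].

End Subspaces.

Section SimpleLie.
Variables (K : fieldType) (g : lieAlgType K).
Implicit Types (h V W I : {vspace g}).

(* [V, W], the span of all brackets; by bilinearity bases suffice. *)
Definition lie_span V W : {vspace g} :=
  <<[seq lie x y | x <- vbasis V, y <- vbasis W]>>%VS.

Definition simple_lie : Prop :=
  lie_span fullv fullv != 0%VS /\
  forall I, (lie_span fullv I <= I)%VS -> I = 0%VS \/ I = fullv.

Fixpoint lower_central h (n : nat) : {vspace g} :=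
  if n is n'.+1 then lie_span h (lower_central h n') else h.

(* A nilpotent self-normalizing subalgebra. *)
Definition cartan_subalgebra h : Prop :=
  [/\ (lie_span h h <= h)%VS,
      exists n, lower_central h n = 0%VS
    & forall x, {in h, forall y, lie x y \in h} -> x \in h].

Definition iso_matrix_lie n (S : set 'M[K]_n) : Prop :=
  exists f : {linear g -> 'M[K]_n},
    [/\ injective f, range f = S
      & forall x y, f (lie x y) = f x *m f y - f y *m f x].

Definition symplectic_form l : 'M[K]_(l + l) :=
  block_mx 0 1%:M (- 1%:M) 0.

(* sl_(l+1) *)
Definition type_A (l : nat) : Prop :=
  iso_matrix_lie [set X : 'M[K]_l.+1 | \tr X = 0].

(* sp_(2l) *)
Definition type_C (l : nat) : Prop :=
  iso_matrix_lie [set X : 'M[K]_(l + l) |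
    X^T *m symplectic_form l + symplectic_form l *m X = 0].

Definition type_A_or_C : Prop :=
  exists2 l, (0 < l)%N & type_A l \/ type_C l.

End SimpleLie.

Section WeightModules.
Variables (K : fieldType) (g : lieAlgType K) (h : {vspace g}).

(* The dual of h. *)
Definition weight := 'Hom(subvs_of h, K^o).
Implicit Types (lam mu : weight).

Definition is_root lam : Prop :=
  lam != 0 /\
  exists2 x : g, x != 0 & forall y : subvs_of h, lie (vsval y) x = (lam y : K) *: x.

Definition subgroup (S : set weight) : Prop :=
  S 0 /\ forall lam mu, S lam -> S mu -> S (lam - mu).

Definition root_lattice : set weight := smallest subgroup is_root.

Definition cofinite (U : set weight) : Prop := finite_set (~` U).

Definition polynomial_fun (F : weight -> K) : Prop :=
  exists n (x : 'I_n -> subvs_of h) (p : mpoly.mpoly n K),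
    forall lam, F lam = mpoly.meval (fun i => lam (x i)) p.

Definition subalgebra (S : set (Uenv g)) : Prop :=
  [/\ S 1, forall (a : K) u v, S u -> S v -> S (a *: u + v)
    & forall u v, S u -> S v -> S (u * v)].

(* U(h), identified with the subalgebra of U(g) generated by h. *)
Definition Ucartan : set (Uenv g) :=
  smallest subalgebra [set Uin x | x in [set` h]].

(* The commutant of U(h) in U(g). *)
Definition U0 : set (Uenv g) :=
  [set u | forall v, Ucartan v -> u * v = v * u].

Section Module.
Variable M : lieModType g.

Definition weight_space lam : set M :=
  [set m | forall x : subvs_of h, lact (vsval x) m = (lam x : K) *: m].

Definition weight_module : Prop :=
  direct_sum weight_space /\ forall lam, exists d, has_dim (weight_space lam) d.

Definition weight_trace (u : Uenv g) lam : K :=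
  trace_on (weight_space lam) (uact u).

Definition simple_U0 lam : Prop :=
  simple_for [set uact (M := M) u | u in U0] (weight_space lam).

Definition semisimple_module : Prop :=
  exists (I : choiceType) (V : I -> set M),
    (forall i, simple_for (range (fun x : g => lact x)) (V i)) /\ direct_sum V.

Definition coherent_family (d : nat) : Prop :=
  [/\ weight_module, forall lam, has_dim (weight_space lam) d
    & forall u, U0 u -> polynomial_fun (weight_trace u)].

Definition irreducible_coherent_family : Prop :=
  (exists d, coherent_family d) /\ exists lam, simple_U0 lam.

Definition U_coherent_family (U : set weight) (d : nat) : Prop :=
  [/\ weight_module, forall lam, U lam -> has_dim (weight_space lam) d
    & forall u, U0 u -> exists2 P, polynomial_fun P &
        forall lam, U lam -> weight_trace u lam = P lam].

Definition irreducible_almost_coherent_family : Prop :=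
  exists U, [/\ cofinite U, exists d, U_coherent_family U d
    & exists2 lam, (forall mu, root_lattice mu -> U (lam + mu)) & simple_U0 lam].

End Module.

Definition almost_equivalent (M N : lieModType g) : Prop :=
  exists2 U, cofinite U & forall lam u, U lam -> U0 u ->
    weight_trace M u lam = weight_trace N u lam.

End WeightModules.

Definition module_iso (K : fieldType) (g : lieAlgType K) (M N : lieModType g) : Prop :=
  exists f : {linear M -> N}, bijective f /\ forall x m, f (lact x m) = lact x (f m).

(* Main.v *)
(* Let Phi lam u be the trace of u in U(g)_0 on the weight space of weight lam;
   for the given family it is polynomial in lam off a finite set, hence extends
   to all weights.  Polynomial identities between traces extend along lines:
   linearity, Phi lam (u v) = Phi (lam + al) (v u) for u, v of opposite degrees
   -al and al, and, through Newton's identities, Cayley-Hamilton in degree d.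
   So in the quotient of U(g)_0 by the radical of the trace form at lam, 1 is a
   sum of orthogonal primitive idempotents e whose traces n(e) are positive
   integers.  Linking idempotents e, e' of weights lam, lam' when e' U(g) e is
   not in the radical, the matrix coefficients of U(g) between linked
   idempotents define a module with one basis vector for each idempotent e and
   each k < n(e).  It is semisimple and has trace Phi.  If Phi lam is the trace
   of a simple module, then the idempotents at lam are all linked and have trace
   1, so that the weight space is simple.  For uniqueness, an element of the
   radical has vanishing power sums of eigenvalues, so it acts nilpotently; it
   therefore kills any semisimple module with trace Phi, and the idempotents
   and the links between them recover the module above. *)
From HB Require Import structures.
From mathcomp Require Import all_boot all_order all_algebra.
From mathcomp Require Import finmap ring zify.
From mathcomp Require Import boolp classical_sets functions cardinality.
From mathcomp Require Import reals complex.
From mathcomp.multinomials Require Import monalg.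
From mathcomp.multinomials Require mpoly.
Require Import Defs.

Set Implicit Arguments.
Unset Strict Implicit.
Unset Printing Implicit Defensive.

Import Order.TTheory GRing.Theory Num.Theory.
Local Open Scope classical_set_scope.
Local Open Scope ring_scope.

(** * Newton's identities *)

(** Outside [U] only traces are under control, so the structure at an excluded weight must come from
    identities between traces. Cayley-Hamilton is one: its coefficients are polynomials in the
    traces of powers, and multiplying by a test element [b] and taking the trace leaves a scalar
    identity. With [b = a] it says that Newton coefficient number [d + 1] vanishes; for an
    idempotent of trace [t] this is, up to sign, the binomial coefficient of [t] over [d + 1], so
    [t] is one of [0, ..., d]. This integer replaces dimension as the measure that makes
    decompositions into idempotents stop. The radical depends on the weight, while an element of
    degree [al] leads from weight [lam] to [al + lam]. Arrows between weights thus do not live in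
    one quotient ring; their relations are congruences [eqr] tagged by the source weight. The
    grading of U(g) is extracted from the given module: it is faithful because g is simple, and [h]
    is abelian and diagonalizable on g because it acts diagonally on the module. Self-normalization
    makes [h] nonzero, so that lines through weights exist. *)

Section Newton.
Variable K : numFieldType.
Implicit Types (p : nat -> K) (s : seq K).

(** Each coefficient depends on all earlier ones, so the recursion carries their whole list. *)
Fixpoint newton_seq p n : seq K :=
  if n is m.+1 then
    let s := newton_seq p m in
    rcons s (- m.+1%:R^-1 * \sum_(i < m.+1) s`_(m - i)%N * p i.+1)
  else [:: 1].

(* The coefficient of ['X^(d - n)] in the monic polynomial of degree [d] whose
   roots have power sums [p], by Newton's identities; [p 0] is not used. *)
Definition newton p n : K := (newton_seq p n)`_n.

Lemma size_newton_seq p n : size (newton_seq p n) = n.+1.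
Proof. by elim: n => //= n IH; rewrite size_rcons IH. Qed.

Lemma newton_seqE p n m : (m <= n)%N -> (newton_seq p n)`_m = newton p m.
Proof.
elim: n => [|n IH]; first by rewrite leqn0 => /eqP ->.
rewrite leq_eqVlt => /orP[/eqP -> //|ltmn].
by rewrite /= nth_rcons size_newton_seq ltmn IH.
Qed.

Lemma newton0 p : newton p 0 = 1. Proof. by []. Qed.

Lemma newtonS p n :
  newton p n.+1 = - n.+1%:R^-1 * \sum_(i < n.+1) newton p (n - i)%N * p i.+1.
Proof.
rewrite /newton /= nth_rcons size_newton_seq ltnn eqxx; congr (_ * _).
by apply: eq_bigr => i _; rewrite newton_seqE // leq_subr.
Qed.

Lemma eq_newton p q : (forall n, p n.+1 = q n.+1) -> newton p =1 newton q.
Proof.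
move=> epq n; have [m] := ubnP n; elim: m n => // m IH [|n] //; rewrite ltnS => le.
rewrite !newtonS; congr (_ * _); apply: eq_bigr => i _; rewrite epq IH //.
by rewrite (leq_ltn_trans (leq_subr _ _)).
Qed.

(** The identities determine the coefficients one after the other, since [n.+1] is invertible in
    characteristic zero. *)
Lemma newton_unique p (c : nat -> K) : c 0 = 1 ->
  (forall n, n.+1%:R * c n.+1 + \sum_(i < n.+1) c (n - i)%N * p i.+1 = 0) ->
  newton p =1 c.
Proof.
move=> c0 cS n; have [m] := ubnP n.
elim: m n => // m IH [|n] //; rewrite ltnS => le.
have n1 : n.+1%:R != 0 :> K by rewrite pnatr_eq0.
apply: (mulfI n1); rewrite newtonS mulNr mulrN mulVKf //.
apply/eqP; rewrite eq_sym -addr_eq0 -[X in _ == X](cS n); apply/eqP; congr (_ + _).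
apply: eq_bigr => i _; rewrite IH //.
by rewrite (leq_ltn_trans (leq_subr _ _)).
Qed.

(** Coefficient of [X^n] in the product of the factors [1 - r X], multiplied in one at a time; up to
    sign, an elementary symmetric function of the roots. *)
Fixpoint root_coefs s n : K :=
  if s is r :: s' then
    root_coefs s' n - r * (if n is m.+1 then root_coefs s' m else 0)
  else (n == 0)%:R.

Lemma root_coefs0 s : root_coefs s 0 = 1.
Proof. by elim: s => //= r s ->; rewrite mulr0 subr0. Qed.

Lemma root_coefs_gt s n : (size s < n)%N -> root_coefs s n = 0.
Proof.
elim: s n => [|r s IH] [|n] //= lt.
by rewrite !IH ?mulr0 ?subr0 // ltnW.
Qed.

(** Newton's identities, by induction on the roots. A new root [r] replaces [a n] by
    [a n - r * a (n - 1)] and adds [r ^+ i] to the power sums; the induction hypothesis at [n] and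
    at [n - 1] accounts for everything except a sum that telescopes. *)
Lemma root_coefsP s n : n.+1%:R * root_coefs s n.+1
  + \sum_(i < n.+1) root_coefs s (n - i)%N * (\sum_(r <- s) r ^+ i.+1) = 0.
Proof.
elim: s n => [|r s IH] n /=.
  by rewrite mulr0 add0r big1 // => i _; rewrite big_nil mulr0.
pose a := root_coefs s; pose p i := \sum_(x <- s) x ^+ i.
pose a' k := if k is m.+1 then a m else 0.
(* The subtracted half of each term is the first half of the next one; only [r * a m] remains,
   [a' 0] being 0. *)
have tele m : \sum_(i < m.+1) (a (m - i)%N - r * a' (m - i)%N) * r ^+ i.+1 = r * a m.
  under eq_bigr do rewrite mulrBl.
  rewrite big_split /= sumrN [X in X - _]big_ord_recl /= subn0 expr1 mulrC -addrA.
  rewrite [X in _ - X]big_ord_recr /= subnn mulr0 mul0r addr0.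
  apply/eqP; rewrite -subr_eq0 addrAC subrr add0r subr_eq0; apply/eqP.
  apply: eq_bigr => i _; rewrite /bump /= add1n.
  have -> : (m - i = (m - i.+1).+1)%N by rewrite subnSK.
  by rewrite /a' [r ^+ i.+2]exprS; ring.
transitivity ((n.+1%:R * a n.+1 + \sum_(i < n.+1) a (n - i)%N * p i.+1)
   - r * (n%:R * a n + \sum_(i < n.+1) a' (n - i)%N * p i.+1)
   + (\sum_(i < n.+1) (a (n - i)%N - r * a' (n - i)%N) * r ^+ i.+1 - r * a n)).
  rewrite [X in _ + X = _](_ : _ =
     \sum_(i < n.+1) a (n - i)%N * p i.+1 - r * \sum_(i < n.+1) a' (n - i)%N * p i.+1
     + \sum_(i < n.+1) (a (n - i)%N - r * a' (n - i)%N) * r ^+ i.+1); last first.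
    rewrite mulr_sumr -sumrB -big_split /=; apply: eq_bigr => i _.
    transitivity ((a (n - i)%N - r * a' (n - i)%N) * (r ^+ i.+1 + p i.+1)); last by ring.
    by rewrite big_cons.
  by rewrite -/a; ring.
rewrite tele subrr addr0 IH sub0r; apply/eqP; rewrite oppr_eq0 mulf_eq0; apply/orP; right.
case: n => [|n]; first by rewrite mul0r add0r big_ord_recl big_ord0 mul0r addr0.
rewrite big_ord_recr /= subnn mul0r addr0; apply/eqP; rewrite -[RHS](IH n).
by congr (_ + _); apply: eq_bigr => i _; rewrite subSn // -ltnS.
Qed.

Lemma newton_power_sums s : newton (fun i => \sum_(r <- s) r ^+ i) =1 root_coefs s.
Proof. by apply: newton_unique; [exact: root_coefs0|exact: root_coefsP]. Qed.

Lemma prod_XsubC_root_coefs (s : seq K) :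
  \prod_(r <- s) ('X - r%:P) =
  \sum_(k < (size s).+1) root_coefs s k *: 'X^(size s - k).
Proof.
elim: s => [|r s IH]; first by rewrite big_nil big_ord1 /= scale1r expr0.
rewrite big_cons IH [size (r :: s)]/= mulrBl.
pose a := root_coefs s.
transitivity ('X * (\sum_(k < (size s).+1) a k *: 'X^(size s - k)) +
   \sum_(k < (size s).+1) (- r * a k) *: 'X^(size s - k)).
  congr (_ + _); rewrite mulr_sumr -sumrN; apply: eq_bigr => k _.
  by rewrite mul_polyC scalerA mulNr scaleNr.
rewrite [RHS]big_ord_recl /= mulr0 subr0 root_coefs0 big_ord_recl /= mulrDr mulr_sumr.
rewrite {1}/a root_coefs0 !scale1r subn0 -exprS -addrA; congr (_ + _).
have -> : \sum_(i < (size s).+1)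
   (root_coefs s (bump 0 i) - r * root_coefs s i) *: 'X^((size s).+1 - bump 0 i)
   = \sum_(i < (size s).+1) a i.+1 *: 'X^(size s - i) +
     \sum_(i < (size s).+1) (- r * a i) *: 'X^(size s - i).
  rewrite -big_split /=; apply: eq_bigr => i _.
  by rewrite -scalerDl mulNr /bump /= add1n subSS.
congr (_ + _); rewrite [RHS]big_ord_recr /= [a (size s).+1]root_coefs_gt // scale0r addr0.
apply: eq_bigr => i _; rewrite /bump /= add1n -scalerAr -exprS subnSK //.
Qed.

End Newton.

Section NewtonMatrix.
Variable K : numClosedFieldType.

Lemma trig_mx_mul n (A B : 'M[K]_n) : is_trig_mx A -> is_trig_mx B ->
  is_trig_mx (A *m B) /\ forall i, (A *m B) i i = A i i * B i i.
Proof.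
move=> /is_trig_mxP trA /is_trig_mxP trB; split=> [|i].
  apply/is_trig_mxP => i j ltij; rewrite mxE big1 // => k _.
  by case: (ltnP i k) => [/trA->|leki]; rewrite ?mul0r // trB ?mulr0 // (leq_ltn_trans leki).
rewrite mxE (bigD1 i) //= big1 ?addr0 // => k neq.
case: (ltngtP i k) => [/trA->|/trB->|eik]; rewrite ?mul0r ?mulr0 //.
by case/eqP: neq; apply: val_inj.
Qed.

Lemma trig_mx_exp n (A : 'M[K]_n.+1) k : is_trig_mx A ->
  is_trig_mx (A ^+ k) /\ forall i, (A ^+ k) i i = A i i ^+ k.
Proof.
move=> trA; elim: k => [|k [trk IH]].
  split=> [|i]; first exact: scalar_mx_is_trig.
  by rewrite !expr0 mxE eqxx.
rewrite exprS; have [tr eqi] := trig_mx_mul trA trk.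
by split=> // i; rewrite eqi IH exprS.
Qed.

(** The powers of a triangular matrix carry the powers of its diagonal entries, so their traces are
    the power sums of the roots of the characteristic polynomial. *)
Lemma newton_Cayley_Hamilton_trig n (T : 'M[K]_n.+1) : is_trig_mx T ->
  \sum_(k < n.+2) newton (fun i => \tr (T ^+ i)) k *: T ^+ (n.+1 - k) = 0.
Proof.
move=> trT; pose s := [seq T i i | i <- enum 'I_n.+1].
have sz : size s = n.+1 by rewrite size_map size_enum_ord.
have cpE : char_poly T = \prod_(r <- s) ('X - r%:P).
  by rewrite char_poly_trig // big_map big_enum.
rewrite -[RHS](Cayley_Hamilton T) cpE prod_XsubC_root_coefs sz rmorph_sum /=.
apply: eq_bigr => k _; rewrite linearZ /= rmorphXn /= horner_mx_X; congr (_ *: _).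
rewrite -newton_power_sums; apply: eq_newton => i.
rewrite big_map big_enum; apply: eq_bigr => j _.
by have [_ ->] := trig_mx_exp i.+1 trT.
Qed.

Lemma newton_Cayley_Hamilton n (A : 'M[K]_n.+1) :
  \sum_(k < n.+2) newton (fun i => \tr (A ^+ i)) k *: A ^+ (n.+1 - k) = 0.
Proof.
(* [cotrigonalization2] triangularizes a commuting pair; here both members are [A]. *)
have [P Pu /andP[simA _]] := cotrigonalization2 (erefl (A *m A)).
have Punit := unitarymx_unit Pu.
pose T := P *m A *m invmx P.
have trT : is_trig_mx T by move: simA; rewrite /similar_to /= conjumx.
have eTA i : T ^+ i = P *m A ^+ i *m invmx P.
  elim: i => [|i IH]; first by rewrite !expr0 mulmx1 mulmxV.
  by rewrite !exprS IH /T -!mulmxE !mulmxA mulmxKV.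
have := newton_Cayley_Hamilton_trig trT.
under eq_bigr => k _ do rewrite eTA scalemxAl scalemxAr.
rewrite -mulmx_suml -mulmx_sumr => /(congr1 (fun X => invmx P *m X *m P)).
rewrite !mulmxA mulVmx // mul1mx -mulmxA mulVmx // mulmx1 mulmx0 mul0mx => E.
rewrite -[RHS]E.
apply: eq_bigr => k _; congr (_ *: _); apply: eq_newton => i.
by rewrite eTA mxtrace_mulC mulmxA mulVmx ?mul1mx.
Qed.

End NewtonMatrix.

Section NewtonSpecial.
Variable K : numFieldType.
Implicit Types (p : nat -> K).

Lemma newtonS_mul p n :
  n.+1%:R * newton p n.+1 = - \sum_(i < n.+1) newton p (n - i)%N * p i.+1.
Proof. by rewrite newtonS mulNr mulrN mulVKf // pnatr_eq0. Qed.

(** The recurrence of the coefficients of [(1 - X)^t]: coefficient [n] is [(-1)^n] times the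
    binomial coefficient of [t] over [n], which vanishes only if [t] is a natural number below
    [n]. *)
Lemma newton_const p t : (forall i, p i.+1 = t) ->
  forall n, n.+1%:R * newton p n.+1 = (n%:R - t) * newton p n.
Proof.
move=> pt; have sumE n : n.+1%:R * newton p n.+1 = - t * \sum_(i < n.+1) newton p i.
  rewrite newtonS_mul mulNr mulr_sumr; congr (- _).
  rewrite [RHS](reindex_inj rev_ord_inj) /=; apply: eq_bigr => i _.
  by rewrite pt mulrC subSS.
case=> [|n]; first by rewrite sumE big_ord1 sub0r.
by rewrite sumE big_ord_recr /= mulrDr -sumE -mulrDl.
Qed.

(** The recurrence of the coefficients of [exp (- p 1 * X)]: coefficient [n] is [(- p 1)^n / n!]. *)
Lemma newton_single p : (forall i, p i.+2 = 0) ->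
  forall n, n.+1%:R * newton p n.+1 = - p 1%N * newton p n.
Proof.
move=> p0 n; rewrite newtonS_mul big_ord_recl big1 /= ?addr0 ?subn0.
  by rewrite mulNr mulrC.
by move=> i _; rewrite p0 mulr0.
Qed.

Lemma newton_const_eq0 p t : (forall i, p i.+1 = t) ->
  forall n, newton p n = 0 -> exists2 m, (m < n)%N & t = m%:R.
Proof.
move=> pt; elim=> [/eqP|n IH c0]; first by rewrite oner_eq0.
have /eqP := newton_const pt n; rewrite c0 mulr0 eq_sym mulf_eq0 subr_eq0.
case/orP => [/eqP <-|/eqP/IH[m lt ->]]; first by exists n.
by exists m => //; apply: ltnW.
Qed.

Lemma newton_single_eq0 p : (forall i, p i.+2 = 0) ->
  forall n, newton p n = 0 -> p 1%N = 0.
Proof.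
move=> p0; elim=> [/eqP|n IH c0]; first by rewrite oner_eq0.
have /eqP := newton_single p0 n; rewrite c0 mulr0 eq_sym mulf_eq0 oppr_eq0.
by case/orP => [/eqP|/eqP/IH].
Qed.

Lemma newton_zero p : (forall i, p i.+1 = 0) -> forall n, newton p n.+1 = 0.
Proof. by move=> p0 n; rewrite newtonS big1 ?mulr0 // => i _; rewrite p0 mulr0. Qed.

End NewtonSpecial.

(** * Algebras with a nondegenerate trace *)

Section TraceAlgebra.
Variables (K : numClosedFieldType) (B : algType K) (d : nat) (T : {scalar B}).
Hypothesis TC : forall a b, T (a * b) = T (b * a).
Hypothesis T_nondeg : forall a, (forall b, T (a * b) = 0) -> a = 0.
Hypothesis T_CH : forall a,
  \sum_(k < d.+1) newton (fun i => T (a ^+ i)) k *: a ^+ (d - k) = 0.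

(** Cayley-Hamilton times [a], under the trace, is Newton's identity of order [d + 1] without its
    leading term. Integrality for idempotents and vanishing for nilpotents both come from it. *)
Lemma newton_trace_top a : newton (fun i => T (a ^+ i)) d.+1 = 0.
Proof.
apply: (@mulfI _ d.+1%:R); first by rewrite pnatr_eq0.
rewrite mulr0 newtonS_mul (reindex_inj rev_ord_inj) /=.
have := congr1 (fun x => T (x * a)) (T_CH a).
rewrite mul0r raddf0 mulr_suml raddf_sum /= => E; apply/eqP.
rewrite oppr_eq0 -[X in _ == X]E; apply/eqP; apply: eq_bigr => i _.
by rewrite -scalerAl linearZ /= -exprSr subSS subKn // -ltnS.
Qed.

Lemma idem_exp (e : B) i : e * e = e -> e ^+ i.+1 = e.
Proof. by move=> ee; elim: i => [//|i IH]; rewrite exprS IH ee. Qed.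

(** All powers of [e] are [e], so the power sums are constant and [newton_const_eq0] applies. If the
    trace is 0, Cayley-Hamilton reduces to [e ^+ d = 0]. *)
Lemma idem_trace (e : B) : e * e = e -> exists2 n : nat, T e = n%:R & (n = 0)%N -> e = 0.
Proof.
move=> ee; have p_const i : T (e ^+ i.+1) = T e by rewrite idem_exp.
have [n _ Te] := newton_const_eq0 p_const (newton_trace_top e).
exists n => // n0; rewrite {}n0 {n} in Te.
have := T_CH e; rewrite big_ord_recl newton0 scale1r subn0 big1; last first.
  by move=> i _; rewrite newton_zero ?scale0r // => j; rewrite p_const.
(* For [d = 0] the identity reads [1 = 0], which is impossible; otherwise [e ^+ d] is [e]. *)
rewrite addr0; case: d => [/eqP|n]; first by rewrite expr0 oner_eq0.
by rewrite idem_exp.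
Qed.

(** Descending induction on the exponent: once the traces of higher powers vanish, the power sums of
    [b = a ^+ i.+1] are zero from the second on, and coefficient [d + 1] is a nonzero multiple of
    [T b ^+ d.+1]. *)
Lemma nilp_trace (a : B) k : a ^+ k = 0 -> T a = 0.
Proof.
move=> ak; suff: forall m i, (i.+1 + m >= k)%N -> T (a ^+ i.+1) = 0.
  by move=> /(_ k 0%N); rewrite expr1; apply; rewrite leq_addl.
elim=> [|m IH] i; first by rewrite addn0 => le; rewrite -(subnK le) exprD ak mulr0 raddf0.
move=> le.
rewrite -[LHS](congr1 T (expr1 (a ^+ i.+1))).
apply: (newton_single_eq0 _ (newton_trace_top (a ^+ i.+1))) => j.
rewrite -exprM mulnC mulSn; apply: (IH _ (leq_trans le _)).
by rewrite addnS -addSn leq_add2r -[i.+2]addn1 leq_add2l.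
Qed.
 
Definition prim (e : B) := [/\ e * e = e, e <> 0 &
  forall f, f * f = f -> e * f = f -> f * e = f -> f = 0 \/ f = e].

Lemma horner_alg_corner (e a : B) (p : {poly K}) : e * a = a -> a * e = a -> 
  e * horner_alg a p = horner_alg a p * e.
Proof.
move=> ea ae; rewrite -[p]coefK poly_def !raddf_sum /= mulr_sumr mulr_suml.
apply: eq_bigr => i _; rewrite linearZ /= rmorphXn /= horner_algX mulr_algl -scalerAr -scalerAl.
congr (_ *: _); elim: (i : nat) => [|k IH]; first by rewrite expr0 mulr1 mul1r.
by rewrite exprS mulrA ea -mulrA -IH mulrA ae.
Qed.

(** Fitting's lemma in the corner of [e], with an annihilating polynomial in place of finite
    dimension. If [p = q * (X - c)^m] with coprime factors annihilates [a], Bezout gives an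
    idempotent [f] of the corner separating the factors. By primitivity it is 0 or [e], so one
    factor alone annihilates: the power of [X - c], as wanted, or [q], of smaller degree. *)
Lemma prim_corner (e a : B) : prim e -> e * a = a -> a * e = a ->
  exists c m, (a - c *: e) ^+ m = 0.
Proof.
move=> [ee e0 prim_e] ea ae.
pose ev := horner_alg a.
have evM p q : ev (p * q) = ev p * ev q by rewrite /ev rmorphM.
have evC p : e * ev p = ev p * e by exact: horner_alg_corner.
suff main : forall n (p : {poly K}), (size p <= n)%N -> p != 0 -> ev p * e = 0 ->
    exists c m, (a - c *: e) ^+ m = 0.
  (* The induction starts from the Cayley-Hamilton polynomial, monic of degree [d] and hence
     nonzero. *)
  pose p := \sum_(k < d.+1) newton (fun i => T (a ^+ i)) k *: 'X^(d - k).
  have evp : ev p = 0.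
    rewrite -[RHS](T_CH a) /ev raddf_sum /=; apply: eq_bigr => k _.
    by rewrite linearZ /= rmorphXn /= horner_algX mulr_algl.
  apply: (main _ p (leqnn _)); last by rewrite evp mul0r.
  apply/eqP => /(congr1 (fun q : {poly K} => q`_d)); rewrite coef0 coef_sum.
  rewrite big_ord_recl big1 /= ?newton0 => [|i _].
    by rewrite addr0 scale1r subn0 coefXn eqxx => /eqP; rewrite oner_eq0.
  rewrite coefZ coefXn /bump /= add1n.
  case: eqP => [E|]; last by rewrite mulr0.
  by exfalso; move: E (ltn_ord i); lia.
elim=> [|n IH] p szp p0 evp; first by rewrite -size_poly_leq0 szp in p0.
have [sz1|sz1] := leqP (size p) 1%N.
  exfalso; apply: e0; have [c c0 pE] : exists2 c, c != 0 & p = c%:P.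
    by apply/size_poly1P; rewrite eqn_leq sz1 size_poly_gt0.
  by move: evp; rewrite pE /ev horner_algC -scalerAl mul1r => /eqP; rewrite scaler_eq0 (negPf c0) => /eqP.
have [c rc] : exists c, root p c by apply/closed_rootP; rewrite neq_ltn sz1 orbT.
have [m [q qc pE]] := multiplicity_XsubC p c; rewrite p0 /= in qc.
have m0 : (0 < m)%N.
  by case: (m) pE => // pE; move: rc; rewrite pE expr0 mulr1 (negPf qc).
have q0 : q != 0 by apply: contraNneq qc => ->; rewrite root0.
have szq : (size q <= n)%N.
  rewrite -ltnS (leq_trans _ szp) // pE size_Mmonic ?monic_exp ?monicXsubC //.
  by rewrite size_exp_XsubC addnS /=; case: m m0 {pE} => // m _; rewrite addnS ltnS leq_addr.
have : coprimep (('X - c%:P) ^+ m) q by rewrite coprimep_expl // coprimep_sym coprimep_XsubC.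
case/Bezout_eq1_coprimepP => -[u v] /= uv.
pose r := ('X - c%:P) ^+ m.
pose f := ev (u * r) * e.
have evq : ev (q * r) * e = 0 by rewrite -pE.
have e_split : e = f + ev (v * q) * e.
  by rewrite -mulrDl -[X in X * e]rmorphD /= uv rmorph1 mul1r.
have rE : ev r = (a - c%:A) ^+ m.
  by rewrite /ev rmorphXn rmorphB /= horner_algX horner_algC.
case: (prim_e f).
- have: f * (ev (v * q) * e) = 0.
    rewrite /f mulrA -[_ * e * _]mulrA evC -2!mulrA ee mulrA -evM.
    have -> : u * r * (v * q) = u * v * (q * r) by ring.
    by rewrite evM -mulrA evq mulr0.
  have fe : f * e = f by rewrite /f -mulrA ee.
  by rewrite {1}e_split in fe => f0; rewrite -[RHS]fe mulrDr f0 addr0.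
- by rewrite /f mulrA evC -mulrA ee.
- by rewrite /f -mulrA ee.
- move=> f0; exists c, m.
  have re0 : ev r * e = 0.
    rewrite e_split f0 add0r mulrA -evM; have -> : r * (v * q) = v * (q * r) by ring.
    by rewrite evM -mulrA evq mulr0.
  rewrite rE in re0.
  have key : (a - c *: e) = (a - c%:A) * e by rewrite mulrBl ae -scalerAl mul1r.
  have expE k : (a - c *: e) ^+ k.+1 = (a - c%:A) ^+ k.+1 * e.
    elim: k => [|k IHm]; first by rewrite !expr1.
    rewrite exprSr IHm [in RHS]exprSr -!mulrA; congr (_ * _).
    by rewrite mulrBr ea -scalerAr ee key.
  by rewrite -(prednK m0) expE (prednK m0) re0.
- move=> fe; apply: (IH q szq q0).
  have: e - f = 0 by rewrite fe subrr.
  rewrite {1}e_split addrAC subrr add0r => vq0.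
  have evq' : ev q * f = 0.
    rewrite /f mulrA -evM; have -> : q * (u * r) = u * (q * r) by ring.
    by rewrite evM -mulrA evq mulr0.
  by rewrite -fe.
Qed.

Lemma prim_trace_neq0 (e : B) : prim e -> T e != 0.
Proof.
case=> ee e0 _; have [n -> n0] := idem_trace ee.
by rewrite pnatr_eq0; apply/eqP => /n0.
Qed.

(** Nilpotents have trace 0, so the scalar [c] of [prim_corner] satisfies [c * T e = T x = 0]. *)
Lemma prim_corner_nilp (e x : B) : prim e -> e * x = x -> x * e = x -> T x = 0 ->
  exists m, x ^+ m = 0.
Proof.
move=> pe ex xe Tx; have [c [m xm]] := prim_corner pe ex xe.
have /eqP := nilp_trace xm; rewrite raddfB /= linearZ /= Tx sub0r oppr_eq0 mulf_eq0.
rewrite (negPf (prim_trace_neq0 pe)) orbF => /eqP c0.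
by exists m; rewrite c0 scale0r subr0 in xm.
Qed.

(** [x] is nilpotent; if it is not zero, let [z] be its last nonzero power, so that [z * x = 0].
    Were [T (x * b)] nonzero, the corner element [y = x * (e * b * e)] would be a nonzero scalar
    plus a nilpotent, hence invertible in the corner, against [z * y = 0]. So [x] is in the radical,
    which is zero. *)
Lemma prim_corner_eq0 (e x : B) : prim e -> e * x = x -> x * e = x -> T x = 0 -> x = 0.
Proof.
move=> pe ex xe Tx; apply: contrapT => x0.
have [ee e0 _] := pe.
have [m0 xm0] := prim_corner_nilp pe ex xe Tx.
have [z [z0 zx ze]] : exists z, [/\ z <> 0, z * x = 0 & z * e = z].
  elim: m0 xm0 => [|[|m] IH] xm; first by case: x0; rewrite -[x]mul1r -(expr0 x) xm mul0r.
    by case: x0; rewrite -[x]expr1.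
  case: (pselect (x ^+ m.+1 = 0)) => [|xm0]; first exact: IH.
  by exists (x ^+ m.+1); split=> //; [rewrite -exprSr|rewrite exprSr -mulrA xe].
apply: x0; apply: T_nondeg => b.
pose y := x * (e * b * e).
have -> : T (x * b) = T y.
  by rewrite /y !mulrA xe [RHS]TC !mulrA ex.
apply: contrapT => /eqP Ty.
have ey : e * y = y by rewrite /y mulrA ex.
have ye : y * e = y by rewrite /y -!mulrA ee.
have [c [m ycm]] := prim_corner pe ey ye.
have c0 : c != 0.
  apply: contraNneq Ty => c0; rewrite c0 scale0r subr0 in ycm.
  by rewrite (nilp_trace ycm).
apply: z0; apply/eqP; suff zw j : z * (y - c *: e) ^+ j = (- c) ^+ j *: z.
  by have /eqP := zw m; rewrite ycm mulr0 eq_sym scaler_eq0 expf_eq0 oppr_eq0 (negPf c0) andbF.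
elim: j => [|j IH]; first by rewrite !expr0 mulr1 scale1r.
rewrite exprS mulrA mulrBr -scalerAr ze mulrA zx mul0r sub0r -scaleNr -scalerAl IH.
by rewrite scalerA exprS.
Qed.

(** Subtracting the scalar leaves a corner element of trace 0. Thus the corner of a primitive
    idempotent is one-dimensional. *)
Lemma prim_scalar (e b : B) : prim e -> e * b * e = (T (e * b) / T e) *: e.
Proof.
move=> pe; have [ee _ _] := pe; apply/subr0_eq/(prim_corner_eq0 pe).
- by rewrite mulrBr -scalerAr ee !mulrA ee.
- by rewrite mulrBl -scalerAl ee -!mulrA ee.
- by rewrite raddfB /= linearZ /= divfK ?prim_trace_neq0 // TC mulrA ee subrr.
Qed.

Definition orth (x y : B) := (x * y == 0) && (y * x == 0).

Lemma idem_decomposition (e : B) : e * e = e -> exists s : seq B,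
  [/\ forall x, x \in s -> [/\ prim x, e * x = x & x * e = x], pairwise orth s
    & \sum_(x <- s) x = e].
Proof.
move=> ee; have [n Te n0] := idem_trace ee; have [k ltnk] := ubnP n.
elim: k => // k IH in e ee n Te n0 ltnk *.
case: (pselect (e = 0)) => [->|e0]; first by exists [::]; split=> //; rewrite big_nil.
case: (pselect (prim e)) => [pe|npe].
  by exists [:: e]; split=> //; [move=> x; rewrite inE => /eqP ->|rewrite big_seq1].
have [f [ff ef fe f0 fne]] :
    exists f, [/\ f * f = f, e * f = f, f * e = f, f <> 0 & f <> e].
  apply: contrapT => nf; apply: npe; split=> // f ff ef fe.
  apply: contrapT => /not_orP[f0 fne]; apply: nf; by exists f.
have ff' : (e - f) * (e - f) = e - f by rewrite mulrBl !mulrBr ee ef fe ff subrr subr0.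
have [n1 T1 n10] := idem_trace ff; have [n2 T2 n20] := idem_trace ff'.
have nE : n = (n1 + n2)%N.
  by apply/eqP; rewrite -(eqr_nat K) natrD -T1 -T2 -Te raddfB /= addrC subrK.
have n1_gt0 : (0 < n1)%N by rewrite lt0n; apply/eqP => /n10.
have n2_gt0 : (0 < n2)%N by rewrite lt0n; apply/eqP => /n20/subr0_eq/esym.
have [|s1 [s1P s1o s1S]] := IH f ff n1 T1 n10.
  by rewrite (leq_trans _ (ltnSE ltnk)) // nE -addn1 leq_add2l.
have [|s2 [s2P s2o s2S]] := IH _ ff' n2 T2 n20.
  by rewrite (leq_trans _ (ltnSE ltnk)) // nE -add1n leq_add2r.
exists (s1 ++ s2); split; last by rewrite big_cat /= s1S s2S addrC subrK.
  move=> x; rewrite mem_cat => /orP[/s1P|/s2P] [px fx xf]; split=> //.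
  - by rewrite -fx mulrA ef.
  - by rewrite -xf -mulrA fe.
  - by rewrite -fx mulrA mulrBr ee ef.
  - by rewrite -xf -mulrA mulrBl ee fe.
rewrite pairwise_cat s1o s2o !andbT; apply/allrelP => x y /s1P[_ fx xf] /s2P[_ gy yg].
have xy0 : x * y = 0 by rewrite -xf -gy -mulrA [f * _]mulrA mulrBr fe ff subrr mul0r mulr0.
have yx0 : y * x = 0 by rewrite -yg -fx -mulrA [_ * (f * x)]mulrA mulrBl ef ff subrr mul0r mulr0.
by rewrite /orth xy0 yx0 eqxx.
Qed.

End TraceAlgebra.

(** * Quotient of an algebra by the radical of its trace form *)

Section TraceQuotient.
Local Open Scope quotient_scope.
Variables (K : numClosedFieldType) (A : algType K) (T : {scalar A}).
Hypothesis TC : forall a b, T (a * b) = T (b * a).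
Hypothesis T1 : T 1 != 0.

Definition trace_rad : {pred A} := fun a => `[< forall b, T (a * b) = 0 >].

Lemma trace_radP a : reflect (forall b, T (a * b) = 0) (a \in trace_rad).
Proof. exact: asboolP. Qed.

Lemma trace_rad_zmod_closed : zmod_closed trace_rad.
Proof.
split=> [|a b /trace_radP Ta /trace_radP Tb]; apply/trace_radP => c.
  by rewrite mul0r raddf0.
by rewrite mulrBl raddfB /= Ta Tb subrr.
Qed.

HB.instance Definition _ := GRing.isZmodClosed.Build A trace_rad trace_rad_zmod_closed.

Lemma trace_radMr a b : a \in trace_rad -> a * b \in trace_rad.
Proof. by move=> /trace_radP Ta; apply/trace_radP => c; rewrite -mulrA. Qed.

Lemma trace_radMl a b : b \in trace_rad -> a * b \in trace_rad.
Proof. by move=> /trace_radP Tb; apply/trace_radP => c; rewrite -mulrA TC -mulrA. Qed.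

(** The two proofs index the type, so that the ring structure built from them can be registered on
    it. *)
Definition tquot of (forall a b, T (a * b) = T (b * a)) & T 1 != 0 := Quotient.quot trace_rad.
Local Notation Q := (tquot TC T1).
HB.instance Definition _ := GRing.Zmodule.on Q.
HB.instance Definition _ := EqQuotient.on Q.
Local Notation pi := (\pi_Q).

Lemma tpi_eqP a b : reflect (pi a = pi b :> Q) (a - b \in trace_rad).
Proof. by rewrite Quotient.idealrBE; apply: eqP. Qed.

Lemma tpiD a b : pi (a + b) = pi a + pi b :> Q.
Proof. by rewrite !piE. Qed.

Lemma trepr a : repr (pi a) - a \in trace_rad.
Proof. by apply/tpi_eqP; rewrite reprK. Qed.

Definition tone : Q := pi 1.
Definition tmul (x y : Q) : Q := pi (repr x * repr y).
Definition tscale (c : K) (x : Q) : Q := pi (c *: repr x).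

Lemma tpiM a b : tmul (pi a) (pi b) = pi (a * b).
Proof.
apply/tpi_eqP; set a' := repr _; set b' := repr _.
have -> : a' * b' - a * b = (a' - a) * b' + a * (b' - b).
  by rewrite mulrBl mulrBr addrA subrK.
by apply: rpredD; [apply/trace_radMr/trepr|apply/trace_radMl/trepr].
Qed.

Lemma tpiZ c a : tscale c (pi a) = pi (c *: a).
Proof.
apply/tpi_eqP; rewrite -scalerBr -[_ - _]mul1r scalerAl.
exact/trace_radMl/trepr.
Qed.

Lemma tmulA : associative tmul.
Proof.
elim/quotW => x; elim/quotW => y; elim/quotW => z.
by rewrite (tpiM y z) (tpiM x y) (tpiM x) (tpiM _ z) mulrA.
Qed.
Lemma tmul1 : left_id tone tmul.
Proof. by elim/quotW => x; rewrite (tpiM 1 x) mul1r. Qed.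
Lemma tmulr1 : right_id tone tmul.
Proof. by elim/quotW => x; rewrite (tpiM x 1) mulr1. Qed.
Lemma tmulDl : left_distributive tmul +%R.
Proof.
elim/quotW => x; elim/quotW => y; elim/quotW => z.
by rewrite -tpiD (tpiM _ z) (tpiM x z) (tpiM y z) mulrDl tpiD.
Qed.
Lemma tmulDr : right_distributive tmul +%R.
Proof.
elim/quotW => x; elim/quotW => y; elim/quotW => z.
by rewrite -tpiD (tpiM x) (tpiM x y) (tpiM x z) mulrDr tpiD.
Qed.
Lemma tone_neq0 : tone != 0.
Proof.
have -> : 0 = pi 0 by rewrite !piE.
apply/eqP => /tpi_eqP; rewrite subr0 => /trace_radP/(_ 1); rewrite mulr1.
exact/eqP.
Qed.
HB.instance Definition _ :=
  GRing.Zmodule_isNzRing.Build Q tmulA tmul1 tmulr1 tmulDl tmulDr tone_neq0.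

Lemma tscaleA b c x : tscale b (tscale c x) = tscale (b * c) x.
Proof. by elim/quotW: x => x; rewrite (tpiZ c) (tpiZ b) tpiZ scalerA. Qed.
Lemma tscale1 : left_id 1 tscale.
Proof. by elim/quotW => x; rewrite tpiZ scale1r. Qed.
Lemma tscaleDr : right_distributive tscale +%R.
Proof. by move=> c; elim/quotW => x; elim/quotW => y; rewrite -tpiD !tpiZ scalerDr tpiD. Qed.
Lemma tscaleDl x : {morph tscale^~ x : b c / b + c}.
Proof. by elim/quotW: x => x b c; rewrite !tpiZ scalerDl tpiD. Qed.
HB.instance Definition _ :=
  GRing.Zmodule_isLmodule.Build K Q tscaleA tscale1 tscaleDr tscaleDl.

Lemma tscaleAl c (x y : Q) : c *: (x * y) = (c *: x) * y.
Proof.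
elim/quotW: x => x; elim/quotW: y => y.
change (tscale c (tmul (pi x) (pi y)) = tmul (tscale c (pi x)) (pi y)).
by rewrite (tpiM x y) (tpiZ c x) (tpiM _ y) (tpiZ c _) scalerAl.
Qed.
HB.instance Definition _ := GRing.Lmodule_isLalgebra.Build K Q tscaleAl.

Lemma tscaleAr c (x y : Q) : c *: (x * y) = x * (c *: y).
Proof.
elim/quotW: x => x; elim/quotW: y => y.
change (tscale c (tmul (pi x) (pi y)) = tmul (pi x) (tscale c (pi y))).
by rewrite (tpiM x y) (tpiZ c y) (tpiM x) (tpiZ c _) scalerAr.
Qed.
HB.instance Definition _ := GRing.Lalgebra_isAlgebra.Build K Q tscaleAr.

Definition ttrace (x : Q) : K := T (repr x).

Lemma ttraceE a : ttrace (pi a) = T a.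
Proof.
have /trace_radP/(_ 1) := trepr a; rewrite mulr1 raddfB /=.
by move/eqP; rewrite subr_eq0 => /eqP.
Qed.

Lemma ttrace_is_scalar : scalar ttrace.
Proof.
move=> c; elim/quotW => x; elim/quotW => y.
rewrite [c *: _](tpiZ c x) -tpiD !ttraceE; exact: linearP.
Qed.
HB.instance Definition _ := GRing.isLinear.Build K Q K *%R ttrace ttrace_is_scalar.

Lemma pi_mul a b : pi (a * b) = pi a * pi b :> Q.
Proof. by rewrite -tpiM. Qed.
Lemma pi_scale c a : pi (c *: a) = c *: pi a :> Q.
Proof. by rewrite -tpiZ. Qed.
Lemma pi_exp a n : pi (a ^+ n) = pi a ^+ n :> Q.
Proof. by elim: n => // n IH; rewrite !exprS pi_mul IH. Qed.
Lemma pi_sum I (r : seq I) (F : I -> A) : pi (\sum_(i <- r) F i) = \sum_(i <- r) pi (F i) :> Q.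
Proof.
elim: r => [|i r IH]; first by rewrite !big_nil; rewrite !piE.
by rewrite !big_cons tpiD IH.
Qed.

Variable d : nat.
Hypothesis T_CH : forall a b,
  T ((\sum_(k < d.+1) newton (fun i => T (a ^+ i)) k *: a ^+ (d - k)) * b) = 0.

(* Idempotents of the quotient, lifted and described by the functionals
   [T (e * _)] only. *)
Lemma trace_decomposition : exists s : seq A,
  [/\ forall e, e \in s -> exists2 n, T e = n%:R & (0 < n)%N,
     forall e, e \in s -> forall b c, T (e * b * e * c) = T (e * b) / T e * T (e * c),
     forall i j b, (i < size s)%N -> (j < size s)%N ->
       T (s`_i * s`_j * b) = (i == j)%:R * T (s`_i * b)
   & forall b, \sum_(e <- s) T (e * b) = T b].
Proof.
pose tT : {scalar Q} := ttrace.
have tE a : tT (pi a) = T a by exact: ttraceE.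
have tC (a b : Q) : tT (a * b) = tT (b * a).
  by elim/quotW: a => a; elim/quotW: b => b; rewrite -!pi_mul !tE TC.
have tnd (a : Q) : (forall b, tT (a * b) = 0) -> a = 0.
  elim/quotW: a => a H; have -> : 0 = pi 0 :> Q by rewrite !piE.
  by apply/tpi_eqP; rewrite subr0; apply/trace_radP => b; rewrite -tE pi_mul H.
have tCH (a : Q) : \sum_(k < d.+1) newton (fun i => tT (a ^+ i)) k *: a ^+ (d - k) = 0.
  elim/quotW: a => a; apply: tnd => b; elim/quotW: b => b.
  rewrite -[RHS](T_CH a b) -tE pi_mul pi_sum; congr (tT (_ * _)).
  apply: eq_bigr => k _; rewrite pi_scale pi_exp; congr (_ *: _).
  by apply: eq_newton => i; rewrite -pi_exp; exact: tE.
have [s [sP so sS]] := idem_decomposition tCH (mul1r 1).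
exists (map (@repr _ Q) s).
have reprT (x : Q) b : T (repr x * b) = tT (x * pi b).
  by rewrite -[X in tT (X * _)]reprK -pi_mul [RHS]tE.
have T0 (x : Q) : T (repr x) = tT x by [].
split.
- move=> _ /mapP[x xs ->]; have [px _ _] := sP x xs; have [xx x0 _] := px.
  have [n nE n0] := idem_trace tCH xx; exists n; first exact: nE.
  by rewrite lt0n; apply/eqP => /n0.
- move=> _ /mapP[x xs ->] b c; have [px _ _] := sP x xs.
  rewrite -!mulrA !reprT !pi_mul reprK !mulrA.
  rewrite (prim_scalar tC tnd tCH _ px) -scalerAl linearZ /=.
  by rewrite T0.
- move=> i j b; rewrite size_map => ltis ltjs; rewrite !(nth_map 0) //.
  rewrite -mulrA !reprT pi_mul reprK mulrA.
  have [<-|neq] := eqVneq i j.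
    by have [[-> _ _] _ _] := sP _ (mem_nth 0 ltis); rewrite mul1r.
  have : s`_i * s`_j = 0.
    case: (ltngtP i j) neq => // lt _.
    - by have /(pairwiseP 0)/(_ i j ltis ltjs lt)/andP[/eqP] := so.
    - by have /(pairwiseP 0)/(_ j i ltjs ltis lt)/andP[_ /eqP] := so.
  by move=> ->; rewrite !mul0r raddf0.
- move=> b; rewrite big_map; under eq_bigr do rewrite reprT.
  rewrite -raddf_sum -mulr_suml sS mul1r; exact: tE.
Qed.

End TraceQuotient.

Lemma sum_if_mem (V : nmodType) (I : eqType) (r t : seq I) (k : I -> V) :
  uniq r -> uniq t -> {subset r <= t} ->
  \sum_(i <- r) k i = \sum_(i <- t) (if i \in r then k i else 0).
Proof.
move=> ur ut sub; rewrite -big_mkcond /= -[RHS]big_filter; apply: perm_big.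
apply: uniq_perm => //; first by rewrite filter_uniq.
by move=> i; rewrite mem_filter; case: (boolP (i \in r)) => //= /sub ->.
Qed.

(** * Weights *)

Section WeightVectors.
Variables (K : fieldType) (g : lieAlgType K) (h : {vspace g}) (E : lmodType K).
Variable A : subvs_of h -> E -> E.
Hypothesis AD : forall y, {morph A y : u v / u + v}.
Hypothesis AZ : forall y c, {morph A y : u / c *: u}.
Implicit Types (lam mu nu : weight h) (u v : E) (s : seq (weight h)).

(** One notion for all gradings in use: [A] is instantiated with the action of [h] on a module, on
    [g] by [ad_g], and on the enveloping algebra by [ad_h]. *)
Definition weight_vector lam v := forall y, A y v = (lam y : K) *: v.

Lemma A0 y : A y 0 = 0.
Proof. by have := AZ y 0 0; rewrite !scale0r. Qed.

Lemma A_sum y I (r : seq I) (P : pred I) (F : I -> E) :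
  A y (\sum_(i <- r | P i) F i) = \sum_(i <- r | P i) A y (F i).
Proof. exact: (big_morph _ (AD y) (A0 y)). Qed.

Lemma weight_vector0 lam : weight_vector lam 0.
Proof. by move=> y; rewrite A0 scaler0. Qed.

Lemma weight_vectorD lam u v :
  weight_vector lam u -> weight_vector lam v -> weight_vector lam (u + v).
Proof. by move=> wu wv y; rewrite AD wu wv scalerDr. Qed.

Lemma weight_vectorZ lam c u : weight_vector lam u -> weight_vector lam (c *: u).
Proof. by move=> wu y; rewrite AZ wu !scalerA mulrC. Qed.

Lemma weight_vector_sum lam I (r : seq I) (P : pred I) (F : I -> E) :
  (forall i, P i -> weight_vector lam (F i)) ->
  weight_vector lam (\sum_(i <- r | P i) F i).
Proof. by move=> wF; elim/big_ind: _ => // *; [apply: weight_vector0|apply: weight_vectorD]. Qed.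

Lemma weight_neq lam mu : lam != mu -> exists y, (lam y : K) - mu y != 0.
Proof.
move=> neq; apply: contrapT => H; case/eqP: neq; apply/lfunP => y.
by apply: contrapT => ne; apply: H; exists y; rewrite subr_eq0; apply/eqP.
Qed.

(** Induction on the list: [A y - mu y] kills the component of weight [mu] and multiplies that of
    weight [lam] by [lam y - mu y], nonzero for a suitable [y]. *)
Lemma weight_vectors_free s (f : weight h -> E) : uniq s ->
  {in s, forall lam, weight_vector lam (f lam)} -> \sum_(lam <- s) f lam = 0 ->
  {in s, forall lam, f lam = 0}.
Proof.
elim: s f => // mu s IH f /= /andP[mus us] wf sum0.
have fs0 : {in s, forall lam, f lam = 0}.
  move=> lam lams; have [y yn] : exists y, (lam y : K) - mu y != 0.
    by apply: weight_neq; apply: contraNneq mus => <-.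
  pose f' (nu : weight h) := ((nu y : K) - mu y) *: f nu.
  have : f' lam = 0.
    apply: (IH f' us _ _ lam lams) => [nu nus|].
      by apply: weight_vectorZ; apply: wf; rewrite inE nus orbT.
    have := congr1 (fun v => A y v - (mu y : K) *: v) sum0.
    rewrite A0 scaler0 subr0 A_sum scaler_sumr -sumrB big_cons.
    rewrite wf ?mem_head // subrr add0r => E0; rewrite -[RHS]E0.
    rewrite !big_seq; apply: eq_bigr => nu nus.
    by rewrite /f' wf ?inE ?nus ?orbT // scalerBl.
  by move/eqP; rewrite scaler_eq0 (negPf yn) => /eqP.
move=> lam; rewrite inE => /orP[/eqP ->|/fs0 //].
by move: sum0; rewrite big_cons big_seq big1 ?addr0 // => nu /fs0.
Qed.

Definition weight_sum v := exists s (f : weight h -> E),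
  [/\ uniq s, {in s, forall lam, weight_vector lam (f lam)} & v = \sum_(lam <- s) f lam].

Lemma weight_sum_uniq s s' (f f' : weight h -> E) :
  uniq s -> {in s, forall lam, weight_vector lam (f lam)} ->
  uniq s' -> {in s', forall lam, weight_vector lam (f' lam)} ->
  \sum_(lam <- s) f lam = \sum_(lam <- s') f' lam ->
  forall lam, (if lam \in s then f lam else 0) = (if lam \in s' then f' lam else 0).
Proof.
move=> us wf us' wf' Esum lam.
pose t := undup (s ++ s').
pose F lam := if lam \in s then f lam else 0.
pose F' lam := if lam \in s' then f' lam else 0.
have wF mu : weight_vector mu (F mu).
  by rewrite /F; case: ifP => [/wf//|_]; apply: weight_vector0.
have wF' mu : weight_vector mu (F' mu).
  by rewrite /F'; case: ifP => [/wf'//|_]; apply: weight_vector0.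
have ut : uniq t := undup_uniq _.
have: \sum_(mu <- t) (F mu - F' mu) = 0.
  rewrite sumrB -!sum_if_mem // ?Esum ?subrr // => mu mur; rewrite mem_undup mem_cat mur ?orbT //.
move/weight_vectors_free => H.
case: (boolP (lam \in t)) => [lt|].
  apply/eqP; rewrite -subr_eq0; apply/eqP; apply: H => //.
  move=> mu _; apply: weight_vectorD => //; rewrite -scaleN1r; exact: weight_vectorZ.
by rewrite mem_undup mem_cat negb_or => /andP[/negPf -> /negPf ->].
Qed.

Lemma weight_sum0 : weight_sum 0.
Proof. by exists [::], (fun=> 0); split=> //; rewrite big_nil. Qed.

Lemma weight_sum1 lam v : weight_vector lam v -> weight_sum v.
Proof.
by move=> wv; exists [:: lam], (fun=> v); split=> // [mu|]; rewrite ?big_seq1 // inE => /eqP ->.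
Qed.

Lemma weight_sumD u v : weight_sum u -> weight_sum v -> weight_sum (u + v).
Proof.
move=> [s [f [us wf ->]]] [s' [f' [us' wf' ->]]].
pose t := undup (s ++ s').
exists t, (fun mu => (if mu \in s then f mu else 0) + (if mu \in s' then f' mu else 0)).
split; first exact: undup_uniq.
  move=> mu _; apply: weight_vectorD; case: ifP => [|_]; first [exact: wf|exact: wf'|exact: weight_vector0].
have ut : uniq t := undup_uniq _.
by rewrite big_split -!sum_if_mem // => mu mur; rewrite mem_undup mem_cat mur ?orbT.
Qed.

Lemma weight_sumZ c v : weight_sum v -> weight_sum (c *: v).
Proof.
move=> [s [f [us wf ->]]]; exists s, (fun lam => c *: f lam); split=> //.
  by move=> lam /wf; apply: weight_vectorZ.
by rewrite scaler_sumr.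
Qed.

Lemma weight_sum_sum I (r : seq I) (F : I -> E) :
  (forall i, weight_sum (F i)) -> weight_sum (\sum_(i <- r) F i).
Proof. by move=> wF; elim/big_ind: _ => //; [exact: weight_sum0|exact: weight_sumD]. Qed.

Section Components.
Hypothesis spanned : forall v, weight_sum v.

Lemma weight_decomposition v : exists p : seq (weight h) * (weight h -> E),
  [/\ uniq p.1, {in p.1, forall lam, weight_vector lam (p.2 lam)}
    & v = \sum_(lam <- p.1) p.2 lam].
Proof. by have [s [f H]] := spanned v; exists (s, f). Qed.

(** Some decomposition is chosen once and for all. The list may contain weights whose component is
    zero; the components themselves do not depend on the choice ([weight_comp_unique]). *)
Definition weight_supp v : seq (weight h) := (projT1 (cid (weight_decomposition v))).1.

Definition weight_comp lam v : E :=
  if lam \in weight_supp v then (projT1 (cid (weight_decomposition v))).2 lam else 0.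

Lemma weight_compP lam v : weight_vector lam (weight_comp lam v).
Proof.
rewrite /weight_comp /weight_supp; case: cid => -[s f] /= [us wf _].
by case: ifP => [/wf //|_]; apply: weight_vector0.
Qed.

Lemma uniq_weight_supp v : uniq (weight_supp v).
Proof. by rewrite /weight_supp; case: cid => -[s f] []. Qed.

Lemma sum_weight_comp v : v = \sum_(lam <- weight_supp v) weight_comp lam v.
Proof.
rewrite /weight_comp /weight_supp; case: cid => -[s f] /= [us wf vE].
by rewrite {1}vE !big_seq; apply: eq_bigr => lam ->.
Qed.

Lemma weight_comp_out lam v : lam \notin weight_supp v -> weight_comp lam v = 0.
Proof. by rewrite /weight_comp => /negPf ->. Qed.

Lemma weight_comp_unique s (f : weight h -> E) v : uniq s ->
  {in s, forall lam, weight_vector lam (f lam)} -> v = \sum_(lam <- s) f lam ->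
  forall lam, weight_comp lam v = if lam \in s then f lam else 0.
Proof.
move=> us wf vE lam; rewrite -(@weight_sum_uniq (weight_supp v) s (weight_comp^~ v) f) //.
- by case: ifP => // /negbT; apply: weight_comp_out.
- exact: uniq_weight_supp.
- by move=> mu _; apply: weight_compP.
- by rewrite -sum_weight_comp.
Qed.

Lemma weight_comp_id lam v : weight_vector lam v -> weight_comp lam v = v.
Proof.
move=> wv; rewrite (@weight_comp_unique [:: lam] (fun=> v)) ?mem_head //.
  by move=> mu; rewrite inE => /eqP ->.
by rewrite big_seq1.
Qed.

Lemma weight_comp_neq lam mu v : weight_vector lam v -> mu != lam -> weight_comp mu v = 0.
Proof.
move=> wv /negPf neq; rewrite (@weight_comp_unique [:: lam] (fun=> v)) ?inE ?neq //.
  by move=> nu; rewrite inE => /eqP ->.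
by rewrite big_seq1.
Qed.

Lemma sum_weight_comp_sub s v : uniq s -> {subset weight_supp v <= s} ->
  v = \sum_(lam <- s) weight_comp lam v.
Proof.
move=> us sub; rewrite {1}(sum_weight_comp v) (sum_if_mem _ _ us sub) ?uniq_weight_supp //.
by apply: eq_bigr => mu _; case: ifP => // /negbT/weight_comp_out ->.
Qed.

Lemma weight_comp_linear lam : linear (weight_comp lam).
Proof.
move=> c u v; pose s := undup (weight_supp u ++ weight_supp v).
have us : uniq s := undup_uniq _.
rewrite (@weight_comp_unique s (fun mu => c *: weight_comp mu u + weight_comp mu v) _ us).
- case: ifP => // /negbT; rewrite mem_undup mem_cat negb_or => /andP[nu nv].
  by rewrite !weight_comp_out // scaler0 addr0.
- by move=> mu _; apply: weight_vectorD; [apply: weight_vectorZ|]; apply: weight_compP.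
- rewrite big_split -scaler_sumr /= -!sum_weight_comp_sub //.
    by move=> mu muv; rewrite mem_undup mem_cat muv orbT.
  by move=> mu muu; rewrite mem_undup mem_cat muu.
Qed.

End Components.

End WeightVectors.

Section MakeWeight.
Variables (K : fieldType) (g : lieAlgType K) (h : {vspace g}).
Variable c : subvs_of h -> K^o.
Hypothesis c_linear : linear c.
HB.instance Definition _ := GRing.isLinear.Build K (subvs_of h) K^o *:%R c c_linear.

Lemma exists_weight : exists lam : weight h, forall y, lam y = c y.
Proof. by exists (linfun c) => y; rewrite lfunE. Qed.

End MakeWeight.

(** * Graded algebras and the weight spaces of their modules *)

Record is_action (K : fieldType) (E : algType K) (M : lmodType K) (act : E -> M -> M) : Prop :=
  IsAction {
    actD : forall u v m, act (u + v) m = act u m + act v m;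
    actZ : forall a u m, act (a *: u) m = a *: act u m;
    actDr : forall u, {morph act u : m n / m + n};
    actZr : forall u a, {morph act u : m / a *: m};
    act1 : forall m, act 1 m = m;
    actM : forall u v m, act (u * v) m = act u (act v m)
  }.

(* [E] plays the role of U(g) and [iota] that of the inclusion of the Cartan
   subalgebra; working over an abstract algebra keeps unification away from
   the quotient construction of [Uenv]. *)
Section Graded.
Variables (K : fieldType) (g : lieAlgType K) (h : {vspace g}) (E : algType K).
Variable iota : subvs_of h -> E.
Implicit Types (lam mu al : weight h) (u v : E) (y : subvs_of h).

Definition ad_h y u : E := iota y * u - u * iota y.

Lemma ad_hD y : {morph ad_h y : u v / u + v}.
Proof. by move=> u v; rewrite /ad_h mulrDr mulrDl opprD addrACA. Qed.

Lemma ad_hZ y c : {morph ad_h y : u / c *: u}.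
Proof. by move=> u; rewrite /ad_h -scalerAr -scalerAl scalerBr. Qed.

Definition homog := weight_vector ad_h.

Lemma homog1 : homog 0 1.
Proof. by move=> y; rewrite /ad_h mulr1 mul1r subrr lfunE /= scale0r. Qed.

Lemma homogM al mu u v : homog al u -> homog mu v -> homog (al + mu) (u * v).
Proof.
move=> wu wv y; rewrite lfunE /= scalerDl.
have -> : ad_h y (u * v) = ad_h y u * v + u * ad_h y v.
  by rewrite /ad_h mulrBl mulrBr !mulrA addrA subrK.
by rewrite wu wv -scalerAl -scalerAr.
Qed.

Lemma homogL al a u v : homog al u -> homog al v -> homog al (a *: u + v).
Proof.
by move=> wu wv; apply: (weight_vectorD ad_hD) => //; apply: (weight_vectorZ ad_hZ).
Qed.

Lemma homog0M u v : homog 0 u -> homog 0 v -> homog 0 (u * v).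
Proof. by move=> hu hv; rewrite -[0]addr0; apply: homogM. Qed.

Lemma homog_zero al : homog al 0.
Proof. exact: (weight_vector0 ad_hZ). Qed.

Section Modules.
Variables (M : lmodType K) (act : E -> M -> M) (actP : is_action act).
Implicit Types (m n : M).

Definition hspace lam : set M := [set m | forall y, act (iota y) m = (lam y : K) *: m].

Lemma act0r u : act u 0 = 0.
Proof. by have := actZr actP u 0 0; rewrite !scale0r. Qed.

Lemma act0l m : act 0 m = 0.
Proof. by have := actZ actP 0 0 m; rewrite !scale0r. Qed.

Lemma actB u v m : act (u - v) m = act u m - act v m.
Proof. by rewrite (actD actP) -[- v]scaleN1r (actZ actP) scaleN1r. Qed.

Lemma act_sum u I (r : seq I) (P : pred I) (F : I -> M) :
  act u (\sum_(i <- r | P i) F i) = \sum_(i <- r | P i) act u (F i).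
Proof. exact: (big_morph _ (actDr actP u) (act0r u)). Qed.

Lemma act_suml I (r : seq I) (P : pred I) (F : I -> E) m :
  act (\sum_(i <- r | P i) F i) m = \sum_(i <- r | P i) act (F i) m.
Proof. exact: (big_morph _ (fun u v => actD actP u v m) (act0l m)). Qed.

Lemma act_linear u : linear (act u).
Proof. by move=> c m m'; rewrite (actDr actP) (actZr actP). Qed.

Let actDh y : {morph act (iota y) : m n / m + n} := actDr actP (iota y).
Let actZh y c : {morph act (iota y) : m / c *: m} := actZr actP (iota y) c.

Lemma hspace_linear lam : linear_subspace (hspace lam).
Proof.
split=> [|a m n wm wn] y; first exact: (weight_vector0 actZh).
by apply: (weight_vectorD actDh); [apply: (weight_vectorZ actZh)|].
Qed.

Lemma hspace_free (s : seq (weight h)) (f : weight h -> M) : uniq s ->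
  {in s, forall lam, hspace lam (f lam)} -> \sum_(lam <- s) f lam = 0 ->
  {in s, forall lam, f lam = 0}.
Proof. exact: (weight_vectors_free actDh actZh). Qed.

Lemma act_hspace al lam u m :
  homog al u -> hspace lam m -> hspace (al + lam) (act u m).
Proof.
move=> wu wm y; rewrite -(actM actP).
have -> : iota y * u = ad_h y u + u * iota y by rewrite subrK.
by rewrite wu (actD actP) (actZ actP) (actM actP) wm (actZr actP) lfunE /= scalerDl.
Qed.

Lemma act0_hspace lam u m : homog 0 u -> hspace lam m -> hspace lam (act u m).
Proof. by rewrite -{2}[lam]add0r; apply: act_hspace. Qed.

Hypothesis iotaC : forall y y', iota y * iota y' = iota y' * iota y.

Lemma homog_iota y : homog 0 (iota y).
Proof. by move=> y'; rewrite lfunE /= scale0r /ad_h iotaC subrr. Qed.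

(* Lagrange interpolation in U(h). *)
Lemma weight_projector lam (s : seq (weight h)) : lam \notin s ->
  exists2 q, homog 0 q & forall m,
    (hspace lam m -> act q m = m) /\
    (forall mu, mu \in s -> hspace mu m -> act q m = 0).
Proof.
elim: s => [|mu s IH].
  by exists 1 => [|m]; [exact: homog1|split=> // _; exact: (act1 actP)].
rewrite inE negb_or => /andP[neq /IH[q q0 qP]] {IH}.
have [y yn] := weight_neq neq.
pose c := ((lam y : K) - mu y)^-1.
pose r := c *: (- (mu y : K) *: 1 + iota y) + 0.
have r0 : homog 0 r.
  by apply: homogL (homog_zero _); apply: homogL homog1 _; apply: homog_iota.
have rP nu m : hspace nu m -> act r m = (c * ((nu y : K) - mu y)) *: m.
  move=> wm; rewrite /r addr0 (actZ actP) (actD actP) (actZ actP) (act1 actP) wm.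
  by rewrite -scalerDl scalerA addrC.
exists (q * r); first exact: homog0M.
move=> m; split=> [wm|nu].
  by rewrite (actM actP) (rP _ _ wm) mulVf // scale1r (qP m).1.
rewrite (actM actP) inE => nus wm; rewrite (rP _ _ wm) (actZr actP).
case/orP: nus => [/eqP ->|nus]; first by rewrite subrr mulr0 scale0r.
by rewrite ((qP m).2 nu) // scaler0.
Qed.

End Modules.
End Graded.

Section SubspaceVspace.
Variables (K : fieldType) (V : vectType K).

(** A subspace inside [P] grows by one vector of [P] at a time, and its codimension bounds the
    number of steps. *)
Lemma linear_subspace_vspace (P : set V) : linear_subspace P ->
  exists W : {vspace V}, forall x, (x \in W) <-> P x.
Proof.
move=> [P0 PL].
suff main n (W : {vspace V}) : (\dim {:V} - \dim W <= n)%N -> (forall x, x \in W -> P x) ->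
    exists W : {vspace V}, forall x, (x \in W) <-> P x.
  by apply: (main _ 0%VS (leqnn _)) => x; rewrite memv0 => /eqP ->.
elim: n W => [|n IH] W le WP.
  exists W => x; split=> [/WP //|_]; suff -> : W = fullv by rewrite memvf.
  by apply/eqP; rewrite eqEdim subvf /= -subn_eq0 -leqn0.
case: (pselect (exists2 x, P x & x \notin W)) => [[x Px xW]|H]; last first.
  exists W => x; split=> [/WP //|Px]; apply: contrapT => /negP xW; apply: H; by exists x.
apply: (IH (W + <[x]>)%VS).
  have lt : (\dim W < \dim (W + <[x]>))%N.
    rewrite ltn_neqAle dimvS ?addvSl // andbT; apply: contra xW => /eqP Ed.
    by rewrite memvE (subv_trans (addvSr W <[x]>)) // -(geq_leqif (dimv_leqif_sup (addvSl W <[x]>))) Ed.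
  by move: le; rewrite !leq_subLR; move/leq_trans; apply; rewrite -addSnnS leq_add2r.
move=> z /memv_addP[w wW [v /vlineP[c ->] ->]].
by rewrite addrC; apply: PL => //; apply: WP.
Qed.

End SubspaceVspace.

Lemma scale_sub_inv (K : fieldType) (V : lmodType K) (a c : K) (v : V) : a != c ->
  (a - c)^-1 *: (a *: v) - c *: ((a - c)^-1 *: v) = v.
Proof.
by move=> ac; rewrite !scalerA -scalerBl [c * _]mulrC -mulrBr mulVf ?subr_eq0 // scale1r.
Qed.

(** * Simultaneous diagonalization *)

Section SimultaneousEigenvectors.
Import VectorInternalTheory.
Variables (K : closedFieldType) (V : vectType K).
Implicit Types (D : V -> V) (P : set V).

(** The list consists of the roots of the characteristic polynomial; applying the linear factors one
    after the other is Cayley-Hamilton. *)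
Lemma split_annihilator n (A : 'M[K]_n) : exists s : seq K,
  forall v : 'rV_n, foldl (fun w c => w *m A - c *: w) v s = 0.
Proof.
case: n A => [|n] A; first by exists [::] => v; rewrite thinmx0.
have [s sE] := closed_field_poly_normal (char_poly A).
rewrite (monicP (char_poly_monic A)) scale1r in sE.
exists s => v; suff -> : foldl (fun w c => w *m A - c *: w) v s =
    v *m horner_mx A (\prod_(z <- s) ('X - z%:P)).
  by rewrite -sE Cayley_Hamilton mulmx0.
elim: s v {sE} => [|c s IH] v /=; first by rewrite big_nil rmorph1 mulmx1.
rewrite IH big_cons rmorphM /= -mulmxE mulmxA; congr (_ *m _).
by rewrite rmorphB /= horner_mx_X horner_mx_C mulmxBr mul_mx_scalar.
Qed.

Definition eigen_sum D P x := exists l : seq (K * V),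
  (forall p, p \in l -> P p.2 /\ D p.2 = p.1 *: p.2) /\ x = \sum_(p <- l) p.2.

(** The second hypothesis on [D] excludes generalized eigenvectors of height two. A list of scalars
    [c] whose factors [D - c] successively annihilate everything is consumed by induction. The
    stable subspace [P] is carried along so that, for commuting operators, eigenvalues already
    obtained are not lost. *)
Lemma eigen_sumP D P : (forall c, {morph D : u v / c *: u + v}) ->
  (forall c x, D (D x - c *: x) = c *: (D x - c *: x) -> D x = c *: x) ->
  linear_subspace P -> (forall x, P x -> P (D x)) ->
  forall x, P x -> eigen_sum D P x.
Proof.
move=> DL Dss [P0 PL] PD.
have D0 : D 0 = 0 by have := DL (-1) 0 0; rewrite scaler0 addr0 scaleN1r addNr.
have DD u v : D (u + v) = D u + D v by rewrite -[u]scale1r DL !scale1r.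
have DZ c u : D (c *: u) = c *: D u by rewrite -[c *: u]addr0 DL D0 addr0.
have DB u v : D (u - v) = D u - D v by rewrite DD -scaleN1r DZ scaleN1r.
have D_sum I (r : seq I) Q F : D (\sum_(i <- r | Q i) F i) = \sum_(i <- r | Q i) D (F i).
  exact: (big_morph _ DD D0).
have PZ c u : P u -> P (c *: u) by move=> Pu; rewrite -[_ *: _]addr0; apply: PL.
have PDD u v : P u -> P v -> P (u + v) by rewrite -{2}[u]scale1r; apply: PL.
have [s sP] : exists s : seq K, forall x, foldl (fun w c => D w - c *: w) x s = 0.
  pose Dv (w : 'rV[K]_(dim V)) := v2r (D (r2v w)).
  have Dv_lin : linear Dv by move=> c u v; rewrite /Dv linearP DL linearP.
  pose DvL := GRing.isLinear.Build K 'rV[K]_(dim V) 'rV[K]_(dim V) *:%R Dv Dv_lin.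
  pose Df : {linear 'rV[K]_(dim V) -> 'rV[K]_(dim V)} := HB.pack Dv DvL.
  have [s sP] := split_annihilator (lin1_mx Df); exists s => x.
  apply: (can_inj v2rK); rewrite linear0 -[RHS](sP (v2r x)).
  elim: s x {sP} => //= c s IH x; rewrite IH; congr (foldl _ _ _).
  by rewrite (mul_rV_lin1 Df) linearB linearZ /= /Dv v2rK.
move=> x; have := sP x; elim: s x {sP} => [|c s IH] x /=.
  by move=> -> _; exists [::]; split=> //; rewrite big_nil.
move=> /IH{}IH Px; have [|l [lP lE]] := IH.
  by rewrite -scaleNr addrC; apply: PL => //; apply: PD.
(* [D x - c *: x] is a sum of eigenvectors. Dividing those of eigenvalue other than [c] by [p.1 - c]
   gives [y] whose image under [D - c] is their sum. Then [D - c] sends [x - y] to an eigenvector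
   for [c], so [x - y] is one itself by [Dss]. *)
pose l' := [seq (p.1, (p.1 - c)^-1 *: p.2) | p <- l & p.1 != c].
pose y := \sum_(p <- l') p.2.
have l'P p : p \in l' -> P p.2 /\ D p.2 = p.1 *: p.2.
  case/mapP=> q; rewrite mem_filter => /andP[_ /lP[Pq Dq]] -> /=.
  by split; [apply: PZ|rewrite DZ Dq !scalerA mulrC].
have yE : D y - c *: y = \sum_(p <- l | p.1 != c) p.2.
  rewrite /y D_sum scaler_sumr -sumrB big_map big_filter big_seq_cond [RHS]big_seq_cond.
  apply: eq_bigr => p /andP[/lP[_ Dp] pc] /=.
  by rewrite DZ Dp scale_sub_inv.
exists ((c, x - y) :: l'); split; last by rewrite big_cons /= subrK.
have Py : P y.
  rewrite /y big_seq; elim/big_ind: _ => // p; by case/l'P.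
move=> p; rewrite inE => /orP[/eqP -> /=|/l'P //]; split.
  by rewrite -scaleN1r addrC; apply: PL.
have zE : D (x - y) - c *: (x - y) = \sum_(p <- l | p.1 == c) p.2.
  have -> : D (x - y) - c *: (x - y) = (D x - c *: x) - (D y - c *: y).
    by rewrite DB scalerBr !opprB addrACA [RHS]addrACA [- D y + _]addrC.
  rewrite yE lE.
  by rewrite (bigID (fun p : K * V => p.1 == c)) /= addrK.
apply: Dss; rewrite zE D_sum scaler_sumr big_seq_cond [RHS]big_seq_cond; apply: eq_bigr => w.
by case/andP=> /lP[_ ->] /eqP ->.
Qed.

End SimultaneousEigenvectors.

(** * Root decomposition of [g] from the weights of a faithful module *)

Section CartanWeights.
Variables (K : closedFieldType) (g : lieAlgType K) (h : {vspace g}) (M : lieModType g).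
Hypothesis lieDr : forall x y z : g, lie x (y + z) = lie x y + lie x z.
Hypothesis lieZr : forall a (x y : g), lie x (a *: y) = a *: lie x y.
Hypothesis M_faithful : forall x : g, (forall m : M, lact x m = 0) -> x = 0.

Definition lact_h (y : subvs_of h) (m : M) : M := lact (vsval y) m.
Definition ad_g (y : subvs_of h) (x : g) : g := lie (vsval y) x.

Hypothesis M_weights : forall m : M, weight_sum (h := h) lact_h m.

Let lact_hD y : {morph lact_h y : m n / m + n}. Proof. exact: lactDr. Qed.
Let lact_hZ y c : {morph lact_h y : m / c *: m}. Proof. by move=> m; exact: lactZr. Qed.
Let ad_gD y : {morph ad_g y : m n / m + n}. Proof. by move=> *; exact: lieDr. Qed.
Let ad_gZ y c : {morph ad_g y : m / c *: m}. Proof. by move=> m; exact: lieZr. Qed.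

Lemma lact0 x : lact x (0 : M) = 0.
Proof. by have := lactZr 0 x (0 : M); rewrite !scale0r. Qed.

Lemma lact_sum x I (r : seq I) (P : pred I) (F : I -> M) :
  lact x (\sum_(i <- r | P i) F i) = \sum_(i <- r | P i) lact x (F i).
Proof. exact: (big_morph _ (lactDr x) (lact0 x)). Qed.

Lemma faithful_weights x :
  (forall (lam : weight h) m, weight_vector lact_h lam m -> lact x m = 0) -> x = 0.
Proof.
move=> xw; apply: M_faithful => m; have [s [f [_ wf ->]]] := M_weights m.
by rewrite lact_sum big_seq big1 // => lam /wf; apply: xw.
Qed.

(** On a weight vector of [M] both elements act by scalars, so their bracket acts by zero;
    faithfulness does the rest. *)
Lemma cartan_abelian (y y' : subvs_of h) : lie (vsval y) (vsval y') = 0.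
Proof.
apply: faithful_weights => lam m wm; rewrite lact_lie.
have E z : lact (vsval z) m = (lam z : K) *: m := wm z.
by rewrite !E !lactZr !E !scalerA mulrC subrr.
Qed.

(* Applied to a vector of weight [lam], [ad y - c] multiplies the component of
   weight [mu] by [mu y - lam y - c], so its square and it have the same kernel. *)
Lemma ad_semisimple (y : subvs_of h) c x :
  ad_g y (ad_g y x - c *: x) = c *: (ad_g y x - c *: x) -> ad_g y x = c *: x.
Proof.
set b := _ - _ => yb; apply/subr0_eq; rewrite -/b.
apply: faithful_weights => lam m wm.
have [s [f [us wf xm]]] := M_weights (lact x m).
have ym : lact (vsval y) m = (lam y : K) *: m := wm y.
pose k (mu : weight h) : K := (mu y : K) - (lam y : K) - c.
have bm : lact b m = \sum_(mu <- s) k mu *: f mu.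
  have -> : lact b m = lact (ad_g y x) m - c *: lact x m.
    by rewrite lactDl -scaleNr lactZl scaleNr.
  rewrite lact_lie ym lactZr xm lact_sum !scaler_sumr -!sumrB !big_seq.
  apply: eq_bigr => mu /wf/(_ y) wmu; rewrite -[lact _ _]/(lact_h y (f mu)) wmu.
  by rewrite !scalerBl.
have sum0 : \sum_(mu <- s) (k mu ^+ 2) *: f mu = 0.
  have : lact (ad_g y b) m - c *: lact b m = 0 by rewrite yb lactZl subrr.
  rewrite lact_lie ym lactZr bm lact_sum !scaler_sumr -!sumrB !big_seq => E.
  rewrite -[RHS]E; apply: eq_bigr => mu /wf/(_ y) wmu; rewrite lactZr.
  rewrite -[lact _ _]/(lact_h y (f mu)) wmu !scalerA -!scalerBl; congr (_ *: _).
  by rewrite /k; move: (mu y : K) (lam y : K) => a a'; ring.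
have wkf : {in s, forall mu, weight_vector lact_h mu (k mu ^+ 2 *: f mu)}.
  by move=> mu mus; apply: (weight_vectorZ lact_hZ); apply: wf.
rewrite bm big_seq big1 // => mu mus.
have /eqP := weight_vectors_free lact_hD lact_hZ us wkf sum0 mus.
by rewrite scaler_eq0 expf_eq0 /= -scaler_eq0 => /eqP.
Qed.

Lemma lieC (x y : g) : lie x y = - lie y x.
Proof.
apply/eqP; rewrite -addr_eq0; apply/eqP.
by have := liexx (x + y); rewrite lieDl !lieDr !liexx add0r addr0.
Qed.

Lemma ad_g_comm (y y' : subvs_of h) x : ad_g y (ad_g y' x) = ad_g y' (ad_g y x).
Proof.
have := lie_jacobi (vsval y) (vsval y') x.
have -> : lie x (lie (vsval y) (vsval y')) = 0.
  by rewrite cartan_abelian -[0 in LHS](scale0r 0) lieZr scale0r.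
rewrite addr0 (lieC x) -scaleN1r lieZr scaleN1r.
exact: subr0_eq.
Qed.

Lemma joint_eigenvectors (ys : seq (subvs_of h)) x : exists l : seq g,
  x = \sum_(z <- l) z /\
  forall z, z \in l -> forall y, y \in ys -> exists c, ad_g y z = c *: z.
Proof.
elim: ys x => [|y ys IH] x.
  by exists [:: x]; split=> [|z _ y]; rewrite ?big_seq1.
have [l [-> lP]] := IH x.
suff step z : z \in l -> exists l' : seq g, z = \sum_(w <- l') w /\
    forall w, w \in l' -> forall y', y' \in y :: ys -> exists c, ad_g y' w = c *: w.
  elim: l {lP} step => [|z l IHl] step; first by exists [::]; split=> //; rewrite !big_nil.
  have [l1 [zE l1P]] := step z (mem_head _ _).
  have [|l2 [E2 l2P]] := IHl; first by move=> w wl; apply: step; rewrite inE wl orbT.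
  exists (l1 ++ l2); rewrite big_cons big_cat /= E2 -zE; split=> // w.
  by rewrite mem_cat => /orP[/l1P|/l2P].
move=> zl.
(* [P] consists of the vectors that share the eigenvalues of [z] under all of [ys]; the commuting
   operator [ad_g y] preserves it. *)
pose P : set g := [set w | forall y' c, y' \in ys -> ad_g y' z = c *: z -> ad_g y' w = c *: w].
have P_lin : linear_subspace P.
  split=> [|a u v Pu Pv] y' c y's E; first by have := ad_gZ y' 0 0; rewrite !scale0r scaler0.
  by rewrite ad_gD ad_gZ (Pu y' c) // (Pv y' c) // scalerDr !scalerA mulrC.
have P_ad w : P w -> P (ad_g y w).
  by move=> Pw y' c y's E; rewrite ad_g_comm (Pw y' c) // ad_gZ.
have ad_gL c : {morph ad_g y : u v / c *: u + v} by move=> u v; rewrite ad_gD ad_gZ.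
have [|l' [l'P zE]] := eigen_sumP ad_gL (@ad_semisimple y) P_lin P_ad (x := z).
  by move=> y' c _.
exists [seq p.2 | p <- l']; rewrite big_map; split=> // w /mapP[p pl' ->] y'.
have [Pp Dp] := l'P p pl'; rewrite inE => /orP[/eqP ->|y's]; first by exists p.1.
by have [c E] := lP z zl y' y's; exists c; apply: Pp.
Qed.

Lemma joint_eigenvector_weight (z : g) :
  (forall y : subvs_of h, exists c, ad_g y z = c *: z) ->
  exists lam : weight h, weight_vector ad_g lam z.
Proof.
move=> zP; have [z0|z0] := eqVneq z 0.
  exists 0 => y; rewrite z0 scaler0.
  by have := ad_gZ y 0 0; rewrite !scale0r.
pose c (y : subvs_of h) : K^o := projT1 (cid (zP y)).
have cP y : ad_g y z = (c y : K) *: z by rewrite /c; case: cid.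
have c_lin : linear c.
  move=> a y y'; apply/eqP; rewrite -subr_eq0 -[_ == _](orbF) -(negPf z0) -scaler_eq0.
  rewrite scalerBl scalerDl -!cP /ad_g linearP lieDl lieZl.
  by rewrite -/(ad_g y z) cP scalerA subrr.
have [lam lamP] := exists_weight c_lin.
by exists lam => y; rewrite lamP.
Qed.

(** A vector that is an eigenvector for a basis of [h] is one for all of [h], with an eigenvalue
    linear in [y]; so simultaneous diagonalization for a basis yields the root decomposition. *)
Lemma cartan_spanned x : weight_sum (h := h) ad_g x.
Proof.
have [l [-> lP]] := joint_eigenvectors (vbasis {:subvs_of h}) x.
rewrite big_seq; elim/big_ind: _ => [||z zl].
- exact: (weight_sum0 ad_g).
- by move=> u v; apply: (weight_sumD ad_gD ad_gZ).
have [|lam wz] := @joint_eigenvector_weight z; last exact: weight_sum1 wz.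
move=> y; have [c cP] : exists c : nat -> K, forall i, (i < size (vbasis {:subvs_of h}))%N ->
    ad_g (vbasis {:subvs_of h})`_i z = c i *: z.
  have H i : exists c, (i < size (vbasis {:subvs_of h}))%N -> 
      ad_g (vbasis {:subvs_of h})`_i z = c *: z.
    case: (ltnP i (size (vbasis {:subvs_of h}))) => [lt|_]; last by exists 0.
    by have [c E] := lP z zl _ (mem_nth 0 lt); exists c.
  by exists (fun i => projT1 (cid (H i))) => i; case: (cid (H i)).
exists (\sum_i coord (vbasis {:subvs_of h}) i y * c i).
rewrite {1}(coord_vbasis (memvf y)) /ad_g linear_sum /=.
rewrite (big_morph (fun x => lie x z) (fun a b => lieDl a b z) (_ : lie 0 z = 0)); last first.
  by have := lieZl 0 (0 : g) z; rewrite !scale0r.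
rewrite scaler_suml; apply: eq_bigr => i _.
by rewrite lieZl -scalerA -cP ?size_tuple.
Qed.

End CartanWeights.

(** * Bases, matrices and traces on finite-dimensional subspaces *)

Section Bases.
Variable K : fieldType.

Lemma subspace_sum (M : lmodType K) (V : set M) I (r : seq I) (c : I -> K) (f : I -> M) :
  linear_subspace V -> (forall i, V (f i)) -> V (\sum_(i <- r) c i *: f i).
Proof.
move=> [V0 VL] Vf; elim: r => [|i r IH]; first by rewrite big_nil.
by rewrite big_cons; apply: VL.
Qed.

Lemma basis_inj (M : lmodType K) (V : set M) d (b : 'I_d -> M) (c c' : 'rV[K]_d) :
  linear_subspace V -> is_basis V b ->
  \sum_i c 0 i *: b i = \sum_i c' 0 i *: b i -> c = c'.
Proof.
move=> Vlin [Vb bU] E.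
have [c0 [_ U]] := bU _ (subspace_sum (index_enum 'I_d) (c 0) Vlin Vb).
by rewrite -(U c erefl) -(U c' E).
Qed.

Lemma basis_matrix (M N : lmodType K) (V : set M) (W : set N) d e
    (b : 'I_d -> M) (b' : 'I_e -> N) (f : M -> N) :
  is_basis V b -> is_basis W b' -> (forall m, V m -> W (f m)) ->
  exists A : 'M[K]_(d, e), forall i, f (b i) = \sum_j A i j *: b' j.
Proof.
move=> [Vb _] [_ bW] fVW.
have H i : exists c : 'rV[K]_e, f (b i) = \sum_j c 0 j *: b' j.
  by have [c [cE _]] := bW _ (fVW _ (Vb i)); exists c.
exists (\matrix_(i, j) projT1 (cid (H i)) 0 j) => i.
by under eq_bigr do rewrite mxE; case: (cid (H i)).
Qed.

(** Coordinates are rows, so matrices multiply in the order in which the maps are applied. *)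
Lemma basis_matrix_mul (M N P : lmodType K) (d e k : nat)
    (b : 'I_d -> M) (b' : 'I_e -> N) (b'' : 'I_k -> P) (f : M -> N) (f' : N -> P)
    (A : 'M[K]_(d, e)) (B : 'M[K]_(e, k)) :
  linear f' -> (forall i, f (b i) = \sum_j A i j *: b' j) ->
  (forall i, f' (b' i) = \sum_j B i j *: b'' j) ->
  forall i, f' (f (b i)) = \sum_j (A *m B) i j *: b'' j.
Proof.
move=> fL Af Bf i; have f0 : f' 0 = 0.
  by have := fL (-1) 0 0; rewrite scaler0 addr0 scaleN1r addNr.
have fD : {morph f' : u v / u + v} by move=> u v; rewrite -[u]scale1r fL !scale1r.
have fZ c u : f' (c *: u) = c *: f' u by rewrite -[c *: u]addr0 fL f0 addr0.
rewrite Af (big_morph f' fD f0).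
under eq_bigr => j _ do rewrite fZ Bf scaler_sumr.
rewrite exchange_big /=; apply: eq_bigr => l _.
by rewrite mxE scaler_suml; apply: eq_bigr => j _; rewrite scalerA.
Qed.

Lemma basis_matrix_inj (M N : lmodType K) (W : set N) d e (b : 'I_d -> M) (b' : 'I_e -> N)
    (f : M -> N) (A B : 'M[K]_(d, e)) : linear_subspace W -> is_basis W b' ->
  (forall i, f (b i) = \sum_j A i j *: b' j) ->
  (forall i, f (b i) = \sum_j B i j *: b' j) -> A = B.
Proof.
move=> Wlin bW Af Bf; apply/row_matrixP => i; apply: (basis_inj Wlin bW).
under eq_bigr do rewrite mxE; under [RHS]eq_bigr do rewrite mxE.
by rewrite -Af -Bf.
Qed.

Lemma id_matrix (M : lmodType K) n (c : 'I_n -> M) i :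
  id (c i) = \sum_j (1%:M : 'M[K]_n) i j *: c j.
Proof.
rewrite (bigD1 i) //= big1 => [|j ne]; first by rewrite mxE eqxx mulr1n scale1r addr0.
by rewrite mxE eq_sym (negPf ne) mulr0n scale0r.
Qed.

(** [trace_on] makes a choice. It is determined because two bases, a priori of different sizes, are
    related by rectangular matrices [P] and [Q] that are inverse on both sides, and the trace is
    cyclic. *)
Lemma trace_onE (M : lmodType K) (V : set M) (f : M -> M) d (b : 'I_d -> M) (A : 'M[K]_d) :
  linear_subspace V -> linear f -> is_basis V b ->
  (forall i, f (b i) = \sum_j A i j *: b j) -> trace_on V f = \tr A.
Proof.
move=> Vlin fL bV Af; apply: xget_unique; first by exists d, b, A; split.
move=> _ [e [b' [B [bV' Bf ->]]]].
have idL : linear (@id M) by [].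
have [P Pid] := basis_matrix bV' bV (fun m (Vm : V m) => Vm : V (id m)).
have [Q Qid] := basis_matrix bV bV' (fun m (Vm : V m) => Vm : V (id m)).
have QP : Q *m P = 1%:M.
  have E1 := basis_matrix_mul (f := id) idL Qid Pid.
  exact (@basis_matrix_inj _ _ V _ _ b b id _ _ Vlin bV E1 (id_matrix b)).
have BE : B *m P = P *m A.
  have E1 := basis_matrix_mul (f := f) idL Bf Pid; have E2 := basis_matrix_mul (f := id) fL Pid Af.
  exact (@basis_matrix_inj _ _ V _ _ b' b f _ _ Vlin bV E1 E2).
have PQ : P *m Q = 1%:M.
  have E1 := basis_matrix_mul (f := id) idL Pid Qid.
  exact (@basis_matrix_inj _ _ V _ _ b' b' id _ _ Vlin bV' E1 (id_matrix b')).
by rewrite -[B]mulmx1 -PQ mulmxA mxtrace_mulC BE mulmxA QP mul1mx.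
Qed.

End Bases.

(** * Functions that are polynomial on lines *)

Section Lines.
Variables (K : numFieldType) (g : lieAlgType K) (h : {vspace g}).
Implicit Types (lam mu nu : weight h) (F G : weight h -> K).

(** Weaker than [polynomial_fun], but easily seen to be stable under the operations used below and
    still determined by the values off a finite set, which is what extending identities requires. *)
Definition line_poly F :=
  forall lam nu, exists q : {poly K}, forall s, F (lam + s *: nu) = q.[s].

Lemma line_poly_cst c : line_poly (fun=> c).
Proof. by move=> lam nu; exists c%:P => s; rewrite hornerC. Qed.

Lemma line_polyD F G : line_poly F -> line_poly G -> line_poly (fun lam => F lam + G lam).
Proof.
move=> HF HG lam nu; have [p pE] := HF lam nu; have [q qE] := HG lam nu.
by exists (p + q) => s; rewrite hornerD pE qE.
Qed.

Lemma line_polyM F G : line_poly F -> line_poly G -> line_poly (fun lam => F lam * G lam).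
Proof.
move=> HF HG lam nu; have [p pE] := HF lam nu; have [q qE] := HG lam nu.
by exists (p * q) => s; rewrite hornerM pE qE.
Qed.

Lemma line_polyN F : line_poly F -> line_poly (fun lam => - F lam).
Proof.
by move=> HF lam nu; have [p pE] := HF lam nu; exists (- p) => s; rewrite hornerN pE.
Qed.

Lemma line_polyB F G : line_poly F -> line_poly G -> line_poly (fun lam => F lam - G lam).
Proof. by move=> HF HG; apply: line_polyD => //; apply: line_polyN. Qed.

Lemma line_poly_sum I (r : seq I) (F : I -> weight h -> K) :
  (forall i, line_poly (F i)) -> line_poly (fun lam => \sum_(i <- r) F i lam).
Proof.
move=> HF; elim: r => [|i r IH].
  by rewrite (_ : (fun _ => _) = fun=> 0); [exact: line_poly_cst|apply/funext => lam; rewrite big_nil].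
rewrite (_ : (fun _ => _) = fun lam => F i lam + \sum_(i <- r) F i lam); first exact: line_polyD.
by apply/funext => lam; rewrite big_cons.
Qed.

Lemma line_poly_shift F mu : line_poly F -> line_poly (fun lam => F (mu + lam)).
Proof.
by move=> HF lam nu; have [p pE] := HF (mu + lam) nu; exists p => s; rewrite addrA pE.
Qed.

Lemma line_poly_eval (y : subvs_of h) : line_poly (fun lam => lam y).
Proof.
move=> lam nu; exists ((lam y : K)%:P + (nu y : K) *: 'X) => s.
by rewrite !hornerE !lfunE /= lfunE mulrC.
Qed.

Lemma line_polyX F n : line_poly F -> line_poly (fun lam => F lam ^+ n).
Proof.
move=> HF; elim: n => [|n IH].
  by rewrite (_ : (fun _ => _) = fun=> 1); [exact: line_poly_cst|apply/funext].
rewrite (_ : (fun _ => _) = fun lam => F lam * F lam ^+ n); first exact: line_polyM.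
by apply/funext => lam; rewrite exprS.
Qed.

Lemma line_poly_prod I (r : seq I) (F : I -> weight h -> K) :
  (forall i, line_poly (F i)) -> line_poly (fun lam => \prod_(i <- r) F i lam).
Proof.
move=> HF; elim: r => [|i r IH].
  by rewrite (_ : (fun _ => _) = fun=> 1); [exact: line_poly_cst|apply/funext => lam; rewrite big_nil].
rewrite (_ : (fun _ => _) = fun lam => F i lam * \prod_(i <- r) F i lam); first exact: line_polyM.
by apply/funext => lam; rewrite big_cons.
Qed.

Lemma polynomial_fun_line F : polynomial_fun F -> line_poly F.
Proof.
move=> [n [x [p pE]]].
rewrite (_ : F = fun lam => \sum_(m <- mpoly.msupp p)
    mpoly.mcoeff m p * \prod_(i <- index_enum 'I_n) (lam (x i) : K) ^+ (mpoly.fun_of_multinom m i)).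
  apply: line_poly_sum => m; apply: line_polyM; first exact: line_poly_cst.
  by apply: line_poly_prod => i; apply: line_polyX; apply: line_poly_eval.
by apply/funext => lam; rewrite pE mpoly.mevalE.
Qed.

Lemma newton_line_poly (p : nat -> weight h -> K) n :
  (forall i, line_poly (p i)) -> line_poly (fun lam => newton (p^~ lam) n).
Proof.
move=> Hp; have [m] := ubnP n; elim: m n => // m IH [|n] le.
  rewrite (_ : (fun _ => _) = fun=> 1); [exact: line_poly_cst|exact/funext].
rewrite (_ : (fun _ => _) = fun lam => - n.+1%:R^-1 *
   \sum_(i < n.+1) newton (p^~ lam) (n - i)%N * p i.+1 lam); last first.
  by apply/funext => lam; rewrite newtonS.
apply: line_polyM; first exact: line_poly_cst.
apply: line_poly_sum => i; apply: line_polyM => //; apply: IH.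
by rewrite (leq_ltn_trans (leq_subr _ _)).
Qed.

Lemma cofinite_setI (U U' : set (weight h)) : cofinite U -> cofinite U' -> cofinite (U `&` U').
Proof. by rewrite /cofinite setCI => fU fU'; rewrite finite_setU. Qed.

Lemma cofinite_shift (U : set (weight h)) mu : cofinite U -> cofinite [set lam | U (mu + lam)].
Proof.
move=> fU; apply: (sub_finite_set _ (finite_image (fun lam => lam - mu) fU)).
by move=> lam /= nU; exists (mu + lam) => //; rewrite addrAC subrr add0r.
Qed.

(** Since [nu] is not zero, each excluded weight is met for at most one parameter. *)
Lemma cofinite_line (U : set (weight h)) lam nu : cofinite U -> nu != 0 ->
  exists r : seq K, forall s, s \notin r -> U (lam + s *: nu).
Proof.
move=> /finite_fsetP[X XE] nu0.
have ex (mu : weight h) : exists s0, forall s, lam + s *: nu = mu -> s = s0.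
  case: (pselect (exists s, lam + s *: nu = mu)) => [[s0 E]|H]; last first.
    by exists 0 => s E; case: H; exists s.
  exists s0 => s; rewrite -E => /addrI /eqP; rewrite -subr_eq0 -scalerBl scaler_eq0 (negPf nu0) orbF.
  by rewrite subr_eq0 => /eqP.
exists [seq projT1 (cid (ex mu)) | mu <- enum_fset X] => s sr.
apply: contrapT => nU; case/negP: sr.
have: (~` U) (lam + s *: nu) by [].
rewrite XE /= => sX; apply/mapP; exists (lam + s *: nu) => //.
by case: cid => s0 /= /(_ s erefl).
Qed.

(** Multiplied by the linear factors at the exceptional points, [q] vanishes everywhere; in
    characteristic zero the natural numbers provide more roots than its degree permits. *)
Lemma poly_eq0_cofinite (q : {poly K}) (r : seq K) :
  (forall s, s \notin r -> q.[s] = 0) -> q = 0.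
Proof.
move=> qr; pose p := q * \prod_(z <- r) ('X - z%:P).
have p0 s : root p s.
  rewrite rootM; case: (boolP (s \in r)) => [sr|/qr/eqP]; last by rewrite /root => ->.
  by rewrite root_prod_XsubC sr orbT.
have: p = 0.
  pose t : seq K := [seq i%:R | i <- iota 0 (size p)].
  apply: (@roots_geq_poly_eq0 _ _ t).
  - by apply/allP => s _; exact: p0.
  - by rewrite map_inj_uniq ?iota_uniq // => i j /eqP; rewrite eqr_nat => /eqP.
  - by rewrite size_map size_iota.
move/eqP; rewrite mulf_eq0 => /orP[/eqP //|].
by rewrite prodf_seq_eq0 => /hasP[z _ /=]; rewrite polyXsubC_eq0.
Qed.

Hypothesis h_neq0 : (0 < \dim h)%N.

Lemma exists_weight_neq0 : exists nu : weight h, nu != 0.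
Proof.
have [nu] : exists nu : weight h, nu \notin (0%VS : {vspace weight h}).
  apply: contrapT => H; have E : \dim {:weight h} = 0%N.
    apply/eqP; rewrite dimv_eq0 -subv0; apply/subvP => nu _; apply: contrapT => /negP nu0.
    by apply: H; exists nu.
  by move: h_neq0; rewrite -[\dim h]muln1 -[X in (0 < X)%N]/(dim (weight h)) -dimvf E.
by rewrite memv0; exists nu.
Qed.

(** On a line through [lam] only finitely many parameters leave [U], so the polynomial on that line
    is zero, in particular at parameter 0. *)
Lemma line_poly_eq0 F (U : set (weight h)) : line_poly F -> cofinite U ->
  (forall lam, U lam -> F lam = 0) -> forall lam, F lam = 0.
Proof.
move=> HF fU F0 lam; have [nu nu0] := exists_weight_neq0.
have [q qE] := HF lam nu; have [r rU] := cofinite_line lam fU nu0.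
have q0 : q = 0 by apply: (@poly_eq0_cofinite q r) => s sr; rewrite -qE F0 //; apply: rU.
by have := qE 0; rewrite scale0r addr0 q0 horner0.
Qed.

Lemma line_poly_eq F G (U : set (weight h)) : line_poly F -> line_poly G -> cofinite U ->
  (forall lam, U lam -> F lam = G lam) -> forall lam, F lam = G lam.
Proof.
move=> HF HG fU FG lam; apply/eqP; rewrite -subr_eq0; apply/eqP.
by apply: (line_poly_eq0 (line_polyB HF HG) fU) => mu Umu; rewrite FG ?subrr.
Qed.

End Lines.

(** * Families of traces *)

Section TraceFamily.
Variables (K : numClosedFieldType) (g : lieAlgType K) (h : {vspace g}) (E : algType K).
Variable iota : subvs_of h -> E.
Implicit Types (lam mu al : weight h) (u v : E) (y : subvs_of h).

(* [Phi lam u] models the trace on the weight space [lam] of the degree-0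
   component of [u]. *)
Record trace_family (Phi : weight h -> E -> K) (d : nat) : Prop := TraceFamily {
  tf_linear : forall lam, linear (Phi lam : E -> K^o);
  tf_comm : forall lam al u v, homog iota al u -> Phi lam (v * u) = Phi (al + lam) (u * v);
  tf_off : forall lam al u, homog iota al u -> al != 0 -> Phi lam u = 0;
  tf_iota : forall lam u y, Phi lam (u * iota y) = (lam y : K) * Phi lam u;
  tf_one : forall lam, Phi lam 1 = d%:R;
  tf_CH : forall lam a b, homog iota 0 a -> homog iota 0 b ->
    Phi lam ((\sum_(k < d.+1) newton (fun i => Phi lam (a ^+ i)) k *: a ^+ (d - k)) * b) = 0
}.

Hypothesis E_spanned : forall u, weight_sum (ad_h iota) u.
Hypothesis iotaC : forall y y', iota y * iota y' = iota y' * iota y.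
Hypothesis h_neq0 : (0 < \dim h)%N.
Let comp := weight_comp E_spanned.

Let compL lam : linear (comp lam).
Proof. exact: (weight_comp_linear (ad_hD iota) (ad_hZ iota) E_spanned). Qed.

Let comp_id lam u : homog iota lam u -> comp lam u = u.
Proof. exact: (weight_comp_id (ad_hD iota) (ad_hZ iota)). Qed.

Let comp_neq lam mu u : homog iota lam u -> mu != lam -> comp mu u = 0.
Proof. exact: (weight_comp_neq (ad_hD iota) (ad_hZ iota)). Qed.

Let comp_homog lam u : homog iota lam (comp lam u).
Proof. exact: (weight_compP (ad_hZ iota)). Qed.

Lemma homog_exp a i : homog iota 0 a -> homog iota 0 (a ^+ i).
Proof.
move=> ha; elim: i => [|i IH]; first exact: homog1.
by rewrite exprS; apply: homog0M.
Qed.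

Lemma homog_sum al I (r : seq I) (F : I -> E) :
  (forall i, homog iota al (F i)) -> homog iota al (\sum_(i <- r) F i).
Proof. by move=> HF; apply: (weight_vector_sum (ad_hD iota) (ad_hZ iota)) => i _; exact: HF. Qed.

Lemma homogZ al c u : homog iota al u -> homog iota al (c *: u).
Proof. exact: (weight_vectorZ (ad_hZ iota)). Qed.

Section TraceFamilyOfModule.
Variables (M : lmodType K) (act : E -> M -> M) (actP : is_action act).
Variables (U : set (weight h)) (n : nat).
Let d := n.+1.
Hypothesis U_cofinite : cofinite U.
Hypothesis M_dim : forall lam, U lam -> has_dim (hspace iota act lam) d.
Hypothesis M_poly : forall u, homog iota 0 u -> exists2 P, polynomial_fun P &
  forall lam, U lam -> trace_on (hspace iota act lam) (act u) = P lam.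

(** Total in [u], so that choosing one function per element defines [mtrace]; outside degree zero
    its value is junk. *)
Lemma trace_poly u : exists P : weight h -> K, homog iota 0 u -> polynomial_fun P /\
  forall lam, U lam -> trace_on (hspace iota act lam) (act u) = P lam.
Proof.
case: (pselect (homog iota 0 u)) => [/M_poly[P HP PE]|nu]; first by exists P.
by exists (fun=> 0) => /nu.
Qed.

Definition mtrace u lam : K := projT1 (cid (trace_poly u)) lam.

Lemma mtrace_poly u : homog iota 0 u -> polynomial_fun (mtrace u).
Proof. by rewrite /mtrace; case: cid => P /= HP /HP[]. Qed.

Lemma mtraceE u lam : homog iota 0 u -> U lam ->
  trace_on (hspace iota act lam) (act u) = mtrace u lam.
Proof. by rewrite /mtrace; case: cid => P /= HP /HP[_]; apply. Qed.

Lemma mtrace_mx lam b u (A : 'M[K]_d) : U lam -> homog iota 0 u ->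
  is_basis (hspace iota act lam) b -> (forall i, act u (b i) = \sum_j A i j *: b j) ->
  mtrace u lam = \tr A.
Proof.
move=> Ulam hu bV AE; rewrite -mtraceE //.
exact: (trace_onE (hspace_linear iota actP lam) (act_linear actP u) bV AE).
Qed.

(* Right multiplication by the rows: an anti-representation. *)
Lemma weight_representation lam : U lam -> exists (b : 'I_d -> M) (X : E -> 'M[K]_d),
  [/\ is_basis (hspace iota act lam) b,
   forall u, homog iota 0 u -> forall i, act u (b i) = \sum_j X u i j *: b j,
   forall c u v, homog iota 0 u -> homog iota 0 v -> X (c *: u + v) = c *: X u + X v,
   forall u v, homog iota 0 u -> homog iota 0 v -> X (u * v) = X v *m X u
   & X 1 = 1%:M].
Proof.
move=> Ulam; have [b bV] := M_dim Ulam; have Vlin := hspace_linear iota actP lam.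
have ex u : exists A : 'M[K]_d, homog iota 0 u -> forall i, act u (b i) = \sum_j A i j *: b j.
  case: (pselect (homog iota 0 u)) => [hu|nu]; last by exists 0 => /nu.
  have [A AE] := basis_matrix bV bV (fun m => act0_hspace actP hu (lam := lam) (m := m)).
  by exists A.
pose X u := projT1 (cid (ex u)).
have XE u : homog iota 0 u -> forall i, act u (b i) = \sum_j X u i j *: b j.
  by rewrite /X; case: cid.
have XU u (A : 'M[K]_d) : homog iota 0 u -> (forall i, act u (b i) = \sum_j A i j *: b j) ->
    X u = A.
  move=> hu AE; exact: (basis_matrix_inj Vlin bV (XE u hu) AE).
exists b, X; split=> //.
- move=> c u v hu hv; apply: XU; first exact: homogL.
  move=> i; rewrite (actD actP) (actZ actP) (XE u hu) (XE v hv) scaler_sumr -big_split.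
  by apply: eq_bigr => j _; rewrite !mxE scalerDl scalerA.
- move=> u v hu hv; apply: XU; first exact: homog0M.
  move=> i; rewrite (actM actP).
  exact: (basis_matrix_mul (act_linear actP u) (XE v hv) (XE u hu)).
- apply: XU; first exact: homog1.
  by move=> i; rewrite (act1 actP); exact: (id_matrix b).
Qed.

Lemma mtrace_line u : homog iota 0 u -> line_poly (mtrace u).
Proof. by move/mtrace_poly/polynomial_fun_line. Qed.

(** The identities below that involve a single weight are checked on matrices at weights of [U] and
    extended by this lemma. *)
Lemma mtrace_ext (F G : weight h -> K) : line_poly F -> line_poly G ->
  (forall lam, U lam -> F lam = G lam) -> forall lam, F lam = G lam.
Proof. by move=> HF HG; apply: (line_poly_eq h_neq0 HF HG U_cofinite). Qed.

Lemma mtrace_linear c u v lam : homog iota 0 u -> homog iota 0 v ->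
  mtrace (c *: u + v) lam = c * mtrace u lam + mtrace v lam.
Proof.
move=> hu hv; move: lam; apply: mtrace_ext.
- exact/mtrace_line/homogL.
- apply: line_polyD; last exact: mtrace_line.
  by apply: line_polyM; [exact: line_poly_cst|exact: mtrace_line].
move=> lam Ulam; have [b [X [bV XE XL _ _]]] := weight_representation Ulam.
rewrite (mtrace_mx Ulam _ bV (XE _ (homogL c hu hv))) ?XL //; last exact: homogL.
rewrite (mtrace_mx Ulam _ bV (XE _ hu)) // (mtrace_mx Ulam _ bV (XE _ hv)) //.
by rewrite linearP.
Qed.

Lemma mtrace_one lam : mtrace 1 lam = d%:R.
Proof.
move: lam; apply: mtrace_ext; first exact/mtrace_line/homog1; first exact: line_poly_cst.
move=> lam Ulam; have [b [X [bV XE _ _ X1]]] := weight_representation Ulam.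
by rewrite (mtrace_mx Ulam _ bV (XE _ (homog1 iota))) ?X1 ?mxtrace1 //; exact: homog1.
Qed.

Lemma mtrace_comm al u v lam : homog iota al u -> homog iota (- al) v ->
  mtrace (v * u) lam = mtrace (u * v) (al + lam).
Proof.
move=> hu hv.
have hvu : homog iota 0 (v * u) by rewrite -(addNr al); apply: homogM.
have huv : homog iota 0 (u * v) by rewrite -(subrr al); apply: homogM.
(* Two weights are involved: the identity is checked where both [lam] and [al + lam] lie in [U],
   again a cofinite set. *)
move: lam; apply: (line_poly_eq h_neq0 _ _ (cofinite_setI U_cofinite (cofinite_shift al U_cofinite))).
- exact: mtrace_line.
- exact/line_poly_shift/mtrace_line.
move=> lam [Ulam Ulam']; have [b bV] := M_dim Ulam; have [b' bV'] := M_dim Ulam'.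
have [A AE] := basis_matrix bV bV' (fun m => act_hspace actP hu (lam := lam) (m := m)).
have hvm m : hspace iota act (al + lam) m -> hspace iota act lam (act v m).
  by move/(act_hspace actP hv); rewrite addKr.
have [B BE] := basis_matrix bV' bV hvm.
have E1 i : act (v * u) (b i) = \sum_j (A *m B) i j *: b j.
  by rewrite (actM actP); exact: (basis_matrix_mul (act_linear actP v) AE BE).
have E2 i : act (u * v) (b' i) = \sum_j (B *m A) i j *: b' j.
  by rewrite (actM actP); exact: (basis_matrix_mul (act_linear actP u) BE AE).
by rewrite (mtrace_mx Ulam hvu bV E1) (mtrace_mx Ulam' huv bV' E2) mxtrace_mulC.
Qed.

Lemma mtrace_iota u y lam : homog iota 0 u -> mtrace (u * iota y) lam = (lam y : K) * mtrace u lam.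
Proof.
move=> hu; have huy : homog iota 0 (u * iota y) by apply/homog0M/homog_iota.
move: lam; apply: mtrace_ext; first exact: mtrace_line.
  by apply: line_polyM; [exact: line_poly_eval|exact: mtrace_line].
move=> lam Ulam; have [b [X [bV XE _ _ _]]] := weight_representation Ulam.
rewrite (mtrace_mx Ulam hu bV (XE _ hu)) -linearZ /=.
apply: (mtrace_mx Ulam huy bV) => i.
rewrite (actM actP) (bV.1 i) (actZr actP) (XE _ hu) scaler_sumr.
by apply: eq_bigr => j _; rewrite mxE scalerA.
Qed.

(** At a weight of [U] this is the trace of the Cayley-Hamilton identity multiplied by the matrix of
    [b]. It extends because Newton coefficients are polynomials in traces, hence polynomial on lines
    too. *)
Lemma mtrace_CH a b lam : homog iota 0 a -> homog iota 0 b ->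
  mtrace ((\sum_(k < d.+1) newton (fun i => mtrace (a ^+ i) lam) k *: a ^+ (d - k)) * b) lam = 0.
Proof.
move=> ha hb.
have hab i : homog iota 0 (a ^+ i * b) by apply: homog0M => //; apply: homog_exp.
have mtrace_sum I (r : seq I) (c : I -> K) (k : I -> nat) mu :
    mtrace (\sum_(i <- r) c i *: (a ^+ k i * b)) mu =
    \sum_(i <- r) c i * mtrace (a ^+ k i * b) mu.
  elim: r => [|i r IH].
    rewrite !big_nil; have := mtrace_linear (-1) mu (homog_zero iota 0) (homog_zero iota 0).
    by rewrite scaler0 addr0 mulN1r addNr.
  rewrite !big_cons mtrace_linear ?IH //.
  by apply: homog_sum => j; apply: homogZ.
rewrite mulr_suml; under eq_bigr do rewrite -scalerAl.
rewrite mtrace_sum; move: lam; apply: mtrace_ext => [||lam Ulam]; last 1 first.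
- have [e [X [bV XE XL XM X1]]] := weight_representation Ulam.
  have TX u : homog iota 0 u -> mtrace u lam = \tr (X u).
    by move=> hu; rewrite (mtrace_mx Ulam hu bV (XE _ hu)).
  have Xexp i : X (a ^+ i) = X a ^+ i.
    elim: i => [|i IH]; first by rewrite X1.
    by rewrite exprS XM ?IH -?mulmxE ?exprSr //; apply: homog_exp.
  transitivity (\tr (X b *m \sum_(k < d.+1) newton (fun i => \tr (X a ^+ i)) k *: X a ^+ (d - k))).
    rewrite mulmx_sumr raddf_sum /=; apply: eq_bigr => k _.
    rewrite TX // XM //; last exact: homog_exp.
    rewrite Xexp -scalemxAr linearZ /=; congr (_ * _); apply: eq_newton => i.
    by rewrite TX ?Xexp //; apply: homog_exp.
  by rewrite newton_Cayley_Hamilton mulmx0 raddf0.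
- apply: line_poly_sum => k; apply: line_polyM; last exact: mtrace_line.
  by apply: newton_line_poly => i; apply/mtrace_line/homog_exp.
- exact: line_poly_cst.
Qed.

(** Elements of nonzero degree shift the weight and contribute no diagonal part, whence the
    projection to degree zero. *)
Definition family_of lam u : K := mtrace (comp 0 u) lam.

Lemma family_ofE lam u : homog iota 0 u -> family_of lam u = mtrace u lam.
Proof. by move=> hu; rewrite /family_of comp_id. Qed.

Lemma family_of_linear lam : linear (family_of lam : E -> K^o).
Proof. by move=> c u v; rewrite /family_of compL mtrace_linear. Qed.

Lemma family_of_off lam al u : homog iota al u -> al != 0 -> family_of lam u = 0.
Proof.
move=> hu al0; rewrite /family_of (comp_neq hu) 1?eq_sym //.
have := mtrace_linear (-1) lam (homog_zero iota 0) (homog_zero iota 0).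
by rewrite scaler0 addr0 mulN1r addNr.
Qed.

Lemma homog_ind (P : E -> Prop) :
  (forall u v, P u -> P v -> P (u + v)) -> P 0 ->
  (forall al u, homog iota al u -> P u) -> forall u, P u.
Proof.
move=> PD P0 PH u; rewrite (sum_weight_comp E_spanned u).
by elim/big_ind: _ => // al _; apply: (PH al); exact: comp_homog.
Qed.

Lemma family_of_trace_family : trace_family family_of d.
Proof.
have FD lam u v : family_of lam (u + v) = family_of lam u + family_of lam v.
  by have := family_of_linear lam 1 u v; rewrite !scale1r.
have F0 lam : family_of lam 0 = 0.
  by have := FD lam 0 0; rewrite addr0 -[X in X = _]addr0 => /addrI.
split=> //.
- exact: family_of_linear.
- move=> lam al u v hu; elim/homog_ind: v => [v v' IH IH'||be v hv].
  + by rewrite mulrDl mulrDr !FD IH IH'.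
  + by rewrite mul0r mulr0 !F0.
  (* Unless the degrees of [u] and [v] are opposite, both products have nonzero degree and both
     sides vanish. *)
  have [be_al|ne] := eqVneq be (- al).
    rewrite be_al in hv; rewrite !family_ofE ?(mtrace_comm _ hu hv) //.
      by rewrite -(subrr al); apply: homogM.
    by rewrite -(addNr al); apply: homogM.
  rewrite (family_of_off _ (homogM hv hu)) ?(family_of_off _ (homogM hu hv)) //.
    by rewrite addrC addr_eq0.
  by rewrite addr_eq0.
- exact: family_of_off.
- move=> lam u y; elim/homog_ind: u => [u v IH IH'||al u hu].
  + by rewrite mulrDl !FD IH IH' mulrDr.
  + by rewrite mul0r F0 mulr0.
  have [al0|al0] := eqVneq al 0.
    rewrite al0 in hu; rewrite !family_ofE ?mtrace_iota //.
    by apply: homog0M => //; apply: homog_iota.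
  rewrite (family_of_off _ hu) // mulr0 (family_of_off _ (al := al)) //.
  by rewrite -[al]addr0; apply: homogM => //; apply: homog_iota.
- by move=> lam; rewrite family_ofE ?mtrace_one //; exact: homog1.
- move=> lam a b ha hb; rewrite family_ofE; last first.
    apply: homog0M => //; apply: homog_sum => k; apply: homogZ; exact: homog_exp.
  rewrite -[RHS](mtrace_CH lam ha hb); congr (mtrace (_ * _) _).
  apply: eq_bigr => k _; congr (_ *: _); apply: eq_newton => i.
  by rewrite family_ofE //; apply: homog_exp.
Qed.

End TraceFamilyOfModule.
End TraceFamily.

(** * Idempotents in the algebra of degree zero *)

Section DegreeZero.
Variables (K : numClosedFieldType) (g : lieAlgType K) (h : {vspace g}) (E : algType K).
Variable iota : subvs_of h -> E.

Definition homog0 : {pred E} := fun u => `[< homog iota 0 u >].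

Lemma homog0P u : reflect (homog iota 0 u) (u \in homog0).
Proof. exact: asboolP. Qed.

Lemma homog0_subalg_closed : subalg_closed homog0.
Proof.
split=> [|c u v /homog0P hu /homog0P hv|u v /homog0P hu /homog0P hv]; apply/homog0P.
- exact: homog1.
- exact: homogL.
- exact: homog0M.
Qed.

HB.instance Definition _ := GRing.isSubalgClosed.Build K E homog0 homog0_subalg_closed.

Record degree0 := Degree0 { degree0_val :> E; degree0P : degree0_val \in homog0 }.
HB.instance Definition _ := [isSub for degree0_val].
HB.instance Definition _ := [Choice of degree0 by <:].
HB.instance Definition _ := [SubChoice_isSubAlgebra of degree0 by <:].

Variables (Phi : weight h -> E -> K) (d : nat).
Hypothesis tf : trace_family iota Phi d.
Hypothesis d_gt0 : (0 < d)%N.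
Hypothesis E_spanned : forall u, weight_sum (ad_h iota) u.
Implicit Types (lam mu al : weight h) (u v w : E) (y : subvs_of h).

Lemma PhiD lam u v : Phi lam (u + v) = Phi lam u + Phi lam v.
Proof. by have := tf_linear tf lam 1 u v; rewrite !scale1r. Qed.

Lemma PhiZ lam c u : Phi lam (c *: u) = c * Phi lam u.
Proof. 
have F0 : Phi lam 0 = 0 by have := PhiD lam 0 0; rewrite addr0 -[X in X = _]addr0 => /addrI.
by have := tf_linear tf lam c u 0; rewrite F0 !addr0.
Qed.

Lemma Phi0 lam : Phi lam 0 = 0.
Proof. by rewrite -(scale0r 0) PhiZ mul0r. Qed.

Lemma Phi_sum lam I (r : seq I) (P : pred I) (F : I -> E) :
  Phi lam (\sum_(i <- r | P i) F i) = \sum_(i <- r | P i) Phi lam (F i).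
Proof. exact: (big_morph _ (PhiD lam) (Phi0 lam)). Qed.

Lemma Phi_comm lam mu u v : homog iota (mu - lam) u -> Phi lam (v * u) = Phi mu (u * v).
Proof. by move=> /(tf_comm tf) ->; rewrite subrK. Qed.

Lemma Phi_comm0 lam u v : homog iota 0 u -> Phi lam (v * u) = Phi lam (u * v).
Proof. by move=> hu; apply: Phi_comm; rewrite subrr. Qed.

(** [trace_decomposition] for the trace [Phi lam] on degree zero. The test element [c] ranges over
    all of [E] and stands on the left, the form in which congruence modulo the radical is used
    later. *)
Lemma degree0_decomposition lam : exists s : seq E,
  [/\ forall e, e \in s -> homog iota 0 e,
      forall e, e \in s -> exists2 n, Phi lam e = n%:R & (0 < n)%N,
      forall e, e \in s -> forall b c, homog iota 0 b ->
        Phi lam (c * (e * b * e)) = Phi lam (e * b) / Phi lam e * Phi lam (c * e),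
      forall i j c, (i < size s)%N -> (j < size s)%N ->
        Phi lam (c * (s`_i * s`_j)) = (i == j)%:R * Phi lam (c * s`_i)
    & forall c, \sum_(e <- s) Phi lam (c * e) = Phi lam c].
Proof.
pose T (a : degree0) : K := Phi lam (degree0_val a).
have T_lin : scalar T by move=> c a b; rewrite /T /= PhiD PhiZ.
pose TL := GRing.isLinear.Build K degree0 K *%R T T_lin.
pose T' : {scalar degree0} := HB.pack T TL.
have TC (a b : degree0) : T' (a * b) = T' (b * a).
  by rewrite /= /T /= Phi_comm0 //; apply/homog0P/degree0P.
have T1 : T' 1 != 0 by rewrite /= /T (tf_one tf) pnatr_eq0 -lt0n.
have valX (a : degree0) i : degree0_val (a ^+ i) = degree0_val a ^+ i.
  by elim: i => // i IH; rewrite !exprS -IH.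
have valM (a b : degree0) : degree0_val (a * b) = degree0_val a * degree0_val b by [].
have val_sum I (r : seq I) (F : I -> degree0) :
    degree0_val (\sum_(i <- r) F i) = \sum_(i <- r) degree0_val (F i).
  by elim: r => [|i r IH]; rewrite ?big_nil // !big_cons -IH.
have TCH (a b : degree0) : T' ((\sum_(k < d.+1) newton (fun i => T' (a ^+ i)) k *: a ^+ (d - k)) * b) = 0.
  have ha := homog0P _ (degree0P a); have hb := homog0P _ (degree0P b).
  rewrite -[RHS](tf_CH tf lam ha hb) /= /T valM val_sum; congr (Phi _ (_ * _)).
  apply: eq_bigr => k _; rewrite -valX; congr (_ *: _); apply: eq_newton => i.
  by rewrite /= /T valX.
have [s [s1 s2 s3 s4]] := trace_decomposition TC T1 TCH.
have hom (a : degree0) : homog iota 0 (degree0_val a) by apply/homog0P/degree0P.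
(* Both sides vanish on components of nonzero degree. *)
have red (A B : E -> K) :
    (forall u v, A (u + v) = A u + A v) -> (forall u v, B (u + v) = B u + B v) ->
    (forall al u, al != 0 -> homog iota al u -> A u = 0 /\ B u = 0) ->
    (forall a : degree0, A a = B a) -> forall u, A u = B u.
  move=> AD BD AB0 AB u.
  have A0 : A 0 = 0 by have := AD 0 0; rewrite addr0 -[X in X = _]addr0 => /addrI.
  have B0 : B 0 = 0 by have := BD 0 0; rewrite addr0 -[X in X = _]addr0 => /addrI.
  elim/(homog_ind E_spanned): u => [u v IH IH'||al u hu].
  - by rewrite AD BD IH IH'.
  - by rewrite A0 B0.
  have [al0|al0] := eqVneq al 0; last by have [-> ->] := AB0 _ _ al0 hu.
  rewrite al0 in hu; have uh : u \in homog0 by apply/homog0P.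
  exact: (AB (Degree0 uh)).
have off al u x : al != 0 -> homog iota al u -> homog iota 0 x -> Phi lam (u * x) = 0.
  by move=> al0 hu hx; apply: (tf_off tf _ _ al0); rewrite -[al]addr0; apply: homogM.
exists (map degree0_val s); split.
- by move=> _ /mapP[a _ ->].
- by move=> _ /mapP[a /s1 H ->].
- move=> _ /mapP[a as_ ->] b c hb; have bh : b \in homog0 by apply/homog0P.
  have key := s2 a as_ (Degree0 bh).
  have haba : homog iota 0 (degree0_val a * b * degree0_val a).
    by do !apply: homog0M => //.
  move: c; apply: red => [u v|u v|al u al0 hu|c].
  + by rewrite mulrDl PhiD.
  + by rewrite mulrDl PhiD mulrDr.
  + by rewrite !(off _ _ _ al0 hu) // mulr0.
  + by rewrite (Phi_comm0 lam _ haba) (Phi_comm0 lam _ (hom a)); exact: key c.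
- move=> i j c; rewrite size_map => lti ltj; rewrite !(nth_map 0) //.
  move: c; apply: red => [u v|u v|al u al0 hu|c].
  + by rewrite mulrDl PhiD.
  + by rewrite mulrDl PhiD mulrDr.
  + by rewrite !(off _ _ _ al0 hu) ?mulr0 //; apply: homog0M.
  + rewrite (Phi_comm0 lam c (homog0M (hom _) (hom _))) (Phi_comm0 lam c (hom _)).
    exact: (s3 i j c lti ltj).
- apply: red => [u v|u v|al u al0 hu|c].
  + by rewrite -big_split; apply: eq_bigr => e _; rewrite mulrDl PhiD.
  + exact: PhiD.
  + rewrite (tf_off tf _ hu al0) big_map big1 // => a _.
    by rewrite (off _ _ _ al0 hu).
  + rewrite big_map -[RHS]/(T' c) -s4; apply: eq_bigr => a _.
    exact: (Phi_comm0 lam _ (hom a)).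
Qed.
End DegreeZero.

(** * Matrix units *)

Section MatrixUnits.
Variables (K : numClosedFieldType) (g : lieAlgType K) (h : {vspace g}) (E : algType K).
Variables (iota : subvs_of h -> E) (Phi : weight h -> E -> K) (d : nat).
Hypothesis tf : trace_family iota Phi d.
Hypothesis d_gt0 : (0 < d)%N.
Hypothesis E_spanned : forall u, weight_sum (ad_h iota) u.
Implicit Types (lam mu al : weight h) (u v w : E) (y : subvs_of h).

(** All weights share one index type: [wt] gives the weight of an idempotent and [over] lists each
    fibre. The idempotent laws hold only modulo the radical at that weight, hence the identities
    under [Phi] with a test factor [c]. *)
Record idem_system (J : choiceType) (wt : J -> weight h) (e : J -> E) (n : J -> nat)
    (over : weight h -> seq J) : Prop := IdemSystem {
  is_uniq : forall lam, uniq (over lam);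
  is_mem : forall lam j, (j \in over lam) = (wt j == lam);
  is_homog : forall j, homog iota 0 (e j);
  is_gt0 : forall j, (0 < n j)%N;
  is_trace : forall j, Phi (wt j) (e j) = (n j)%:R;
  is_prim : forall j b c, homog iota 0 b ->
    Phi (wt j) (c * (e j * b * e j)) = Phi (wt j) (e j * b) / (n j)%:R * Phi (wt j) (c * e j);
  is_orth : forall j k c, wt j = wt k ->
    Phi (wt j) (c * (e j * e k)) = (j == k)%:R * Phi (wt j) (c * e j);
  is_sum : forall lam c, \sum_(j <- over lam) Phi lam (c * e j) = Phi lam c
}.

Lemma exists_idem_system : exists (J : choiceType) (wt : J -> weight h) (e : J -> E)
  (n : J -> nat) (over : weight h -> seq J), idem_system wt e n over.
Proof.
pose s lam := projT1 (cid (degree0_decomposition tf d_gt0 E_spanned lam)).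
pose P (p : weight h * nat) := (p.2 < size (s p.1))%N.
pose J : choiceType := {p : weight h * nat | P p}.
pose wt (j : J) := (val j).1.
pose e (j : J) : E := (s (wt j))`_(val j).2.
pose over lam : seq J := pmap insub [seq (lam, i) | i <- seq.iota 0 (size (s lam))].
have sP lam : [/\ forall e, e \in s lam -> homog iota 0 e,
      forall e, e \in s lam -> exists2 n, Phi lam e = n%:R & (0 < n)%N,
      forall e, e \in s lam -> forall b c, homog iota 0 b ->
        Phi lam (c * (e * b * e)) = Phi lam (e * b) / Phi lam e * Phi lam (c * e),
      forall i j c, (i < size (s lam))%N -> (j < size (s lam))%N ->
        Phi lam (c * ((s lam)`_i * (s lam)`_j)) = (i == j)%:R * Phi lam (c * (s lam)`_i)
    & forall c, \sum_(e <- s lam) Phi lam (c * e) = Phi lam c].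
  by rewrite /s; case: cid.
have es (j : J) : e j \in s (wt j) by apply: mem_nth; exact: (valP j).
have nP (j : J) : exists n : nat, Phi (wt j) (e j) = n%:R /\ (0 < n)%N.
  by have [_ H _ _ _] := sP (wt j); have [n] := H _ (es j); exists n.
pose n j := projT1 (cid (nP j)).
have nE j : Phi (wt j) (e j) = (n j)%:R by rewrite /n; case: cid => k [].
have n0 j : (0 < n j)%N by rewrite /n; case: cid => k [].
exists J, wt, e, n, over; split=> //.
- move=> lam; rewrite pmap_sub_uniq // map_inj_uniq ?iota_uniq // => i i' [] //.
- move=> lam j; rewrite mem_pmap_sub /=; apply/mapP/eqP => [[i _]|<-].
    by move=> Ej; rewrite /wt (Ej : val j = _).
  exists (val j).2; last by rewrite /wt; case: (j) => -[].
  by rewrite mem_iota /=; exact: (valP j).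
- by move=> j; have [H _ _ _ _] := sP (wt j); apply: H.
- move=> j b c hb; have [_ _ H _ _] := sP (wt j).
  by rewrite (H _ (es j) b c hb) nE.
- move=> j k c ejk; have [_ _ _ H _] := sP (wt j).
  have kP : ((val k).2 < size (s (wt j)))%N by rewrite ejk; exact: (valP k).
  rewrite /e -ejk (H _ _ c (valP j) kP).
  have -> // : (j == k) = ((val j).2 == (val k).2).
  apply/eqP/eqP => [-> //|E2]; apply/val_inj; move: ejk E2; rewrite /wt.
  by case: (j) (k) => [[a b] ?] [[a' b'] ?] /= -> ->.
- move=> lam c; have [_ _ _ _ <-] := sP lam.
  have -> : s lam = [seq e j | j <- over lam].
    rewrite -[LHS](mkseq_nth 0) /mkseq /over.
    have : {subset seq.iota 0 (size (s lam)) <= [pred i | P (lam, i)]}.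
      by move=> k; rewrite mem_iota.
    elim: (seq.iota _ _) => //= k r IH sub.
    have Pk : P (lam, k) by have := sub k (mem_head _ _).
    by rewrite insubT /= IH // => l lr; apply: sub; rewrite inE lr orbT.
  by rewrite big_map.
Qed.

Variables (J : choiceType) (wt : J -> weight h) (e : J -> E) (n : J -> nat).
Variable over : weight h -> seq J.
Hypothesis sys : idem_system wt e n over.
Implicit Types (i j k l : J).

(* Equality modulo the radical of the trace form at [lam]. *)
Definition eqr lam u v := forall w, Phi lam (w * u) = Phi lam (w * v).

Lemma eqr_sym lam u v : eqr lam u v -> eqr lam v u.
Proof. by move=> H w; rewrite H. Qed.

Lemma eqr_trans lam v u w : eqr lam u v -> eqr lam v w -> eqr lam u w.
Proof. by move=> H H' x; rewrite H H'. Qed.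

Lemma eqrMl lam w u v : eqr lam u v -> eqr lam (w * u) (w * v).
Proof. by move=> H x; rewrite !mulrA H. Qed.

(** Under the trace, [x] passes from the right end to the left while the weight changes from [lam]
    to [mu]; so a congruence at [mu] becomes one at [lam]. *)
Lemma eqrMr lam mu x u v : homog iota (mu - lam) x -> eqr mu u v -> eqr lam (u * x) (v * x).
Proof. by move=> hx H w; rewrite !mulrA !(Phi_comm tf _ hx) !mulrA H. Qed.

Lemma eqrZ lam c u v : eqr lam u v -> eqr lam (c *: u) (c *: v).
Proof. by move=> H w; rewrite -!scalerAr !(PhiZ tf) H. Qed.

Lemma eqr_Phi lam u v : eqr lam u v -> Phi lam u = Phi lam v.
Proof. by move=> /(_ 1); rewrite !mul1r. Qed.

Lemma nK_neq0 j : (n j)%:R != 0 :> K.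
Proof. by rewrite pnatr_eq0 -lt0n (is_gt0 sys). Qed.

Lemma eqr_idem j : eqr (wt j) (e j * e j) (e j).
Proof. by move=> w; rewrite (is_orth sys) // eqxx mul1r. Qed.

Lemma eqr_orth j k : wt j = wt k -> j != k -> eqr (wt j) (e j * e k) 0.
Proof. by move=> ejk /negPf neq w; rewrite (is_orth sys) // neq mul0r mulr0 (Phi0 tf). Qed.

Lemma eqr_prim j b : homog iota 0 b ->
  eqr (wt j) (e j * b * e j) ((Phi (wt j) (e j * b) / (n j)%:R) *: e j).
Proof. by move=> hb w; rewrite (is_prim sys) // -scalerAr (PhiZ tf). Qed.

Lemma eqr_one lam : eqr lam (\sum_(j <- over lam) e j) 1.
Proof. by move=> w; rewrite mulr_sumr (Phi_sum tf) mulr1 (is_sum sys). Qed.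

(* [p] and [q] are mutually inverse arrows between the idempotents [i] and [j]. *)
Definition arrows i j p q := [/\ homog iota (wt j - wt i) p, homog iota (wt i - wt j) q,
  [/\ eqr (wt i) (e j * p) p & eqr (wt i) (p * e i) p],
  [/\ eqr (wt j) (e i * q) q & eqr (wt j) (q * e j) q]
  & [/\ eqr (wt i) (q * p) (e i) & eqr (wt j) (p * q) (e j)]].

Definition linked i j := exists p q, arrows i j p q.

Lemma linked_refl i : linked i i.
Proof.
exists (e i), (e i); split; rewrite ?subrr; try exact: (is_homog sys); split; exact: eqr_idem.
Qed.

Lemma linked_sym i j : linked i j -> linked j i.
Proof. by move=> [p [q [hp hq [? ?] [? ?] [? ?]]]]; exists q, p; split. Qed.

Lemma homogB lam mu nu u v :
  homog iota (nu - mu) u -> homog iota (mu - lam) v -> homog iota (nu - lam) (u * v).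
Proof.
move=> hu hv; have -> : nu - lam = (nu - mu) + (mu - lam) by rewrite addrA subrK.
exact: homogM.
Qed.

Lemma homogr0 lam u : homog iota 0 u -> homog iota (lam - lam) u.
Proof. by rewrite subrr. Qed.

Lemma linked_trans j i k : linked i j -> linked j k -> linked i k.
Proof.
move=> [p [q [hp hq [ep pe] [eq qe] [qp pq]]]] [p' [q' [hp' hq' [ep' pe'] [eq' qe'] [qp' pq']]]].
exists (p' * p), (q * q'); split; try exact: (homogB (mu := wt j)).
- by split; [rewrite mulrA; apply: eqrMr hp ep'|rewrite -mulrA; apply: eqrMl].
- by split; [rewrite mulrA; apply: eqrMr hq' eq|rewrite -mulrA; apply: eqrMl].
- split.
  + apply: eqr_trans qp; rewrite -mulrA; apply: eqrMl; rewrite mulrA.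
    by apply: (eqr_trans (eqrMr hp qp')).
  + apply: eqr_trans pq'; rewrite -mulrA; apply: eqrMl; rewrite mulrA.
    by apply: (eqr_trans (eqrMr hq' pq)).
Qed.

(** If [w * (e j * u * e i)] has nonzero trace, then [e i * w * e j * u * e i] is a nonzero multiple
    of [e i] by primitivity, and after rescaling [e j * u * e i] and [e i * w * e j] are inverse
    arrows. *)
Lemma linkedP i j : linked i j \/
  forall u, homog iota (wt j - wt i) u -> eqr (wt i) (e j * u * e i) 0.
Proof.
case: (pselect (exists u w, [/\ homog iota (wt j - wt i) u, homog iota (wt i - wt j) w
   & Phi (wt i) (w * (e j * u * e i)) <> 0])) => [[u [w [hu hw ne]]]|H]; last first.
  right=> u hu w; rewrite mulr0 (Phi0 tf).
  have hx : homog iota (wt j - wt i) (e j * u * e i).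
    apply: (homogB (mu := wt i)); last exact/homogr0/(is_homog sys).
    by apply: (homogB (mu := wt j)) => //; exact/homogr0/(is_homog sys).
  elim/(homog_ind E_spanned): w => [w w' IH IH'||be w hw].
  - by rewrite mulrDl (PhiD tf) IH IH' addr0.
  - by rewrite mul0r (Phi0 tf).
  (* Only a factor [w] of the opposite degree can give a nonzero trace. *)
  have [be0|be0] := eqVneq (be + (wt j - wt i)) 0; last exact: (tf_off tf _ (homogM hw hx)).
  apply: contrapT => ne; apply: H; exists u, w; split=> //.
  by move/eqP: be0; rewrite addr_eq0 opprB => /eqP <-.
left; have he k := is_homog sys k; have he' k lam := homogr0 lam (he k).
pose b := w * e j * u.
have hb : homog iota 0 b.
  by rewrite -(subrr (wt i)); apply: (homogB (mu := wt j)) => //; apply: (homogB (mu := wt j)).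
(* The multiple of [e i] to which [e i * b * e i] is congruent; its inverse normalizes [q]. *)
pose c := Phi (wt i) (e i * b) / (n i)%:R.
have c0 : c != 0.
  rewrite mulf_eq0 invr_eq0 negb_or nK_neq0 andbT.
  apply/eqP => E0; apply: ne; rewrite -E0 /b.
  by rewrite !mulrA (Phi_comm tf _ (he' i (wt i))) !mulrA.
have hp : homog iota (wt j - wt i) (e j * u * e i).
  by apply: (homogB (mu := wt i)) => //; apply: (homogB (mu := wt j)).
have hq : homog iota (wt i - wt j) (c^-1 *: (e i * w * e j)).
  by apply: homogZ; apply: (homogB (mu := wt j)) => //; apply: (homogB (mu := wt i)).
have qp : eqr (wt i) (c^-1 *: (e i * w * e j) * (e j * u * e i)) (e i).
  rewrite -scalerAl; apply: (eqr_trans (v := c^-1 *: (e i * b * e i))).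
    apply: eqrZ; rewrite /b -!mulrA; apply/eqrMl/eqrMl.
    by rewrite !mulrA; apply: (eqrMr (he' i _)); apply: (eqrMr hu); apply: eqr_idem.
  by move=> x; rewrite -scalerAr (PhiZ tf) (eqr_prim i hb) -/c -scalerAr (PhiZ tf) mulKf.
have jp : eqr (wt i) (e j * (e j * u * e i)) (e j * u * e i).
  rewrite !mulrA; apply: (eqrMr (he' i _)); apply: (eqrMr hu); exact: eqr_idem.
have pi_ : eqr (wt i) (e j * u * e i * e i) (e j * u * e i).
  by rewrite -mulrA; apply: eqrMl; apply: eqr_idem.
have iq : eqr (wt j) (e i * (c^-1 *: (e i * w * e j))) (c^-1 *: (e i * w * e j)).
  rewrite -scalerAr; apply: eqrZ; rewrite !mulrA.
  apply: (eqrMr (he' j _)); apply: (eqrMr hw); exact: eqr_idem.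
have qj : eqr (wt j) (c^-1 *: (e i * w * e j) * e j) (c^-1 *: (e i * w * e j)).
  by rewrite -scalerAl; apply: eqrZ; rewrite -[X in eqr _ X _]mulrA; apply: eqrMl; apply: eqr_idem.
move: hp hq qp jp pi_ iq qj; set p := e j * u * e i; set q := c^-1 *: _.
move=> hp hq qp jp pi_ iq qj; exists p, q; split=> //; split=> //.
pose x := u * e i * (c^-1 *: (e i * w)).
have hx : homog iota 0 x.
  rewrite -(subrr (wt j)); apply: (homogB (mu := wt i)).
    by apply: (homogB (mu := wt i)).
  by apply: homogZ; apply: (homogB (mu := wt i)).
have pqE : p * q = e j * x * e j by rewrite /p /q /x -!scalerAr -!scalerAl !mulrA.
(* By primitivity of [e j], [p * q] is congruent to [c' *: e j]. It is idempotent and has the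
   nonzero trace of [q * p], so [c'] is 1. *)
pose c' := Phi (wt j) (e j * x) / (n j)%:R.
have pq : eqr (wt j) (p * q) (c' *: e j) by rewrite pqE; apply: eqr_prim.
have pqpq : eqr (wt j) (p * q * (p * q)) (p * q).
  rewrite -mulrA; apply: eqrMl; rewrite mulrA; apply: (eqr_trans (eqrMr hq qp)).
  exact: iq.
have c'0 : c' != 0.
  apply: contraTneq (nK_neq0 i) => c'0; rewrite negbK -(is_trace sys) -(eqr_Phi qp).
  by rewrite (Phi_comm tf _ hp) (eqr_Phi pq) c'0 scale0r (Phi0 tf).
suff c'1 : c' = 1 by rewrite c'1 scale1r in pq.
have hpq : homog iota (wt j - wt j) (p * q) by apply: (homogB (mu := wt i)).
have E2 : eqr (wt j) (p * q * (p * q)) ((c' * c') *: e j).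
  apply: (eqr_trans (eqrMr hpq pq)); rewrite -scalerAl -scalerA; apply: eqrZ.
  apply: (eqr_trans (eqrMl (e j) pq)); rewrite -scalerAr; apply: eqrZ; exact: eqr_idem.
have := eqr_Phi E2; rewrite (eqr_Phi pqpq) (eqr_Phi pq) !(PhiZ tf) (is_trace sys).
by move/(mulIf (nK_neq0 j))/esym => /(congr1 (fun z => c'^-1 * z)); rewrite mulKf // mulVf.
Qed.

(** Both are the trace of a pair of inverse arrows, read as [q * p] at one end and as [p * q] at the
    other. *)
Lemma linked_n i j : linked i j -> n i = n j.
Proof.
move=> [p [q [hp hq _ _ [qp pq]]]]; apply/eqP; rewrite -(eqr_nat K).
by rewrite -!(is_trace sys) -(eqr_Phi qp) -(eqr_Phi pq) (Phi_comm tf _ hp).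
Qed.

Lemma has_linked j : exists i, `[< linked i j >].
Proof. by exists j; apply/asboolP/linked_refl. Qed.

Definition rep j : J := xchoose (has_linked j).

Lemma rep_linked j : linked (rep j) j.
Proof. by apply/asboolP; exact: (xchooseP (has_linked j)). Qed.

(** Linked indices define the same predicate, and [xchoose] depends only on the predicate. *)
Lemma linked_rep j k : linked j k -> rep j = rep k.
Proof.
move=> ljk; apply: eq_xchoose => i; apply/asboolP/asboolP => li.
  exact: linked_trans li ljk.
exact: linked_trans li (linked_sym ljk).
Qed.

Lemma rep_idem j : rep (rep j) = rep j.
Proof. exact/linked_rep/rep_linked. Qed.

Lemma rep_n j : n (rep j) = n j.
Proof. exact/linked_n/rep_linked. Qed.

(** These arrows start at the representative. For [j] and [k] in one class, [pj k * qj j] then plays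
    the matrix unit from [j] to [k]. *)
Definition pj j : E := projT1 (cid (rep_linked j)).
Definition qj j : E := projT1 (cid (projT2 (cid (rep_linked j)))).

Lemma arrowsP j : arrows (rep j) j (pj j) (qj j).
Proof. by rewrite /pj /qj; case: cid => p /= ex; case: cid. Qed.

Lemma homog_pj j : homog iota (wt j - wt (rep j)) (pj j).
Proof. by have [] := arrowsP j. Qed.

Lemma homog_qj j : homog iota (wt (rep j) - wt j) (qj j).
Proof. by have [] := arrowsP j. Qed.

Lemma eqr_epj j : eqr (wt (rep j)) (e j * pj j) (pj j).
Proof. by have [_ _ []] := arrowsP j. Qed.

Lemma eqr_pje j : eqr (wt (rep j)) (pj j * e (rep j)) (pj j).
Proof. by have [_ _ []] := arrowsP j. Qed.

Lemma eqr_eqj j : eqr (wt j) (e (rep j) * qj j) (qj j).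
Proof. by have [_ _ _ []] := arrowsP j. Qed.

Lemma eqr_qje j : eqr (wt j) (qj j * e j) (qj j).
Proof. by have [_ _ _ []] := arrowsP j. Qed.

Lemma eqr_qp j : eqr (wt (rep j)) (qj j * pj j) (e (rep j)).
Proof. by have [_ _ _ _ []] := arrowsP j. Qed.

Lemma eqr_pq j : eqr (wt j) (pj j * qj j) (e j).
Proof. by have [_ _ _ _ []] := arrowsP j. Qed.

(* Matrix coefficients: [u * pj j] is the sum of [coef k j u *: pj k] modulo
   the radical, see [eqr_expand]. *)
Definition coef k j u : K :=
  if rep k == rep j then Phi (wt (rep j)) (qj k * u * pj j) / (n j)%:R else 0.

Lemma coef_linear k j : linear (coef k j : E -> K^o).
Proof.
move=> c u v; rewrite /coef; case: eqP => _; last by rewrite scaler0 addr0.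
rewrite mulrDr mulrDl (PhiD tf) -scalerAr -scalerAl (PhiZ tf) mulrDl.
by congr (_ + _); exact/esym/mulrA.
Qed.

Lemma sub_sub_cancel (V : zmodType) (r k a j : V) : (r - k) + a + (j - r) = (a + j) - k.
Proof. by rewrite -!addrA addrC -!addrA addNr addr0 addrC -addrA. Qed.

Lemma coef_off k j al u : homog iota al u -> wt k != al + wt j -> coef k j u = 0.
Proof.
move=> hu ne; rewrite /coef; case: eqP => // E1.
rewrite (tf_off tf _ (homogM (homogM (homog_qj k) hu) (homog_pj j))) ?mul0r //.
by rewrite E1 sub_sub_cancel subr_eq0 eq_sym.
Qed.

Lemma coef_rep k j u : rep k != rep j -> coef k j u = 0.
Proof. by rewrite /coef => /negPf ->. Qed.

(* For [k] not linked to [j], [e k * u * e j] lies in the radical. *)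
Lemma eqr_expand j al u : homog iota al u ->
  eqr (wt (rep j)) (u * pj j) (\sum_(k <- over (al + wt j)) coef k j u *: pj k).
Proof.
move=> hu.
have hup : homog iota (al + wt j - wt (rep j)) (u * pj j).
  by rewrite -addrA; apply: homogM => //; exact: homog_pj.
apply: (eqr_trans (v := \sum_(k <- over (al + wt j)) e k * (u * pj j))).
  rewrite -mulr_suml -[X in eqr _ X _]mul1r; apply: (eqrMr hup).
  exact/eqr_sym/eqr_one.
move=> w; rewrite !mulr_sumr !(Phi_sum tf) big_seq [RHS]big_seq; apply: eq_bigr => k.
rewrite (is_mem sys) => /eqP wk; move: w.
have hup' : homog iota (wt k - wt (rep j)) (u * pj j) by rewrite wk.
have hu' : homog iota (wt k - wt j) u by rewrite wk addrK.
have [E1|ne] := eqVneq (rep k) (rep j); last first.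
  rewrite -/(eqr _ _ _) coef_rep // scale0r.
  case: (linkedP j k) => [/linked_rep E2|H]; first by rewrite E2 eqxx in ne.
  apply: (eqr_trans (v := e k * u * e j * pj j)).
    by rewrite [X in eqr _ X _]mulrA -[X in eqr _ _ X]mulrA; apply/eqrMl/eqr_sym/eqr_epj.
  rewrite -(mul0r (pj j)); apply: (eqrMr (homog_pj j)); exact: H.
rewrite -/(eqr _ _ _).
have hb : homog iota 0 (qj k * u * pj j).
  rewrite -(subrr (wt (rep k))); apply: (homogB (mu := wt j)); last by rewrite E1; exact: homog_pj.
  by apply: (homogB (mu := wt k)) => //; exact: homog_qj.
apply: (eqr_trans (v := pj k * qj k * (u * pj j))).
  exact/(eqrMr hup')/eqr_sym/eqr_pq.
apply: (eqr_trans (v := pj k * (e (rep j) * (qj k * u * pj j) * e (rep j)))).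
  rewrite -mulrA; apply: eqrMl; rewrite -E1.
  apply: (eqr_trans (v := e (rep k) * (qj k * u * pj j))).
    rewrite !mulrA -[X in eqr _ X _]mulrA -[X in eqr _ _ X]mulrA; rewrite E1; apply: (eqrMr hup').
    by rewrite -E1; exact/eqr_sym/eqr_eqj.
  rewrite -[X in eqr _ _ X]mulrA; apply: eqrMl; rewrite -[X in eqr _ _ X]mulrA; apply: eqrMl.
  by rewrite E1; exact/eqr_sym/eqr_pje.
apply: (eqr_trans (v := pj k * (coef k j u *: e (rep j)))).
  apply: eqrMl; rewrite /coef E1 eqxx -(rep_n j).
  rewrite (_ : Phi _ (qj k * u * pj j) = Phi (wt (rep j)) (e (rep j) * (qj k * u * pj j))).
    exact: eqr_prim.
  apply: eqr_Phi; rewrite !mulrA -mulrA -[X in eqr _ _ X]mulrA; apply: (eqrMr hup').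
  by rewrite -E1; exact/eqr_sym/eqr_eqj.
by rewrite -scalerAr; apply: eqrZ; rewrite -E1; exact: eqr_pje.
Qed.

(** [v * pj j] is replaced by its expansion [eqr_expand]; indices outside the class of [j]
    contribute zero on both sides. *)
Lemma coefM k j al u v : homog iota al v ->
  coef k j (u * v) = \sum_(l <- over (al + wt j)) coef k l u * coef l j v.
Proof.
move=> hv; have [E1|ne] := eqVneq (rep k) (rep j); last first.
  rewrite coef_rep // big1 // => l _.
  have [E2|ne2] := eqVneq (rep k) (rep l); last by rewrite coef_rep ?mul0r.
  by rewrite [coef l j v]coef_rep ?mulr0 // -E2.
rewrite {1}/coef E1 eqxx mulrA -mulrA (eqr_expand j hv (qj k * u)) mulr_sumr (Phi_sum tf) mulr_suml.
apply: eq_bigr => l _; rewrite -scalerAr (PhiZ tf) mulrC mulrCA.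
have [E2|ne2] := eqVneq (rep l) (rep j); last by rewrite [coef l j v]coef_rep // !(mul0r, mulr0).
rewrite mulrC; congr (_ * _); rewrite /coef E1 E2 eqxx mulrC; congr (_ / _%:R).
by rewrite -(rep_n j) -E2 rep_n.
Qed.

Lemma coef_pq k j w : rep k = rep j -> coef k j w = Phi (wt (rep j)) (qj k * w * pj j) / (n j)%:R.
Proof. by rewrite /coef => ->; rewrite eqxx. Qed.

Lemma eqr_qp_neq j k : wt j = wt k -> j != k -> eqr (wt (rep k)) (qj j * pj k) 0.
Proof.
move=> ejk ne; apply: (eqr_trans (v := qj j * (e j * e k) * pj k)).
  apply: (eqr_trans (v := qj j * e j * pj k)).
    apply: (eqrMr (homog_pj k)); rewrite -ejk; exact/eqr_sym/eqr_qje.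
  by rewrite -!mulrA; do !apply: eqrMl; exact/eqr_sym/eqr_epj.
rewrite -(mul0r (pj k)); apply: (eqrMr (homog_pj k)); rewrite -(mulr0 (qj j)) -ejk.
by apply: eqrMl; exact: eqr_orth.
Qed.

Lemma coef_one k j : coef k j 1 = (k == j)%:R.
Proof.
have [wkj|ne] := eqVneq (wt k) (wt j); last first.
  rewrite (coef_off (homog1 iota)) ?add0r //; case: eqVneq => // E1.
  by rewrite E1 eqxx in ne.
have [->|ne] := eqVneq k j.
  by rewrite coef_pq // mulr1 (eqr_Phi (eqr_qp j)) (is_trace sys) rep_n mulfV ?nK_neq0.
rewrite /coef; case: eqP => // E1; rewrite mulr1 (eqr_Phi (eqr_qp_neq wkj ne)).
by rewrite (Phi0 tf) mul0r.
Qed.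

Lemma coef_iota k j y : coef k j (iota y) = (wt j y : K) * (k == j)%:R.
Proof.
rewrite -coef_one; have [E1|ne] := eqVneq (rep k) (rep j); last by rewrite !coef_rep ?mulr0.
rewrite !coef_pq // mulr1 mulrA; congr (_ / _).
(* Moving [iota y] to the right of [pj j] costs [wt j y - wt (rep j) y]; at the right end it
   contributes [wt (rep j) y], for a total of [wt j y]. *)
have -> : qj k * iota y * pj j = (wt j y - wt (rep j) y : K) *: (qj k * pj j) + qj k * pj j * iota y.
  have := homog_pj j y; rewrite /ad_h => /(congr1 (fun x => x + pj j * iota y)); rewrite subrK => E2.
  by rewrite -!mulrA E2 mulrDr -scalerAr !lfunE /= lfunE.
by rewrite (PhiD tf) (PhiZ tf) (tf_iota tf) -mulrDl subrK.
Qed.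

Lemma coef_idem k j l : wt j = wt l -> wt k = wt l ->
  coef k j (e l) = ((k == l) && (l == j))%:R.
Proof.
move=> wj wk; have [E1|ne] := eqVneq (rep k) (rep j); last first.
  rewrite coef_rep //; case: (k =P l) => [kl|//]; case: (l =P j) => [lj|//].
  by rewrite kl lj eqxx in ne.
have [ekl|nkl] := eqVneq k l; last first.
  have A0 : eqr (wt l) (qj k * e l) 0.
    apply: (eqr_trans (v := qj k * e k * e l)).
      apply: (eqrMr (mu := wt k)); last exact/eqr_sym/eqr_qje.
      by rewrite wk; apply/homogr0/(is_homog sys).
    by rewrite -mulrA -(mulr0 (qj k)) -wk; apply: eqrMl; apply: eqr_orth.
  have hpj : homog iota (wt l - wt (rep j)) (pj j) by rewrite -wj; exact: homog_pj.
  by rewrite coef_pq // (eqr_Phi (eqrMr hpj A0)) mul0r (Phi0 tf) mul0r.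
rewrite /= -ekl -coef_one !coef_pq // mulr1; congr (_ / _); apply: eqr_Phi.
by apply: (eqrMr (mu := wt k)); [rewrite wk -wj; exact: homog_pj|exact: eqr_qje].
Qed.

Lemma coef_arrow l k j : rep k = rep j -> wt l = wt k ->
  coef l j (pj k * qj j) = (l == k)%:R.
Proof.
move=> E1 wlk; have [E2|ne] := eqVneq (rep l) (rep j); last first.
  rewrite coef_rep //; case: eqP => // elk.
  by rewrite elk E1 eqxx in ne.
have nE : n j = n k by rewrite -(rep_n j) -(rep_n k) E1.
rewrite coef_pq // nE -coef_one coef_pq ?E2 ?E1 // mulr1; congr (_ / _); apply: eqr_Phi.
apply: (eqr_trans (v := qj l * pj k * e (rep j))).
  by rewrite -!mulrA; do 2!apply: eqrMl; exact: eqr_qp.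
by rewrite -E1 -mulrA; apply: eqrMl; exact: eqr_pje.
Qed.

(** The factor [n j] clears the denominator of [coef]; moving [pj j] around the trace turns the term
    into the trace of [a * e j], and the [e j] add up to 1. *)
Lemma coef_trace lam a : homog iota 0 a ->
  \sum_(j <- over lam) (n j)%:R * coef j j a = Phi lam a.
Proof.
move=> ha; rewrite -(is_sum sys lam) big_seq [RHS]big_seq; apply: eq_bigr => j.
rewrite (is_mem sys) => /eqP wj; rewrite coef_pq // mulrC divfK ?nK_neq0 //.
rewrite (Phi_comm tf _ (homog_pj j)) mulrA wj (Phi_comm0 tf _ _ ha) -wj.
exact: (eqr_pq j a).
Qed.

Lemma sum_over_n lam : (\sum_(j <- over lam) n j)%N = d.
Proof.
apply/eqP; rewrite -(eqr_nat K) -(tf_one tf lam) natr_sum -(is_sum sys lam).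
apply/eqP; rewrite big_seq [RHS]big_seq; apply: eq_bigr => j.
by rewrite (is_mem sys) mul1r => /eqP <-; rewrite (is_trace sys).
Qed.

End MatrixUnits.

(** * The canonical module *)

Section LinearExtension.
Variables (K : fieldType) (I : choiceType) (M : lmodType K).
Implicit Types (f : {malg K[I]}) (w : I -> M) (b c : I).

Lemma mcoeff_basis b c : (<< b >> : {malg K[I]})@_c = (b == c)%:R.
Proof. exact: mcoeffU. Qed.

Lemma malg_sum_coef (r : seq I) (P : pred I) (F : I -> K) c : uniq r ->
  (\sum_(b <- r | P b) F b *: << b >> : {malg K[I]})@_c =
  if (c \in r) && P c then F c else 0.
Proof.
move=> ur; rewrite (raddf_sum (mcoeff c)) /=.
under eq_bigr do rewrite mcoeffZ mcoeff_basis.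
case: ifP => [/andP[cr Pc]|/negbT nc].
  rewrite -big_filter (bigD1_seq c) ?mem_filter ?Pc ?filter_uniq //= eqxx mulr1 big1 ?addr0 //.
  by move=> b /negPf ->; rewrite mulr0.
rewrite big_seq_cond big1 // => b /andP[br Pb]; case: eqP => [E|_]; last by rewrite mulr0.
by rewrite -E br Pb in nc.
Qed.

Lemma malg_expand f : f = \sum_(b <- msupp f) f@_b *: << b >>.
Proof.
apply/malgP => c; rewrite malg_sum_coef ?fset_uniq // andbT.
by case: ifP => // /negbT/mcoeff_outdom.
Qed.

Definition restr (P : pred I) f : {malg K[I]} := \sum_(b <- msupp f | P b) f@_b *: << b >>.

Lemma restrE P f c : (restr P f)@_c = (P c)%:R * f@_c.
Proof.
rewrite malg_sum_coef ?fset_uniq //; case: (boolP (P c)) => Pc; rewrite (andbT, andbF) ?mul0r //.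
by rewrite mul1r; case: ifP => // /negbT/mcoeff_outdom ->.
Qed.

Definition lext w f : M := \sum_(b <- msupp f) f@_b *: w b.

Lemma lextEw (D : {fset I}) w f : (msupp f `<=` D)%fset -> lext w f = \sum_(b <- D) f@_b *: w b.
Proof.
move=> le; rewrite /lext (big_fset_incl _ le) => //= x _ /mcoeff_outdom ->.
by rewrite scale0r.
Qed.

Lemma lext_linear w : linear (lext w).
Proof.
move=> a f f'; pose D := (msupp f `|` msupp f' `|` msupp (a *: f + f'))%fset.
rewrite (@lextEw D w f) ?(@lextEw D w f') ?(@lextEw D w (a *: f + f')).
- rewrite scaler_sumr -big_split; apply: eq_bigr => b _.
  by rewrite mcoeffD mcoeffZ scalerDl scalerA.
- exact: fsubsetUr.
- by rewrite /D -fsetUA fsetUCA fsubsetUl.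
- by rewrite /D -fsetUA fsubsetUl.
Qed.

Lemma lext_basis w b : lext w << b >> = w b.
Proof. by rewrite (lextEw _ (@msuppU_le _ _ _ _)) big_seq_fset1 mcoeffUU scale1r. Qed.

Lemma lextD w f f' : lext w (f + f') = lext w f + lext w f'.
Proof. by have := lext_linear w 1 f f'; rewrite !scale1r. Qed.

Lemma lext0 w : lext w 0 = 0.
Proof. by rewrite /lext msupp0 big_seq_fset0. Qed.

Lemma lextZ w a f : lext w (a *: f) = a *: lext w f.
Proof. by have := lext_linear w a f 0; rewrite lext0 !addr0. Qed.

Lemma lext_sum w T (r : seq T) (P : pred T) (F : T -> {malg K[I]}) :
  lext w (\sum_(t <- r | P t) F t) = \sum_(t <- r | P t) lext w (F t).
Proof. exact: (big_morph _ (lextD w) (lext0 w)). Qed.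

Lemma eq_lext w w' f : (forall b, b \in msupp f -> w b = w' b) -> lext w f = lext w' f.
Proof. by move=> H; rewrite /lext !big_seq; apply: eq_bigr => b /H ->. Qed.

Lemma lext_comb a w w' f : lext (fun b => a *: w b + w' b) f = a *: lext w f + lext w' f.
Proof.
rewrite /lext scaler_sumr -big_split; apply: eq_bigr => b _.
by rewrite scalerDr !scalerA [a * _]mulrC.
Qed.

End LinearExtension.

Section CanonicalModule.
Variables (K : numClosedFieldType) (g : lieAlgType K) (h : {vspace g}) (E : algType K).
Variables (iota : subvs_of h -> E) (Phi : weight h -> E -> K) (d : nat).
Hypothesis tf : trace_family iota Phi d.
Hypothesis E_spanned : forall u, weight_sum (ad_h iota) u.
Hypothesis iotaC : forall y y', iota y * iota y' = iota y' * iota y.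
Variables (J : choiceType) (wt : J -> weight h) (e : J -> E) (n : J -> nat).
Variable over : weight h -> seq J.
Hypothesis sys : idem_system iota Phi wt e n over.
Implicit Types (lam mu al : weight h) (u v w : E) (y : subvs_of h) (i j k l : J).

Local Notation rep := (rep sys).
Local Notation coef := (coef sys).

(* One basis vector for each copy of each idempotent; the trace [n j] is the
   multiplicity of [e j]. *)
Definition Nidx : choiceType := {b : J * nat | (b.2 < n b.1)%N}.
Local Notation Nmod := {malg K[Nidx]}.
Implicit Types (b c : Nidx) (f : Nmod).
Definition bj b : J := (val b).1.
Definition bm b : nat := (val b).2.

Lemma Nidx_eq b c : bj b = bj c -> bm b = bm c -> b = c.
Proof.
move=> Ej Em; apply/val_inj; move: Ej Em; rewrite /bj /bm.
by case: b c => [[? ?] ?] [[? ?] ?] /= -> ->.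
Qed.

Lemma Nidx_eqE b c : (b == c) = (bm c == bm b) && (bj c == bj b).
Proof.
by apply/eqP/andP => [->|[/eqP Em /eqP Ej]]; [rewrite !eqxx|apply/esym/Nidx_eq].
Qed.

(** The default 0 lets sums run over a whole fibre without proving that the copy number is in
    range. *)
Definition bv (p : J * nat) : Nmod := if insub p is Some b then << (b : Nidx) >> else 0.

Lemma bvE p c : (bv p)@_c = ((bj c == p.1) && (bm c == p.2))%:R.
Proof.
rewrite /bv; case: insubP => [b _ bp|np].
  rewrite mcoeff_basis -bp -/(bj b) -/(bm b); congr (nat_of_bool _)%:R.
  by apply/eqP/andP => [->|[/eqP Ej /eqP Em]]; [rewrite !eqxx|apply/esym/Nidx_eq].
rewrite mcoeff0; case: eqP => //= Ej; case: eqP => //= Em.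
by case/negP: np; rewrite -Ej -Em; exact: (valP c).
Qed.

(** Splitting [u] into homogeneous components keeps the sum finite: a component of degree [al]
    reaches only the fibre over [al + wt (bj b)]. The copy number [bm b] never changes. *)
Definition vact u b : Nmod :=
  \sum_(al <- weight_supp E_spanned u) \sum_(k <- over (al + wt (bj b)))
    coef k (bj b) (weight_comp E_spanned al u) *: bv (k, bm b).

Lemma coef_sum k j (T : Type) (r : seq T) (F : T -> E) :
  coef k j (\sum_(t <- r) F t) = \sum_(t <- r) coef k j (F t).
Proof.
have cD u v : coef k j (u + v) = coef k j u + coef k j v.
  by have := coef_linear tf sys k j 1 u v; rewrite !scale1r.
have c0 : coef k j 0 = 0 by have := cD 0 0; rewrite addr0 -[X in X = _]addr0 => /addrI.
exact: (big_morph _ cD c0).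
Qed.

Lemma vactE u b c : (vact u b)@_c = (bm c == bm b)%:R * coef (bj c) (bj b) u.
Proof.
rewrite {2}(sum_weight_comp E_spanned u) coef_sum mulr_sumr raddf_sum /=.
apply: eq_bigr => al _; rewrite raddf_sum /=.
under eq_bigr do rewrite mcoeffZ bvE /=.
have hal : homog iota al (weight_comp E_spanned al u).
  exact: (weight_compP (ad_hZ iota)).
have [wc|nwc] := eqVneq (wt (bj c)) (al + wt (bj b)).
  rewrite (bigD1_seq (bj c)) ?(is_uniq sys) ?(is_mem sys) ?wc //= eqxx big1 ?addr0 => [|k /negPf ne].
    by rewrite mulrC.
  by rewrite eq_sym ne mulr0.
rewrite (coef_off tf sys hal nwc) mulr0 big_seq big1 // => k.
rewrite (is_mem sys) => /eqP wk; case: eqP => [E1|]; last by rewrite mulr0.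
by rewrite E1 wk eqxx in nwc.
Qed.

Lemma vact_homog al u b : homog iota al u ->
  vact u b = \sum_(k <- over (al + wt (bj b))) coef k (bj b) u *: bv (k, bm b).
Proof.
move=> hu; apply/malgP => c; rewrite vactE raddf_sum /=.
under eq_bigr do rewrite mcoeffZ bvE /=.
have [wc|nwc] := eqVneq (wt (bj c)) (al + wt (bj b)).
  rewrite (bigD1_seq (bj c)) ?(is_uniq sys) ?(is_mem sys) ?wc //= eqxx big1 ?addr0 => [|k /negPf ne].
    by rewrite mulrC.
  by rewrite eq_sym ne mulr0.
rewrite (coef_off tf sys hu nwc) mulr0 big_seq big1 // => k.
rewrite (is_mem sys) => /eqP wk; case: eqP => [E1|]; last by rewrite mulr0.
by rewrite E1 wk eqxx in nwc.
Qed.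

Definition nact u f : Nmod := lext (vact u) f.

Lemma nact_lext u f : nact u f = lext (vact u) f.
Proof. by []. Qed.

Lemma nactE u f c : (nact u f)@_c =
  \sum_(b <- msupp f) f@_b * ((bm c == bm b)%:R * coef (bj c) (bj b) u).
Proof. by rewrite /nact /lext raddf_sum /=; apply: eq_bigr => b _; rewrite mcoeffZ vactE. Qed.

Lemma nact_basis u b : nact u << b >> = vact u b.
Proof. exact: lext_basis. Qed.

Lemma vactL a u v b : vact (a *: u + v) b = a *: vact u b + vact v b.
Proof.
apply/malgP => c; rewrite mcoeffD mcoeffZ !vactE.
have /= -> := coef_linear tf sys (bj c) (bj b) a u v.
rewrite mulrDr; congr (_ + _); exact: mulrCA.
Qed.

Lemma nactLl a u v f : nact (a *: u + v) f = a *: nact u f + nact v f.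
Proof. by rewrite /nact -lext_comb; apply: eq_lext => b _; exact: vactL. Qed.

Lemma nact0l f : nact 0 f = 0.
Proof. by have := nactLl (-1) 0 0 f; rewrite scaler0 addr0 scaleN1r addNr. Qed.

Lemma nactDl u v f : nact (u + v) f = nact u f + nact v f.
Proof. by have := nactLl 1 u v f; rewrite !scale1r. Qed.

(** Linked indices have equally many copies, so the copy number of [b] is valid for [j] and [bv] is
    not the default. *)
Lemma nact_bv u j m b : rep j = rep (bj b) -> m = bm b ->
  forall c, (nact u (bv (j, m)))@_c = (bm c == m)%:R * coef (bj c) j u.
Proof.
move=> Ej -> c; rewrite /bv insubT /=.
  by have := valP b; rewrite /= -/(bm b) -/(bj b) -!(rep_n tf sys (bj b)) -(rep_n tf sys j) Ej.
by move=> lt; rewrite nact_basis vactE.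
Qed.

Lemma nact_vactM u v b : nact u (vact v b) = vact (u * v) b.
Proof.
elim/(homog_ind E_spanned): v => [v v' IH IH'||al v hv].
- by rewrite mulrDr -!nact_basis !nactDl !nact_basis -IH -IH' /nact lextD.
- by rewrite mulr0 -!nact_basis !nact0l /nact lext0.
apply/malgP => c; rewrite vactE (coefM tf E_spanned sys _ _ _ hv) (vact_homog b hv).
rewrite /nact lext_sum raddf_sum mulr_sumr /=; apply: eq_bigr => k _.
rewrite lextZ mcoeffZ -/(nact u _).
have [E1|ne] := eqVneq (rep k) (rep (bj b)).
  by rewrite (nact_bv _ E1) // mulrCA [coef _ _ v * _]mulrC.
by rewrite [coef k _ v]coef_rep // mul0r !mulr0.
Qed.

Lemma nact_action : is_action nact.
Proof.
split.
- exact: nactDl.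
- by move=> a u f; have := nactLl a u 0 f; rewrite nact0l !addr0.
- by move=> u f f'; rewrite /nact lextD.
- by move=> u a f; rewrite /nact lextZ.
- move=> f; rewrite {2}(malg_expand f); apply: eq_bigr => b _; congr (_ *: _).
  apply/malgP => c; rewrite vactE (coef_one tf sys) mcoeff_basis -natrM mulnb; congr (nat_of_bool _)%:R.
  by apply/andP/eqP => [[/eqP Em /eqP Ej]|->]; [apply/esym/Nidx_eq|rewrite !eqxx].
- move=> u v f; rewrite /nact [lext (vact v) f]/lext lext_sum [LHS]/lext.
  by apply: eq_bigr => b _; rewrite lextZ -/(nact u _) nact_vactM.
Qed.

Let nactP := nact_action.

Definition wJ b : weight h := wt (bj b).

Lemma nact_iota y f c : (nact (iota y) f)@_c = (wJ c y : K) * f@_c.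
Proof.
rewrite {2}(malg_expand f) nactE raddf_sum mulr_sumr /=; apply: eq_bigr => b _.
rewrite (coef_iota tf sys) mcoeffZ mcoeff_basis Nidx_eqE -mulnb natrM.
rewrite [_%:R * (_ * _)]mulrCA [LHS]mulrCA /wJ.
by case: (bj c =P bj b) => [->|_] //; rewrite !mulr0.
Qed.

Lemma Nmod_hspaceP lam f :
  hspace iota nact lam f <-> forall c, f@_c != 0 -> wJ c = lam.
Proof.
split=> [hf c fc|H y].
  apply/lfunP => y; have := congr1 (mcoeff c) (hf y).
  by rewrite nact_iota mcoeffZ => /(mulIf fc).
apply/malgP => c; rewrite nact_iota mcoeffZ; have [->|/H -> //] := eqVneq f@_c 0.
by rewrite !mulr0.
Qed.

Lemma Nmod_hspace_basis b : hspace iota nact (wJ b) << b >>.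
Proof.
by apply/Nmod_hspaceP => c; rewrite mcoeff_basis; case: (b =P c) => [->|_] //; rewrite eqxx.
Qed.

Lemma Nmod_weight_sum f : weight_sum (fun y => nact (iota y)) f.
Proof.
have D y : {morph nact (iota y) : m m' / m + m'} := actDr nactP (iota y).
have Z y a : {morph nact (iota y) : m / a *: m} := actZr nactP (iota y) a.
rewrite (malg_expand f); apply: (weight_sum_sum D Z) => b.
by apply: (weight_sumZ Z); apply: (weight_sum1 (lam := wJ b)); exact: Nmod_hspace_basis.
Qed.

Definition overJ lam : seq Nidx :=
  pmap insub [seq (j, m) | j <- over lam, m <- seq.iota 0 (n j)].

Lemma mem_overJ lam b : (b \in overJ lam) = (wJ b == lam).
Proof.
rewrite mem_pmap_sub; apply/allpairsPdep/eqP => [[j [m [jo _ E1]]]|wb].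
  by rewrite (is_mem sys) in jo; rewrite /wJ /bj E1 /=; exact/eqP.
exists (bj b), (bm b); split; last by rewrite /bj /bm -surjective_pairing.
  by rewrite (is_mem sys); apply/eqP.
by rewrite mem_iota; exact: (valP b).
Qed.

Lemma uniq_overJ lam : uniq (overJ lam).
Proof.
apply: pmap_sub_uniq; apply: allpairs_uniq_dep; first exact: (is_uniq sys).
  by move=> j _; exact: iota_uniq.
by move=> [j m] [j' m'] _ _ /= [-> ->].
Qed.

Lemma sum_overJ lam (F : J -> K) :
  \sum_(b <- overJ lam) F (bj b) = \sum_(j <- over lam) (n j)%:R * F j.
Proof.
pose s := [seq (j, m) | j <- over lam, m <- seq.iota 0 (n j)].
have sE : [seq val b | b <- overJ lam] = s.
  rewrite pmap_filter; last by move=> p; exact: insubK.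
  apply/all_filterP/allP => p /allpairsPdep[j [m [_ mi ->]]] /=.
  by rewrite insubT //=; move: mi; rewrite mem_iota.
rewrite -(big_map val xpredT (fun p : J * nat => F p.1)) sE big_allpairs_dep /=.
by apply: eq_bigr => j _; rewrite big_const_seq count_predT size_iota iter_addr_0 mulr_natl.
Qed.

Lemma size_overJ lam : size (overJ lam) = d.
Proof.
apply/eqP; rewrite -(eqr_nat K) -(sum_over_n tf sys lam) natr_sum.
have := sum_overJ lam (fun=> 1); rewrite big_const_seq count_predT iter_addr_0 => ->.
by apply/eqP/eq_bigr => j _; rewrite mulr1.
Qed.

Definition overT lam : d.-tuple Nidx := tcast (size_overJ lam) (in_tuple (overJ lam)).

Lemma overT_val lam : tval (overT lam) = overJ lam.
Proof. by rewrite val_tcast. Qed.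

Lemma big_overT (V : nmodType) lam (F : Nidx -> V) :
  \sum_(i < d) F (tnth (overT lam) i) = \sum_(b <- overJ lam) F b.
Proof. by rewrite -(big_tuple _ _ _ xpredT) overT_val. Qed.

Lemma mcoeff_overT lam (c : 'rV[K]_d) (i : 'I_d) :
  (\sum_(i < d) c 0 i *: (<< tnth (overT lam) i >> : Nmod))@_(tnth (overT lam) i) = c 0 i.
Proof.
rewrite raddf_sum /= (bigD1 i) //= big1 => [|k ne].
  by rewrite mcoeffZ mcoeff_basis eqxx mulr1 addr0.
rewrite mcoeffZ mcoeff_basis; case: eqP => [|_]; last by rewrite mulr0.
have /tuple_uniqP inj : uniq (overT lam) by rewrite overT_val uniq_overJ.
by move=> /inj E1; rewrite E1 eqxx in ne.
Qed.

Lemma Nmod_is_basis lam :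
  is_basis (hspace iota nact lam) (fun i : 'I_d => << tnth (overT lam) i >> : Nmod).
Proof.
split=> [i|f hf].
  have /eqP E1 : wJ (tnth (overT lam) i) == lam by rewrite -mem_overJ -overT_val mem_tnth.
  by have := Nmod_hspace_basis (tnth (overT lam) i); rewrite E1.
pose c : 'rV[K]_d := \row_i f@_(tnth (overT lam) i).
have fE : f = \sum_(i < d) c 0 i *: << tnth (overT lam) i >>.
  under eq_bigr do rewrite mxE.
  rewrite (big_overT lam (fun b => f@_b *: << b >> : Nmod)).
  apply/malgP => b; rewrite (malg_sum_coef _ _ _ (uniq_overJ lam)) andbT mem_overJ.
  case: eqP => // wb; apply/eqP; apply/negPn/negP => /(Nmod_hspaceP lam f).1.
  by move/(_ hf).
exists c; split=> // c' E1; apply/rowP => i.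
by rewrite -[RHS](mcoeff_overT lam) -E1 mxE.
Qed.

Lemma Nmod_trace lam u : homog iota 0 u ->
  trace_on (hspace iota nact lam) (nact u) = Phi lam u.
Proof.
move=> hu; pose A : 'M[K]_d := \matrix_(i, j)
  ((bm (tnth (overT lam) j) == bm (tnth (overT lam) i))%:R *
   coef (bj (tnth (overT lam) j)) (bj (tnth (overT lam) i)) u).
have nL : linear (nact u) by exact: lext_linear.
rewrite (trace_onE (A := A) (hspace_linear iota nactP lam) nL (Nmod_is_basis lam)); last first.
  move=> i; rewrite nact_basis.
  have [_ /(_ (vact u (tnth (overT lam) i)))] := Nmod_is_basis lam.
  case=> [|c [cE _]].
    rewrite -nact_basis; apply: act0_hspace nactP _ _ _ _ _ => //.
    exact: ((Nmod_is_basis lam).1 i).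
  rewrite {1}cE; apply: eq_bigr => j _; congr (_ *: _).
  by rewrite mxE -vactE cE mcoeff_overT.
rewrite /mxtrace; under eq_bigr do rewrite mxE eqxx mul1r.
rewrite (big_overT lam (fun b => coef (bj b) (bj b) u)) (sum_overJ lam (fun j => coef j j u)).
exact: (coef_trace tf sys lam hu).
Qed.

(** A projector to weight [wt j] among the finitely many weights of [f], followed by [e j], which by
    [coef_idem] projects its weight space onto the copies of [j]. *)
Lemma Nmod_isolate f j : exists2 u, homog iota 0 u &
  forall c, (nact u f)@_c = (bj c == j)%:R * f@_c.
Proof.
pose s := undup [seq wJ b | b <- msupp f & wJ b != wt j].
have js : wt j \notin s.
  by rewrite mem_undup; apply/mapP => -[b]; rewrite mem_filter => /andP[/eqP ne _] E1; apply: ne.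
have [q hq qP] := weight_projector nactP iotaC js.
exists (e j * q); first exact: homog0M (is_homog sys j) hq.
move=> c; rewrite (actM nactP).
have qf : nact q f = restr (fun b => wJ b == wt j) f.
  rewrite {1}(malg_expand f) (act_sum nactP) /restr [RHS]big_mkcond big_seq [RHS]big_seq.
  apply: eq_bigr => b bf; rewrite (actZr nactP).
  case: eqP => [E1|/eqP ne]; first by rewrite (qP _).1 // -E1; exact: Nmod_hspace_basis.
  rewrite ((qP _).2 (wJ b)) ?scaler0 //; last exact: Nmod_hspace_basis.
  by rewrite mem_undup; apply: map_f; rewrite mem_filter ne.
rewrite qf; set f' := restr _ f.
have f'0 b : f'@_b != 0 -> wJ b = wt j.
  by rewrite restrE; case: (wJ b =P wt j) => // _; rewrite mul0r eqxx.
have [wc|nwc] := eqVneq (wJ c) (wt j); last first.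
  have hf' : hspace iota nact (wt j) f' by apply/Nmod_hspaceP.
  have /Nmod_hspaceP/(_ c) H := act0_hspace nactP (is_homog sys j) hf'.
  have -> : (nact (e j) f')@_c = 0.
    by apply/eqP/negPn/negP => /H E1; rewrite E1 eqxx in nwc.
  by case: eqP => [E1|_]; rewrite ?mul0r // /wJ E1 eqxx in nwc *.
transitivity ((bj c == j)%:R * f'@_c); last by rewrite restrE wc eqxx mul1r.
rewrite {2}(malg_expand f') nactE raddf_sum mulr_sumr /= big_seq [RHS]big_seq.
apply: eq_bigr => b; rewrite -mcoeff_neq0 => /f'0 wb.
rewrite (coef_idem tf sys) // mcoeffZ mcoeff_basis Nidx_eqE [RHS]mulrCA; congr (_ * _).
by case: (bj c =P j) => [->|_] /=; rewrite ?mulr0 ?mul0r // mul1r -mulnb natrM.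
Qed.

End CanonicalModule.

(** * Simple summands of the canonical module *)

Section Semisimple.
Variables (K : numClosedFieldType) (g : lieAlgType K) (h : {vspace g}) (E : algType K).
Variables (iota : subvs_of h -> E) (Phi : weight h -> E -> K) (d : nat).
Hypothesis tf : trace_family iota Phi d.
Hypothesis E_spanned : forall u, weight_sum (ad_h iota) u.
Hypothesis iotaC : forall y y', iota y * iota y' = iota y' * iota y.
Variables (J : choiceType) (wt : J -> weight h) (e : J -> E) (n : J -> nat).
Variable over : weight h -> seq J.
Hypothesis sys : idem_system iota Phi wt e n over.
Local Notation rep := (rep sys).
Local Notation coef := (coef sys).
Local Notation Nidx := (Nidx n).
Local Notation Nmod := {malg K[Nidx]}.
Local Notation nact := (nact E_spanned sys).
Local Notation wJ := (@wJ K g h J wt n).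
Local Notation pj := (pj sys).
Local Notation qj := (qj sys).
Local Notation eqr := (eqr Phi).
Implicit Types (lam mu al : weight h) (u v w : E) (y : subvs_of h) (i j k l : J).
Implicit Types (b c : Nidx) (f : Nmod).

Let nactP : is_action nact := nact_action tf E_spanned sys.

Lemma nact_arrow b c : rep (bj c) = rep (bj b) -> bm c = bm b ->
  nact (pj (bj c) * qj (bj b)) << b >> = << c >>.
Proof.
move=> E1 E2; apply/malgP => x; rewrite nact_basis (vactE tf) mcoeff_basis Nidx_eqE E2.
have hpq : homog iota (wJ c - wJ b) (pj (bj c) * qj (bj b)).
  apply: (homogB (mu := wt (rep (bj c)))); first exact: homog_pj.
  by rewrite E1; exact: homog_qj.
rewrite -mulnb natrM eq_sym; congr (_ * _).
have [wx|nwx] := eqVneq (wJ x) (wJ c).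
  by rewrite (coef_arrow tf E1 wx) eq_sym.
rewrite (coef_off tf sys hpq) ?subrK //.
by case: eqP => // Ex; rewrite /wJ Ex eqxx in nwx.
Qed.

(** One summand for each linkage class and each copy number, named by the basis vector at the
    representative of the class. *)
Definition Pieces : choiceType := {b : Nidx | rep (bj b) == bj b}.

Lemma class_proof b : (bm b < n (rep (bj b)))%N.
Proof. by rewrite (rep_n tf); exact: (valP b). Qed.

Definition class_idx b : Nidx := exist _ (rep (bj b), bm b) (class_proof b).

Lemma class_proof2 b : rep (bj (class_idx b)) == bj (class_idx b).
Proof. by rewrite /bj /= (rep_idem tf sys). Qed.

Definition class b : Pieces := exist _ (class_idx b) (class_proof2 b).

Definition piece (t : Pieces) : set Nmod := [set f | forall c, f@_c != 0 -> class c = t].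

Lemma class_eq b c : class b = class c <-> rep (bj b) = rep (bj c) /\ bm b = bm c.
Proof.
split=> [/(congr1 val)/(congr1 val) [E1 E2]|[E1 E2]]; first by [].
by do 2!apply/val_inj; rewrite /= E1 E2.
Qed.

Lemma class_val (t : Pieces) : class (val t) = t.
Proof.
do 2!apply/val_inj; rewrite /= (eqP (valP t)).
by rewrite /bj /bm -surjective_pairing.
Qed.

Lemma piece_linear t : linear_subspace (piece t).
Proof.
split=> [c|a f f' Hf Hf' c]; first by rewrite mcoeff0 eqxx.
rewrite mcoeffD mcoeffZ; have [->|/Hf //] := eqVneq f@_c 0.
by rewrite mulr0 add0r => /Hf'.
Qed.

Lemma piece_submodule t : submodule_for (range nact) (piece t).
Proof.
split; first exact: piece_linear.
move=> _ [u _ <-] f Hf c; rewrite (nactE tf) => H.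
have [b bf ne] : exists2 b, b \in msupp f & f@_b * ((bm c == bm b)%:R * coef (bj c) (bj b) u) != 0.
  apply: contrapT => Hn; case/negP: H; rewrite big_seq big1 // => b bf.
  by apply: contrapT => /eqP ne; apply: Hn; exists b.
move: ne; rewrite mulf_eq0 negb_or => /andP[/Hf <-].
rewrite mulf_eq0 negb_or pnatr_eq0 eqb0 negbK => /andP[/eqP Em nc].
apply/class_eq; split=> //.
by apply/eqP; apply: contraNT nc => ne; rewrite coef_rep.
Qed.

Lemma piece_basis b : piece (class b) << b >>.
Proof. by move=> c; rewrite mcoeff_basis; case: (b =P c) => [->|_] //; rewrite eqxx. Qed.

Lemma submodule_range (M : lmodType K) (act : E -> M -> M) (W : set M) u m :
  submodule_for (range act) W -> W m -> W (act u m).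
Proof. by move=> [_ H]; apply: H; exists u. Qed.

Lemma subspace_scale (M : lmodType K) (W : set M) a m : linear_subspace W -> W m -> W (a *: m).
Proof. by move=> [W0 WL] Wm; rewrite -[_ *: _]addr0; apply: WL. Qed.

Lemma subspace_add (M : lmodType K) (W : set M) m m' :
  linear_subspace W -> W m -> W m' -> W (m + m').
Proof. by move=> [W0 WL] Wm; rewrite -[m]scale1r; apply: WL. Qed.

Lemma subspace_big (M : lmodType K) (W : set M) T (r : seq T) (P : pred T) (F : T -> M) :
  linear_subspace W -> (forall t, P t -> W (F t)) -> W (\sum_(t <- r | P t) F t).
Proof.
move=> HW HF; elim/big_ind: _ => //; first by case: HW.
by move=> m m'; apply: subspace_add.
Qed.

Lemma malg_neq0 f : f <> 0 -> exists c, f@_c != 0.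
Proof.
move=> f0; apply: contrapT => H; apply: f0; apply/malgP => c; rewrite mcoeff0.
by apply: contrapT => /eqP fc; apply: H; exists c.
Qed.

Lemma nact_single f c : (forall b, f@_b != 0 -> bj b = bj c -> b = c) ->
  exists2 u, homog iota 0 u & nact u f = f@_c *: << c >>.
Proof.
move=> H; have [u hu uE] := Nmod_isolate tf E_spanned iotaC sys f (bj c).
exists u => //; apply/malgP => x; rewrite uE mcoeffZ mcoeff_basis.
have [<-|ne] := eqVneq c x; first by rewrite eqxx mul1r mulr1.
rewrite mulr0; case: eqP => [Ex|_]; last by rewrite mul0r.
have [->|/H/(_ Ex) E1] := eqVneq f@_x 0; first by rewrite mulr0.
by rewrite E1 eqxx in ne.
Qed.

Lemma nonzero_subspace (M : lmodType K) (W : set M) :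
  linear_subspace W -> W <> [set 0] -> exists2 m, W m & m <> 0.
Proof.
move=> [W0 _] ne; apply: contrapT => H; apply: ne; apply/seteqP; split=> m /=.
  by move=> Wm; apply: contrapT => m0; apply: H; exists m.
by move=> ->.
Qed.

(** With the copy number fixed, a vector of a piece has at most one coordinate for each idempotent.
    A nonzero submodule therefore contains a basis vector ([nact_single]), and matrix units carry it
    to the rest of the piece. *)
Lemma piece_simple t : simple_for (range nact) (piece t).
Proof.
split; first exact: piece_submodule.
  move=> E0; have : piece (class (val t)) << val t >> by exact: piece_basis.
  rewrite class_val E0 /= => /(congr1 (mcoeff (val t))).
  by rewrite mcoeff_basis eqxx mcoeff0 => /eqP; rewrite oner_eq0.
move=> W HW WV; case: (pselect (W = [set 0])) => [|W0]; [by left|right].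
have Wlin := HW.1; have [f Wf f0] := nonzero_subspace Wlin W0.
have [c fc] := malg_neq0 f0; have ct := WV f Wf c fc.
have Wc : W << c >>.
  have [|u _ uE] := nact_single (f := f) (c := c).
    move=> b fb Eb; apply: Nidx_eq => //.
    by have /class_eq [] : class b = class c by rewrite ct; apply: WV fb.
  have := submodule_range u HW Wf; rewrite uE => /(subspace_scale (f@_c)^-1 Wlin).
  by rewrite scalerA mulVf // scale1r.
apply/seteqP; split=> // f' Hf'; rewrite (malg_expand f') big_seq.
apply: (@subspace_big _ W); first exact: Wlin.
move=> b.
rewrite -mcoeff_neq0.
move=> /Hf' bt.
apply: (@subspace_scale _ W); first exact: Wlin.
have /class_eq [E1 E2] : class b = class c by rewrite bt ct.
by rewrite -(nact_arrow E1 E2); apply: submodule_range.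
Qed.

Lemma piece_direct_sum : direct_sum piece.
Proof.
split=> [f|s F us HF sum0 t ts].
  exists (undup [seq class b | b <- msupp f]), (fun t => restr (fun b => class b == t) f).
  split; first exact: undup_uniq.
    move=> t _ c; rewrite restrE; case: (class c =P t) => // _; by rewrite mul0r eqxx.
  apply/malgP => c; rewrite raddf_sum /=; under eq_bigr do rewrite restrE.
  have [c0|c0] := eqVneq f@_c 0.
    by rewrite c0 big1 // => t _; rewrite mulr0.
  rewrite (bigD1_seq (class c)) ?undup_uniq //=; last first.
    by rewrite mem_undup; apply: map_f; rewrite -mcoeff_neq0.
  by rewrite eqxx mul1r big1 ?addr0 // => t /negPf; rewrite eq_sym => ->; rewrite mul0r.
apply/malgP => c; rewrite mcoeff0; apply: contrapT => /eqP Fc.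
have ct := HF t ts c Fc.
have := congr1 (mcoeff c) sum0; rewrite mcoeff0 raddf_sum /= (bigD1_seq t) //=.
rewrite big_seq_cond big1 ?addr0 => [/eqP|t' /andP[t's /eqP ne]]; first by rewrite (negPf Fc).
by apply: contrapT => /eqP Fc'; apply: ne; rewrite -ct; apply/esym/HF.
Qed.

End Semisimple.

(** * Simple weight spaces *)

Section TraceKill.
Variables (K : numClosedFieldType) (g : lieAlgType K) (h : {vspace g}) (E : algType K).
Variables (iota : subvs_of h -> E) (Phi : weight h -> E -> K) (d : nat).
Hypothesis tf : trace_family iota Phi d.
Hypothesis E_spanned : forall u, weight_sum (ad_h iota) u.
Hypothesis iotaC : forall y y', iota y * iota y' = iota y' * iota y.
Variables (M : lmodType K) (act : E -> M -> M) (actP : is_action act).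
Local Notation eqr := (eqr Phi).
Implicit Types (lam mu al : weight h) (u v w : E).

(** [iter] writes the powers of [A] for every size [d], zero included. *)
Lemma act_exp lam (b : 'I_d -> M) w (A : 'M[K]_d) i :
  (forall k, act w (b k) = \sum_j A k j *: b j) ->
  forall k, act (w ^+ i) (b k) = \sum_j (iter i (mulmx A) 1%:M) k j *: b j.
Proof.
move=> AE; elim: i => [|i IH] k; first by rewrite expr0 (act1 actP); exact: (id_matrix b).
by rewrite exprSr (actM actP); exact: (basis_matrix_mul (act_linear actP (w ^+ i)) AE IH).
Qed.

(* An element of the radical has zero power sums, hence acts nilpotently. *)
Lemma radical_fixes_zero lam (b : 'I_d -> M) w m :
  is_basis (hspace iota act lam) b ->
  (forall u, homog iota 0 u -> trace_on (hspace iota act lam) (act u) = Phi lam u) ->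
  homog iota 0 w -> eqr lam w 0 -> hspace iota act lam m -> act w m = m -> m = 0.
Proof.
move=> bV trE hw w0 hm wm.
have [A AE] := basis_matrix bV bV (fun m => act0_hspace actP hw (lam := lam) (m := m)).
suff nil : exists i, iter i (mulmx A) 1%:M = 0.
  have [i Ai] := nil; have mE j : act (w ^+ j) m = m.
    by elim: j => [|j IH]; rewrite ?expr0 ?(act1 actP) // exprS (actM actP) IH.
  rewrite -(mE i); have [c [-> _]] := bV.2 m hm.
  rewrite (act_sum actP) big1 // => k _; rewrite (actZr actP) (act_exp lam i AE) Ai big1 ?scaler0 //.
  by move=> j _; rewrite mxE scale0r.
have trA i : \tr (iter i.+1 (mulmx A) 1%:M) = 0.
  have hwi : homog iota 0 (w ^+ i.+1) by apply: homog_exp.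
  rewrite -(trace_onE (hspace_linear iota actP lam) (act_linear actP (w ^+ i.+1)) bV (act_exp lam i.+1 AE)).
  by rewrite trE // exprSr w0 mulr0 (Phi0 tf).
exists d; case: d A trA {AE b bV} => [|k] A trA; first by rewrite thinmx0.
have iterE i : iter i (mulmx A) 1%:M = A ^+ i.
  by elim: i => //= i ->; rewrite mulmxE -exprS.
rewrite iterE; have := newton_Cayley_Hamilton A; rewrite big_ord_recl newton0 scale1r subn0 big1 ?addr0 //.
move=> i _; rewrite (eq_newton (q := fun=> 0)) => [|j]; last by rewrite -iterE trA.
by rewrite newton_zero ?scale0r.
Qed.

End TraceKill.

Section Irreducible.
Variables (K : numClosedFieldType) (g : lieAlgType K) (h : {vspace g}) (E : algType K).
Variables (iota : subvs_of h -> E) (Phi : weight h -> E -> K) (d : nat).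
Hypothesis tf : trace_family iota Phi d.
Hypothesis d_gt0 : (0 < d)%N.
Hypothesis E_spanned : forall u, weight_sum (ad_h iota) u.
Hypothesis iotaC : forall y y', iota y * iota y' = iota y' * iota y.
Variables (J : choiceType) (wt : J -> weight h) (e : J -> E) (n : J -> nat).
Variable over : weight h -> seq J.
Hypothesis sys : idem_system iota Phi wt e n over.
Local Notation rep := (rep sys).
Local Notation Nidx := (Nidx n).
Local Notation Nmod := {malg K[Nidx]}.
Local Notation nact := (nact E_spanned sys).
Local Notation wJ := (@wJ K g h J wt n).
Local Notation eqr := (eqr Phi).
Implicit Types (u v w : E) (y : subvs_of h).

Let nactP : is_action nact := nact_action tf E_spanned sys.

Variables (M : lmodType K) (act : E -> M -> M) (actP : is_action act).
Variables (lam : weight h) (b : 'I_d -> M).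
Local Notation V := (hspace iota act lam).
Hypothesis bV : is_basis V b.
Hypothesis trE : forall u, homog iota 0 u -> trace_on V (act u) = Phi lam u.
Hypothesis V_simple : simple_for [set act u | u in homog iota 0] V.

Lemma simple_generated m m' : V m -> m <> 0 -> V m' -> exists2 u, homog iota 0 u & act u m = m'.
Proof.
move=> Vm m0 Vm'; have [_ _ /(_ [set x | exists2 u, homog iota 0 u & act u m = x])] := V_simple.
case=> [|x [u hu <-]|E0|EV].
- split=> [|_ [v hv <-] _ [u hu <-]]; last first.
    by exists (v * u); [exact: homog0M|rewrite (actM actP)].
  split; first by exists 0; [exact: homog_zero|rewrite (act0l actP)].
  move=> a _ _ [u hu <-] [v hv <-]; exists (a *: u + v); first exact: homogL.
  by rewrite (actD actP) (actZ actP).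
- exact: (act0_hspace actP hu Vm).
- have : [set x | exists2 u, homog iota 0 u & act u m = x] m.
    by exists 1; [exact: homog1|rewrite (act1 actP)].
  by rewrite E0.
- by rewrite -EV in Vm'.
Qed.

(** If [act u m] were nonzero, simplicity would give [v] of degree zero bringing it back to [m]; but
    [v * u] is in the radical too and fixes no nonzero vector. *)
Lemma radical_kills_simple u m : homog iota 0 u -> eqr lam u 0 -> V m -> act u m = 0.
Proof.
move=> hu u0 Vm; apply: contrapT => um0.
have Vum : V (act u m) by exact: (act0_hspace actP hu Vm).
have [v hv vum] := simple_generated Vum um0 Vm.
have m0 : m = 0.
  apply: (radical_fixes_zero tf actP bV trE (w := v * u)) => //.
  - exact: homog0M.
  - by move=> w; rewrite mulrA u0 !mulr0.
  - by rewrite (actM actP).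
by apply: um0; rewrite m0 (act0r actP).
Qed.

Lemma eqr_act u v m : homog iota 0 u -> homog iota 0 v -> eqr lam u v -> V m ->
  act u m = act v m.
Proof.
move=> hu hv uv Vm; apply/subr0_eq; rewrite -(actB actP); apply: radical_kills_simple => //.
  by rewrite addrC -scaleN1r; apply: homogL.
by move=> w; rewrite mulrBr (PhiD tf) -scaleN1r (PhiZ tf) uv mulN1r subrr mulr0 (Phi0 tf).
Qed.

(** The trace [n j] is not zero, so [e j] does not act by zero; it acts as an idempotent because the
    radical acts by zero. *)
Lemma idem_vector j : wt j = lam -> exists m, [/\ V m, m <> 0 & act (e j) m = m].
Proof.
move=> wj; have he := is_homog sys j.
have [i ne] : exists i, act (e j) (b i) <> 0.
  apply: contrapT => H; have E0 : forall i, act (e j) (b i) = \sum_k (0 : 'M[K]_d) i k *: b k.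
    move=> i; rewrite big1 => [|k _]; last by rewrite mxE scale0r.
    by apply: contrapT => ne; apply: H; exists i.
  have := trace_onE (hspace_linear iota actP lam) (act_linear actP (e j)) bV E0.
  by rewrite trE // -wj (is_trace sys) mxtrace0 => /eqP; rewrite (negPf (nK_neq0 sys j)).
have Vb := bV.1 i.
exists (act (e j) (b i)); split=> //; first exact: (act0_hspace actP he Vb).
rewrite -(actM actP); apply: eqr_act => //; first exact: homog0M.
by rewrite -wj; exact: (eqr_idem sys j).
Qed.

(** Some [u] of degree zero carries a nonzero vector fixed by [e i] to one fixed by [e j], so
    [e j * u * e i] is not in the radical. *)
Lemma simple_linked i j : wt i = lam -> wt j = lam -> rep i = rep j.
Proof.
move=> wi wj; have [m [Vm m0 em]] := idem_vector wi; have [m' [Vm' m'0 em']] := idem_vector wj.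
have [u hu um] := simple_generated Vm m0 Vm'.
case: (linkedP tf E_spanned sys i j) => [|H]; first exact: (linked_rep tf).
have hu' : homog iota (wt j - wt i) u by rewrite wi wj subrr.
case: m'0; rewrite -em' -um -em -!(actM actP).
rewrite [act _ m](@eqr_act _ 0) ?(act0l actP) //; last by rewrite -wi; exact: H.
- exact: (homog0M (homog0M (is_homog sys j) hu) (is_homog sys i)).
- exact: homog_zero.
Qed.

(** By primitivity, [e j * u * e j] acts by a scalar on a vector [m] fixed by [e j]. As [m]
    generates the weight space, the image of [e j] is the line of [m], and the trace of this
    projection is 1. *)
Lemma simple_n1 j : wt j = lam -> n j = 1%N.
Proof.
move=> wj; have he := is_homog sys j; have [m [Vm m0 em]] := idem_vector wj.
have Vlin := hspace_linear iota actP lam.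
have line i : exists c, act (e j) (b i) = c *: m.
  have [u hu um] := simple_generated Vm m0 (bV.1 i).
  exists (Phi (wt j) (e j * u) / (n j)%:R); rewrite -um -{1}em -{2}em -(actZ actP) -!(actM actP).
  apply: eqr_act => //; first exact: (homog0M (homog0M he hu) he).
    exact: homogZ.
  by rewrite -wj; exact: (eqr_prim tf sys j hu).
pose x i := projT1 (cid (line i)).
have xE i : act (e j) (b i) = x i *: m by rewrite /x; case: cid.
have [c [mE _]] := bV.2 m Vm.
have trc : trace_on V (act (e j)) = \sum_i x i * c 0 i.
  rewrite (trace_onE (A := \matrix_(i, k) (x i * c 0 k)) Vlin (act_linear actP (e j)) bV).
    by apply: eq_bigr => i _; rewrite mxE.
  move=> i; rewrite xE {1}mE scaler_sumr; apply: eq_bigr => k _.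
  by rewrite mxE scalerA.
have : (\sum_i x i * c 0 i) *: m = m.
  rewrite -[RHS]em {2}mE (act_sum actP) scaler_suml; apply: eq_bigr => i _.
  by rewrite (actZr actP) xE scalerA mulrC.
rewrite -trc trE // -wj (is_trace sys) -{2}[m]scale1r => /eqP.
rewrite -subr_eq0 -scalerBl scaler_eq0 => /orP[|/eqP //].
by rewrite subr_eq0 => /eqP E1; apply/eqP; rewrite -(eqr_nat K) E1.
Qed.

(** A nonzero vector of the weight space yields a basis vector, since there is one copy of each
    idempotent, and matrix units of degree zero reach the others, since all are linked. *)
Lemma Nmod_simple : simple_for [set nact u | u in homog iota 0] (hspace iota nact lam).
Proof.
have Hlin := hspace_linear iota nactP lam.
split.
- split; first exact: Hlin.
  move=> _ [u hu <-] f Hf; exact: (act0_hspace nactP hu Hf).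
- move=> E0; have : overJ n over lam <> [::].
    by move=> E1; have := size_overJ tf sys lam; rewrite E1 /= => d0; move: d_gt0; rewrite -d0.
  case Eo : (overJ n over lam) => [//|c s] _.
  have wc : wJ c = lam by apply/eqP; rewrite -(mem_overJ sys) Eo mem_head.
  have : hspace iota nact lam << c >> by rewrite -wc; exact: (Nmod_hspace_basis tf).
  rewrite E0 /=.
  move=> /(congr1 (mcoeff c)); rewrite mcoeff_basis eqxx mcoeff0 => /eqP.
  by rewrite oner_eq0.
move=> W HW WV; case: (pselect (W = [set 0])) => [|W0]; [by left|right].
have Wact u f : homog iota 0 u -> W f -> W (nact u f).
  by move=> hu; apply: HW.2; exists u.
have Wlin := HW.1; have [f Wf f0] := nonzero_subspace Wlin W0.
have [c fc] := malg_neq0 f0.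
have bm0 b' : wJ b' = lam -> bm b' = 0%N.
  by move=> wb; have := valP b'; rewrite -/(bm b') -/(bj b') (simple_n1 wb); case: (bm b').
have fw b' : f@_b' != 0 -> wJ b' = lam.
  by move: b'; apply/(Nmod_hspaceP tf E_spanned sys); exact: WV.
have wc := fw c fc.
have Wc : W << c >>.
  have [|u hu uE] := nact_single tf E_spanned iotaC sys (f := f) (c := c).
    by move=> b' /fw wb' Eb; apply: Nidx_eq => //; rewrite !bm0.
  have := Wact u f hu Wf; rewrite uE => /(subspace_scale (f@_c)^-1 Wlin).
  by rewrite scalerA mulVf // scale1r.
apply/seteqP; split=> // f' Hf'; rewrite (malg_expand f') big_seq.
apply: (@subspace_big _ _ W); first exact: Wlin.
move=> b'; rewrite -mcoeff_neq0 => nz.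
have wb' : wJ b' = lam by move: b' nz; apply/(Nmod_hspaceP tf E_spanned sys).
apply: (@subspace_scale _ _ W); first exact: Wlin.
have E1 : rep (bj b') = rep (bj c) by apply: simple_linked.
rewrite -(nact_arrow tf E_spanned E1) ?bm0 //; apply: Wact => //.
have -> : 0 = wJ b' - wJ c by rewrite wb' wc subrr.
apply: (homogB (mu := wt (rep (bj b')))); first exact: (homog_pj sys).
by rewrite E1; exact: (homog_qj sys).
Qed.

End Irreducible.

(** * Uniqueness *)

Section IdempotentMatrix.
Variable K : numFieldType.

(** For a full-rank factorization [A = C *m R], idempotence gives [R *m C = 1], an identity matrix
    whose size is the rank; the trace is cyclic. *)
Lemma idem_mx_rank d (A : 'M[K]_d) : A *m A = A -> \tr A = (\rank A)%:R.
Proof.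
move=> AA; move: (col_base_full A) (row_base_free A) (mulmx_base A).
move: (col_base A) (row_base A) => C R /row_fullP[C' C'C] /row_freeP[R' RR'] CR.
have RC : R *m C = 1%:M.
  have : C' *m (C *m R *m (C *m R)) *m R' = C' *m (C *m R) *m R' by rewrite CR AA.
  by rewrite !mulmxA C'C !mul1mx -!mulmxA RR' mulmx1.
by rewrite -{1}CR mxtrace_mulC RC mxtrace1.
Qed.

Lemma idem_mx_row_base d k (A : 'M[K]_d) : A *m A = A -> \tr A = k%:R ->
  exists R : 'M[K]_(k, d), [/\ row_free R, R *m A = R
    & forall v : 'rV_d, exists c, v *m A = c *m R].
Proof.
move=> AA; rewrite idem_mx_rank // => /eqP; rewrite eqr_nat => /eqP <-.
exists (row_base A); split; first exact: row_base_free.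
  have /submxP[D ->] : (row_base A <= A)%MS by rewrite eq_row_base.
  by rewrite -mulmxA AA.
by move=> v; apply/submxP; rewrite eq_row_base submxMl.
Qed.

End IdempotentMatrix.

Section Uniqueness.
Variables (K : numClosedFieldType) (g : lieAlgType K) (h : {vspace g}) (E : algType K).
Variables (iota : subvs_of h -> E) (Phi : weight h -> E -> K) (d : nat).
Hypothesis tf : trace_family iota Phi d.
Hypothesis E_spanned : forall u, weight_sum (ad_h iota) u.
Hypothesis iotaC : forall y y', iota y * iota y' = iota y' * iota y.
Variables (J : choiceType) (wt : J -> weight h) (e : J -> E) (n : J -> nat).
Variable over : weight h -> seq J.
Hypothesis sys : idem_system iota Phi wt e n over.
Local Notation rep := (rep sys).
Local Notation coef := (coef sys).
Local Notation Nidx := (Nidx n).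
Local Notation Nmod := {malg K[Nidx]}.
Local Notation nact := (nact E_spanned sys).
Local Notation pj := (pj sys).
Local Notation qj := (qj sys).
Local Notation eqr := (eqr Phi).
Implicit Types (lam mu al : weight h) (u v w : E) (y : subvs_of h).

Variables (M : lmodType K) (act : E -> M -> M) (actP : is_action act).
Hypothesis M_span : forall m, weight_sum (fun y => act (iota y)) m.
Hypothesis M_dim : forall lam, has_dim (hspace iota act lam) d.
Hypothesis trE : forall lam u, homog iota 0 u ->
  trace_on (hspace iota act lam) (act u) = Phi lam u.
Variables (I : choiceType) (V : I -> set M).
Hypothesis V_simple : forall t, simple_for (range act) (V t).
Hypothesis V_sum : direct_sum V.
Local Notation hsp := (hspace iota act).

(** The summands are submodules, so [iota y - lam y] acts on each component separately, and a zero
    sum has zero components. *)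
Lemma piece_components lam (s : seq I) (F : I -> M) : uniq s ->
  {in s, forall t, V t (F t)} -> hsp lam (\sum_(t <- s) F t) ->
  {in s, forall t, hsp lam (F t)}.
Proof.
move=> us HF Hs t ts y; apply/subr0_eq.
pose G t := act (iota y) (F t) - (lam y : K) *: F t.
apply: (V_sum.2 s G us) => // [t' t's|].
  have [[Vlin Vact] _ _] := V_simple t'.
  have VF := HF t' t's.
  apply: subspace_add => //; first by apply: Vact => //; exists (iota y).
  by rewrite -scaleNr; apply: subspace_scale.
by rewrite /G sumrB -(act_sum actP) Hs scaler_sumr subrr.
Qed.

Lemma simple_returns t m : V t m -> m <> 0 ->
  forall m', V t m' -> exists u, act u m = m'.
Proof.
move=> Vm m0 m' Vm'; have [[Vlin Vact] _ /(_ (range (act^~ m)))] := V_simple t.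
case=> [|x [u _ <-]|E0|EV].
- split=> [|_ [v _ <-] _ [u _ <-]]; last by exists (v * u); rewrite ?(actM actP).
  split; first by exists 0; rewrite ?(act0l actP).
  move=> a _ _ [u _ <-] [v _ <-]; exists (a *: u + v) => //.
  by rewrite (actD actP) (actZ actP).
- by apply: Vact => //; exists u.
- have : range (act^~ m) m by exists 1; rewrite ?(act1 actP).
  by rewrite E0.
- by move: Vm'; rewrite -EV => -[u _ <-]; exists u.
Qed.

(** In a simple summand a nonzero [act u (F t)] is brought back to [F t] by some [a]. For reasons of
    weight the component [a'] of degree [lam - mu] already does so; then [a' * u] has degree zero,
    lies in the radical and fixes [F t], which must vanish. *)
Lemma radical_kills lam mu u m : homog iota (mu - lam) u -> eqr lam u 0 ->
  hsp lam m -> act u m = 0.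
Proof.
move=> hu u0 hm; have [b bV] := M_dim lam.
have [s [F [us HF mE]]] := V_sum.1 m.
have hF : {in s, forall t, hsp lam (F t)} by apply: piece_components => //; rewrite -mE.
rewrite mE (act_sum actP) big_seq big1 // => t ts; apply: contrapT => uF0.
have [[Vlin Vact] _ _] := V_simple t.
have VF := HF t ts; have hFt := hF t ts.
have VuF : V t (act u (F t)) by apply: Vact => //; exists u.
have [a aE] := simple_returns VuF uF0 VF.
have huF : hsp mu (act u (F t)) by rewrite -[mu](subrK lam); exact: (act_hspace actP hu hFt).
pose a' := weight_comp E_spanned (lam - mu) a.
have ha' : homog iota (lam - mu) a' by exact: (weight_compP (ad_hZ iota)).
(* The weights other than [lam] to which components of [a] lead; [q] kills these and fixes weight
   [lam]. *)
pose others := [seq al + mu | al <- weight_supp E_spanned a & al + mu != lam].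
have lam_others : lam \notin others.
  by apply/mapP => -[al]; rewrite mem_filter => /andP[/eqP ne _] E1; apply: ne.
have [q hq qP] := weight_projector actP iotaC lam_others.
have fixF : act (a' * u) (F t) = F t.
  have RE : F t = act q (act a (act u (F t))) by rewrite aE (qP _).1.
  rewrite (actM actP) [RHS]RE [X in act q (act X _)](sum_weight_comp E_spanned a).
  rewrite (act_suml actP) (act_sum actP).
  have hterm al : hsp (al + mu) (act (weight_comp E_spanned al a) (act u (F t))).
    by apply: (act_hspace actP _ huF); exact: (weight_compP (ad_hZ iota)).
  have z al : al \in weight_supp E_spanned a -> al != lam - mu ->
      act q (act (weight_comp E_spanned al a) (act u (F t))) = 0.
    move=> als ne; apply: (qP _).2 (hterm al); apply: map_f.
    by rewrite mem_filter als andbT -(inj_eq (addIr (- mu))) addrK.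
  have o : act q (act a' (act u (F t))) = act a' (act u (F t)).
    by apply: (qP _).1; have := hterm (lam - mu); rewrite subrK.
  have [asupp|nas] := boolP (lam - mu \in weight_supp E_spanned a).
    rewrite (bigD1_seq (lam - mu)) ?uniq_weight_supp //= o big_seq_cond big1 ?addr0 //.
    by move=> al /andP[als ne]; apply: z.
  rewrite big_seq big1 => [|al als]; last by apply: z => //; apply: contraNneq nas => <-.
  by rewrite /a' weight_comp_out // (act0l actP).
have F0 : F t = 0.
  apply: (radical_fixes_zero tf actP bV (@trE lam) (w := a' * u)) => //.
    by rewrite -(subrr lam); apply: (homogB (mu := mu)).
  by move=> w; rewrite mulrA u0 !mulr0.
by apply: uF0; rewrite F0 (act0r actP).
Qed.

Lemma eqr_hact lam mu u v m : homog iota (mu - lam) u -> homog iota (mu - lam) v ->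
  eqr lam u v -> hsp lam m -> act u m = act v m.
Proof.
move=> hu hv uv hm; apply/subr0_eq; rewrite -(actB actP).
apply: (radical_kills (mu := mu) (lam := lam)) => //.
  by have := homogL (-1) hv hu; rewrite scaleN1r [- v + u]addrC.
by move=> w; rewrite mulrBr (PhiD tf) -scaleN1r (PhiZ tf) uv mulN1r subrr mulr0 (Phi0 tf).
Qed.

(** Since the radical acts by zero, the matrix of [e j] on the weight space is idempotent of trace
    [n j], so its image has dimension [n j]. *)
Lemma idem_image (j : J) : exists w : 'I_(n j) -> M,
  [/\ forall i, hsp (wt j) (w i) /\ act (e j) (w i) = w i,
      forall c : 'I_(n j) -> K, \sum_i c i *: w i = 0 -> forall i, c i = 0
    & forall m, hsp (wt j) m -> act (e j) m = m ->
        exists c : 'I_(n j) -> K, m = \sum_i c i *: w i].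
Proof.
have Hlin := hspace_linear iota actP (wt j); have he := is_homog sys j.
have [b bV] := M_dim (wt j).
have [A AE] := basis_matrix bV bV (fun m => act0_hspace actP he (lam := wt j) (m := m)).
have trA : \tr A = (n j)%:R.
  by rewrite -(trace_onE Hlin (act_linear actP (e j)) bV AE) trE // (is_trace sys).
have actE (c : 'rV_d) : act (e j) (\sum_i c 0 i *: b i) = \sum_i (c *m A) 0 i *: b i.
  rewrite (act_sum actP); under eq_bigr do rewrite (actZr actP) AE scaler_sumr.
  rewrite exchange_big /=; apply: eq_bigr => k _; rewrite mxE scaler_suml.
  by apply: eq_bigr => i _; rewrite scalerA.
have AA : A *m A = A.
  have E2 := basis_matrix_mul (act_linear actP (e j)) AE AE.
  apply: (basis_matrix_inj Hlin bV E2) => i; rewrite -AE -(actM actP).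
  apply: (eqr_hact (lam := wt j) (mu := wt j)); rewrite ?subrr //; first exact: homog0M.
    exact: (eqr_idem sys).
  exact: bV.1.
have [R [Rfree RA Rspan]] := idem_mx_row_base AA trA.
exists (fun i => \sum_k R i k *: b k); split.
- move=> i; split; first exact: (subspace_sum _ _ Hlin bV.1).
  have := actE (row i R); rewrite -row_mul RA.
  by under eq_bigr do rewrite mxE.
- move=> c H i; pose cr : 'rV[K]_(n j) := \row_i c i.
  suff cr0 : cr = 0 by move/rowP/(_ i): cr0; rewrite !mxE.
  apply: (row_free_inj Rfree); rewrite mul0mx; apply: (basis_inj Hlin bV).
  rewrite [RHS]big1 => [|k _]; last by rewrite mxE scale0r.
  rewrite -[RHS]H; under [RHS]eq_bigr do rewrite scaler_sumr.
  rewrite exchange_big /=; apply: eq_bigr => k _; rewrite mxE scaler_suml.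
  by apply: eq_bigr => i' _; rewrite mxE scalerA.
- move=> m hm em; have [r [mE _]] := bV.2 m hm.
  have [c cE] := Rspan r; exists (fun i => c 0 i).
  rewrite -em mE actE cE; under [RHS]eq_bigr do rewrite scaler_sumr.
  rewrite exchange_big /=; apply: eq_bigr => k _; rewrite mxE scaler_suml.
  by apply: eq_bigr => i' _; rewrite scalerA.
Qed.

Definition wvec (j : J) (m : nat) : M :=
  if insub m is Some i then projT1 (cid (idem_image j)) i else 0.

Lemma wvec_out (j : J) m : (n j <= m)%N -> wvec j m = 0.
Proof. by move=> le; rewrite /wvec insubF // ltnNge le. Qed.

Lemma wvecP (j : J) : exists w : 'I_(n j) -> M,
  [/\ forall i : 'I_(n j), wvec j i = w i,
      forall i, hsp (wt j) (w i) /\ act (e j) (w i) = w i,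
      forall c : 'I_(n j) -> K, \sum_i c i *: w i = 0 -> forall i, c i = 0
    & forall m, hsp (wt j) m -> act (e j) m = m ->
        exists c : 'I_(n j) -> K, m = \sum_i c i *: w i].
Proof.
exists (projT1 (cid (idem_image j))); split; first by move=> i; rewrite /wvec valK.
all: by case: (cid (idem_image j)) => w /= [].
Qed.

Lemma wvec_hsp (j : J) m : hsp (wt j) (wvec j m).
Proof.
case: (ltnP m (n j)) => [lt|/wvec_out ->]; last exact: (hspace_linear iota actP (wt j)).1.
by have [w [wE H _ _]] := wvecP j; rewrite (wE (Ordinal lt)); case: (H (Ordinal lt)).
Qed.

(** One basis, of the image of the idempotent at the representative, serves the whole class: it is
    transported along the arrows [pj], which makes it compatible with the matrix units. *)
Definition wbas (p : J * nat) : M := act (pj p.1) (wvec (rep p.1) p.2).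

Definition Niso : Nmod -> M := lext (fun b : Nidx => wbas (val b)).

Lemma Niso_bv (p : J * nat) : Niso (bv K n p) = wbas p.
Proof.
rewrite /bv; case: insubP => [b _ <-|np]; first exact: lext_basis.
by rewrite /Niso lext0 /wbas wvec_out ?(act0r actP) // (rep_n tf) leqNgt.
Qed.

Lemma NisoD f f' : Niso (f + f') = Niso f + Niso f'.
Proof. exact: lextD. Qed.

Lemma Niso_act u f : Niso (nact u f) = act u (Niso f).
Proof.
transitivity (\sum_(b <- msupp f) f@_b *: Niso (vact E_spanned sys u b)).
  rewrite /Niso nact_lext [lext (vact _ _ _) f]/lext lext_sum.
  by apply: eq_bigr => b _; rewrite lextZ.
rewrite [Niso f]/Niso [lext _ f]/lext (act_sum actP); apply: eq_bigr => b _.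
rewrite (actZr actP); congr (_ *: _).
elim/(homog_ind E_spanned): u => [u v IH IH'||al u hu].
- have := vactL tf E_spanned sys 1 u v b; rewrite !scale1r => ->.
  by rewrite NisoD (actD actP); congr (_ + _); [exact: IH|exact: IH'].
- have := vactL tf E_spanned sys (-1) 0 0 b; rewrite scaler0 addr0 scaleN1r addNr => ->.
  rewrite /Niso.
  rewrite lext0.
  rewrite (act0l actP).
  reflexivity.
rewrite (vact_homog tf E_spanned sys b hu) /Niso lext_sum.
have wb := wvec_hsp (rep (bj b)) (bm b).
rewrite /wbas -/(bj b) -/(bm b) -(actM actP).
have hup : homog iota (al + wt (bj b) - wt (rep (bj b))) (u * pj (bj b)).
  by rewrite -addrA; apply: homogM => //; exact: (homog_pj sys).
(* The radical acts by zero, so the expansion of [u * pj (bj b)] modulo the radical becomes an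
   equality on vectors of this weight. *)
rewrite [RHS](@eqr_hact (wt (rep (bj b))) (al + wt (bj b)) _
   (\sum_(k <- over (al + wt (bj b))) coef k (bj b) u *: pj k)) //; first last.
- exact: (eqr_expand tf E_spanned sys).
- rewrite big_seq; apply: (weight_vector_sum (ad_hD iota) (ad_hZ iota)) => k.
  rewrite (is_mem sys) => /eqP wk.
  have [E1|ne] := eqVneq (rep k) (rep (bj b)).
    by apply: homogZ; rewrite -wk -E1; exact: (homog_pj sys).
  by rewrite (coef_rep _ ne) scale0r; exact: homog_zero.
rewrite (act_suml actP); apply: eq_bigr => k _.
rewrite lextZ (actZ actP) -/(Niso _) Niso_bv /wbas /=.
have [E1|ne] := eqVneq (rep k) (rep (bj b)); first by rewrite E1.
by rewrite (coef_rep _ ne) !scale0r.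
Qed.

(** Isolate in [f] the coordinates at one index [j] and apply [qj j]. It undoes [pj j] and leaves a
    linear relation among the independent vectors [w i]. *)
Lemma Niso_inj f : Niso f = 0 -> f = 0.
Proof.
move=> F0; apply: contrapT => /malg_neq0[c fc].
have [u hu uE] := Nmod_isolate tf E_spanned iotaC sys f (bj c).
have := Niso_act u f; rewrite F0 (act0r actP); set f' := nact u f in uE *.
pose j := bj c; pose r := rep j.
have [w [wE Hw wfree _]] := wvecP r.
have nr : n r = n j := rep_n tf sys j.
have lt (i : 'I_(n r)) : (i < n j)%N by rewrite -nr.
pose bi (i : 'I_(n r)) : Nidx := exist _ (j, nat_of_ord i) (lt i).
have f'E : f' = \sum_i f@_(bi i) *: << bi i >>.
  apply/malgP => x; rewrite uE raddf_sum /=.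
  under eq_bigr do rewrite mcoeffZ mcoeff_basis.
  case: (bj x =P bj c) => [Ex|ne]; last first.
    rewrite mul0r big1 // => i _; case: eqP => [E1|_]; last by rewrite mulr0.
    by case: ne; rewrite -E1.
  have ltx : (bm x < n r)%N by rewrite nr /j -Ex; exact: (valP x).
  have xE : bi (Ordinal ltx) = x by apply: Nidx_eq; rewrite // /bj /= /j Ex.
  rewrite mul1r (bigD1 (Ordinal ltx)) //= xE eqxx mulr1 big1 ?addr0 // => i ne.
  case: eqP => [E1|_]; last by rewrite mulr0.
  by case/eqP: ne; apply/val_inj; rewrite /= -E1.
rewrite f'E /Niso lext_sum => E0.
have qE0 : act (qj j) (\sum_i f@_(bi i) *: act (pj j) (w i)) = 0.
  rewrite -[RHS](act0r actP (qj j)) -[in RHS]E0; congr act.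
  by apply: eq_bigr => i _; rewrite lextZ lext_basis /wbas /= wE.
have sum0 : \sum_i f@_(bi i) *: w i = 0.
  rewrite -[RHS]qE0 (act_sum actP); apply: eq_bigr => i _.
  rewrite (actZr actP) -(actM actP); congr (_ *: _); have [hw ew] := Hw i.
  rewrite -{1}ew; apply/esym; apply: (eqr_hact (lam := wt r) (mu := wt r)) => //.
  - by apply: (homogB (mu := wt j)); [exact: (homog_qj sys)|exact: (homog_pj sys)].
  - by rewrite subrr; exact: (is_homog sys).
  - exact: (eqr_qp sys).
have ltc : (bm c < n r)%N by rewrite nr; exact: (valP c).
have := wfree (fun i => f@_(bi i)) sum0 (Ordinal ltc).
rewrite (_ : bi _ = c); last by apply: Nidx_eq.
by move/eqP; rewrite (negPf fc).
Qed.

(** On a weight vector the idempotents of its weight add up to the identity, and [e j] acts as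
    [pj j] after [qj j], whose value lies in the image of the idempotent at the representative. *)
Lemma Niso_surj m : exists f, Niso f = m.
Proof.
have [s [F [_ HF ->]]] := M_span m.
rewrite big_seq; elim/big_ind: _ => [|m1 m2 [f1 <-] [f2 <-]|lam lams].
- by exists 0; rewrite /Niso lext0.
- by exists (f1 + f2); rewrite /Niso lextD.
have hF : hsp lam (F lam) := HF lam lams.
have -> : F lam = \sum_(j <- over lam) act (e j) (F lam).
  rewrite -(act_suml actP) -[LHS](act1 actP); apply: (eqr_hact (lam := lam) (mu := lam)) => //.
  - by rewrite subrr; exact: homog1.
  - by rewrite subrr; apply: homog_sum => j; exact: (is_homog sys).
  - exact/eqr_sym/(eqr_one tf sys).
rewrite big_seq; elim/big_ind: _ => [|m1 m2 [f1 <-] [f2 <-]|j].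
- by exists 0; rewrite /Niso lext0.
- by exists (f1 + f2); rewrite /Niso lextD.
rewrite (is_mem sys) => /eqP wj; have hF' : hsp (wt j) (F lam) by rewrite wj.
have homj : homog iota (wt j - wt j) (e j) by rewrite subrr; exact: (is_homog sys).
have hqF : hsp (wt (rep j)) (act (qj j) (F lam)).
  by have := act_hspace actP (homog_qj sys j) hF'; rewrite subrK.
have eqF : act (e (rep j)) (act (qj j) (F lam)) = act (qj j) (F lam).
  rewrite -(actM actP); apply: (eqr_hact (lam := wt j) (mu := wt (rep j))) => //.
  - apply: (homogB (mu := wt (rep j))); last exact: (homog_qj sys).
    by rewrite subrr; exact: (is_homog sys).
  - exact: (homog_qj sys).
  - exact: (eqr_eqj sys).
have [w [wE _ _ /(_ _ hqF eqF)[c cE]]] := wvecP (rep j).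
exists (\sum_i c i *: bv K n (j, nat_of_ord i)).
rewrite /Niso lext_sum; under eq_bigr => i _ do rewrite lextZ -/(Niso _) Niso_bv /wbas /= wE -(actZr actP).
rewrite -(act_sum actP) -cE -(actM actP); apply: (eqr_hact (lam := wt j) (mu := wt j)) => //.
- by apply: (homogB (mu := wt (rep j))); [exact: (homog_pj sys)|exact: (homog_qj sys)].
- exact: (eqr_pq sys).
Qed.

End Uniqueness.

(** * The enveloping algebra *)

Section EnvelopeInduction.
Local Open Scope quotient_scope.
Variables (K : fieldType) (g : lieAlgType K).

(** The free algebra is spanned by words, and a nonempty word is a generator times a shorter
    word. *)
Lemma Uenv_ind (P : Uenv g -> Prop) :
  (forall a u v, P u -> P v -> P (a *: u + v)) -> P 1 ->
  (forall x u, P u -> P (Uin x * u)) -> forall u, P u.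
Proof.
move=> PL P1 PM; have P0 : P 0 by rewrite -(addNr 1) -scaleN1r; apply: PL.
elim/quotW => p; rewrite (monalgE p).
have pi_sum I (r : seq I) F :
    \pi_(Uenv g) (\sum_(i <- r) F i) = \sum_(i <- r) \pi_(Uenv g) (F i).
  elim: r => [|i r IH]; first by rewrite !big_nil !piE.
  by rewrite !big_cons UpiD IH.
rewrite pi_sum; elim/big_ind: _ => // [u v Pu Pv|w _].
  by rewrite -[u]scale1r; apply: PL.
have -> : << p@_w *g w >> = p@_w *: << w >> :> {malg K[{fmonom g}]}.
  by apply/malgP => k; rewrite mcoeffZ !mcoeffU mulr_natr.
rewrite -UpiZ -[Uscale _ _]addr0; apply: PL => //.
case: w => s; elim: s => [|x s IH].
  by rewrite (_ : \pi _ = 1 :> Uenv g) //; congr (\pi _); rewrite -fmoneE.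
rewrite (_ : \pi _ = Uin x * \pi_(Uenv g) << FMonom s >>); first exact: PM.
rewrite [RHS](UpiM (fgen x)); congr (\pi _).
by rewrite /fgen malgM_def fgmulUU mulr1 /mmul /= fmmulE fmuE.
Qed.

Lemma uact_action (M : lieModType g) : is_action (@uact K g M).
Proof.
split.
- exact: uactD.
- exact: uactZ.
- exact: uactDr.
- exact: uactZr.
- exact: uact1.
- exact: uactM.
Qed.

End EnvelopeInduction.

Section ActionModule.
Variables (K : fieldType) (g : lieAlgType K) (M : lmodType K).
Variable act : Uenv g -> M -> M.

(** A copy of [M] indexed by the proof of the action axioms, so that the Lie module structure can be
    registered on it. *)
Definition action_module of is_action act : Type := M.

Variable actP : is_action act.
Local Notation N := (action_module actP).
HB.instance Definition _ := GRing.Lmodule.on N.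

Definition action_lact (x : g) (m : N) : N := act (Uin x) m.

Lemma action_lactDl x y m : action_lact (x + y) m = action_lact x m + action_lact y m.
Proof. by rewrite /action_lact UinD; exact: (actD actP). Qed.
Lemma action_lactZl a x m : action_lact (a *: x) m = a *: action_lact x m.
Proof. by rewrite /action_lact UinZ; exact: (actZ actP). Qed.
Lemma action_lactDr x m m' : action_lact x (m + m') = action_lact x m + action_lact x m'.
Proof. exact: (actDr actP). Qed.
Lemma action_lactZr a x m : action_lact x (a *: m) = a *: action_lact x m.
Proof. exact: (actZr actP). Qed.
Lemma action_lact_lie x y m : action_lact (lie x y) m =
  action_lact x (action_lact y m) - action_lact y (action_lact x m).
Proof.
rewrite /action_lact Uin_lie; apply: etrans (actB actP _ _ _) _.
by congr (_ - _); exact: (actM actP).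
Qed.

HB.instance Definition _ := isLieModule.Build K g N
  action_lactDl action_lactZl action_lactDr action_lactZr action_lact_lie.

Lemma action_uact u (m : N) : uact u m = act u m.
Proof.
elim/Uenv_ind: u m => [a u v IH IH'||x u IH] m.
- have e1 : uact (a *: u + v) m = a *: uact u m + uact v m by rewrite uactD uactZ.
  have e2 : act (a *: u + v) m = a *: act u m + act v m.
    exact: etrans (actD actP _ _ _) (congr1 (fun z => z + _) (actZ actP _ _ _)).
  apply: etrans e1 (etrans _ (esym e2)).
  by congr (_ *: _ + _); [exact: IH|exact: IH'].
- exact: etrans (uact1 m) (esym (act1 actP m)).
- have e1 : uact (Uin x * u) m = lact x (uact u m) by rewrite uactM uact_in.
  exact: etrans e1 (etrans (congr1 (lact x) (IH m)) (esym (actM actP _ _ _))).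
Qed.

End ActionModule.

Section Submodules.
Variables (K : fieldType) (g : lieAlgType K) (M : lieModType g).

Lemma submodule_uact (W : set M) :
  submodule_for (range (fun x : g => lact x)) W <-> submodule_for (range (@uact K g M)) W.
Proof.
split=> -[Wlin Wact]; split=> // _ [u _ <-].
  have [W0 WL] := Wlin; elim/Uenv_ind: u => [a u v Hu Hv||x u Hu] m Wm.
  - by rewrite uactD uactZ; apply: WL; [apply: Hu|apply: Hv].
  - by rewrite uact1.
  - by rewrite uactM uact_in; apply: (Wact (lact x)); [exists x|apply: Hu].
by move=> m Wm; rewrite -uact_in; apply: (Wact (uact (Uin u))) => //; exists (Uin u).
Qed.

Lemma simple_uact (V : set M) :
  simple_for (range (fun x : g => lact x)) V <-> simple_for (range (@uact K g M)) V.
Proof.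
by split=> -[/submodule_uact HV V0 Vs]; split=> // W /submodule_uact; apply: Vs.
Qed.

End Submodules.

Section WeightsOfU.
Variables (K : fieldType) (g : lieAlgType K) (h : {vspace g}).

Definition iotaU (y : subvs_of h) : Uenv g := Uin (vsval y).

Lemma weight_spaceE (M : lieModType g) lam :
  weight_space lam = hspace iotaU (@uact K g M) lam.
Proof.
apply/seteqP; split=> m Hm y; first by rewrite uact_in; exact: Hm.
by rewrite -uact_in; exact: Hm.
Qed.

(** The centralizer of [u] is a subalgebra, so commuting with the generators from [h] is enough. *)
Lemma U0P u : U0 h u <-> homog iotaU 0 u.
Proof.
split=> [u0 y|wu v].
  rewrite lfunE scale0r /ad_h u0 ?subrr //.
  by apply: sub_gen_smallest; exists (vsval y) => //; exact: subvsP.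
move=> /(_ [set w | u * w = w * u]); apply; split.
  split=> [|a w w' Ew Ew'|w w' Ew Ew']; red.
  - exact: etrans (mulr1 u) (esym (mul1r u)).
  - have e1 : u * (a *: w) = a *: w * u.
      exact: etrans (esym (scalerAr a u w)) (etrans (congr1 _ Ew) (scalerAl a w u)).
    exact: commrD e1 Ew'.
  - exact: (@commrM _ u w w' Ew Ew').
move=> _ [x xh <-]; have := wu (Subvs xh); rewrite lfunE scale0r.
by move/subr0_eq => /esym.
Qed.

End WeightsOfU.

(** * Existence, simplicity and uniqueness over an abstract graded algebra *)

Section AbstractCompletion.
Variables (K : numClosedFieldType) (g : lieAlgType K) (h : {vspace g}) (E : algType K).
Variable iota : subvs_of h -> E.
Hypothesis E_spanned : forall u, weight_sum (ad_h iota) u.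
Hypothesis iotaC : forall y y', iota y * iota y' = iota y' * iota y.
Hypothesis h_neq0 : (0 < \dim h)%N.
Implicit Types (lam : weight h) (u : E).

Definition semisimple_action (M : lmodType K) (act : E -> M -> M) : Prop :=
  exists (I : choiceType) (V : I -> set M),
    (forall t, simple_for (range act) (V t)) /\ direct_sum V.

Record realizes (Phi : weight h -> E -> K) d (M : lmodType K) (act : E -> M -> M) : Prop :=
  Realizes {
    rl_action : is_action act;
    rl_span : forall m, weight_sum (fun y => act (iota y)) m;
    rl_dim : forall lam, has_dim (hspace iota act lam) d;
    rl_trace : forall lam u, homog iota 0 u ->
      trace_on (hspace iota act lam) (act u) = Phi lam u;
    rl_semisimple : semisimple_action act
  }.

Definition simple_at (M : lmodType K) (act : E -> M -> M) lam : Prop :=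
  simple_for [set act u | u in homog iota 0] (hspace iota act lam).

Lemma trace_family_realized (Phi : weight h -> E -> K) d :
  trace_family iota Phi d -> (0 < d)%N ->
  exists (N : lmodType K) (nact : E -> N -> N), [/\ realizes Phi d nact,
    forall (M : lmodType K) (act : E -> M -> M) lam, is_action act ->
      has_dim (hspace iota act lam) d ->
      (forall u, homog iota 0 u -> trace_on (hspace iota act lam) (act u) = Phi lam u) ->
      simple_at act lam -> simple_at nact lam
    & forall (M : lmodType K) (act : E -> M -> M), realizes Phi d act ->
      exists f : {linear N -> M}, bijective f /\ forall u m, f (nact u m) = act u (f m)].
Proof.
move=> tf d_gt0; have [J [wt [e [n [over sys]]]]] := exists_idem_system tf d_gt0 E_spanned.
exists {malg K[Nidx n]}, (nact E_spanned sys); split.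
- split.
  + exact: (nact_action tf E_spanned sys).
  + exact: (Nmod_weight_sum tf E_spanned sys).
  + by move=> lam; exists (fun i => << tnth (overT tf sys lam) i >>); exact: Nmod_is_basis.
  + exact: (Nmod_trace tf E_spanned sys).
  + exists (Pieces sys), (@piece _ _ _ _ _ _ _ tf _ _ _ _ _ sys); split.
      exact: (piece_simple tf E_spanned iotaC).
    exact: (piece_direct_sum tf sys).
- move=> M act lam actP [b bV] trE Ms.
  exact: (Nmod_simple tf d_gt0 E_spanned iotaC sys actP bV trE Ms).
- move=> M act [actP sp dm tr [I [V [Vs Vd]]]].
  pose F := Niso tf E_spanned iotaC sys actP dm tr Vs Vd.
  have F_lin : linear F by exact: lext_linear.
  pose FL := GRing.isLinear.Build K {malg K[Nidx n]} M *:%R F F_lin.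
  pose F' : {linear {malg K[Nidx n]} -> M} := HB.pack F FL.
  exists F'; split; last exact: (Niso_act tf E_spanned iotaC sys actP dm tr Vs Vd).
  have surj m : exists f, F f = m by exact: (Niso_surj tf E_spanned iotaC sys actP sp dm tr Vs Vd).
  have FG m : F (projT1 (cid (surj m))) = m by case: cid.
  have FB a b : F (a - b) = F a - F b := raddfB F' a b.
  exists (fun m => projT1 (cid (surj m))) => [f|m]; last exact: FG.
  have E0 : F (projT1 (cid (surj (F f))) - f) = 0 by rewrite FB FG subrr.
  exact: subr0_eq (Niso_inj E0).
Qed.

Section Completion.
Variables (M : lmodType K) (act : E -> M -> M) (actP : is_action act).
Variables (U : set (weight h)) (n : nat).
Hypothesis U_cofinite : cofinite U.
Hypothesis M_dim : forall lam, U lam -> has_dim (hspace iota act lam) n.+1.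
Hypothesis M_poly : forall u, homog iota 0 u -> exists2 P, polynomial_fun P &
  forall lam, U lam -> trace_on (hspace iota act lam) (act u) = P lam.

Lemma exists_trace_family : exists Phi : weight h -> E -> K,
  [/\ trace_family iota Phi n.+1,
      forall u, homog iota 0 u -> polynomial_fun (Phi^~ u)
    & forall lam u, U lam -> homog iota 0 u ->
        trace_on (hspace iota act lam) (act u) = Phi lam u].
Proof.
exists (family_of E_spanned M_poly); split.
- exact: (family_of_trace_family E_spanned iotaC h_neq0 actP U_cofinite M_dim M_poly).
- move=> u hu; rewrite (_ : _^~ u = mtrace M_poly u); first exact: mtrace_poly.
  by apply/funext => lam; exact: family_ofE.
- by move=> lam u Ulam hu; rewrite family_ofE //; exact: mtraceE.
Qed.

End Completion.
End AbstractCompletion.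

(** * Consequences of the hypotheses on [g] and [h] *)

Section LieBilinear.
Variables (K : fieldType) (g : lieAlgType K).
Hypothesis g_AC : type_A_or_C g.

(** The axioms of [lie] state linearity in the first argument only; in the second it is read off the
    injective matrix realization. *)
Lemma type_AC_lieDr (x y z : g) : lie x (y + z) = lie x y + lie x z.
Proof.
suff main n (S : set 'M[K]_n) : iso_matrix_lie g S -> lie x (y + z) = lie x y + lie x z.
  by case: g_AC => l _ [|]; exact: main.
case=> f [f_inj _ fE]; apply: f_inj; rewrite linearD !fE linearD.
by rewrite mulmxDr mulmxDl opprD addrACA.
Qed.

Lemma type_AC_lieZr a (x y : g) : lie x (a *: y) = a *: lie x y.
Proof.
suff main n (S : set 'M[K]_n) : iso_matrix_lie g S -> lie x (a *: y) = a *: lie x y.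
  by case: g_AC => l _ [|]; exact: main.
case=> f [f_inj _ fE]; apply: f_inj; rewrite linearZ /= !fE linearZ /=.
by rewrite -scalemxAr -scalemxAl scalerBr.
Qed.

End LieBilinear.

Section CartanNonzero.
Variables (K : numClosedFieldType) (g : lieAlgType K) (h : {vspace g}).
Hypothesis g_simple : simple_lie g.
Hypothesis lieDr : forall x y z : g, lie x (y + z) = lie x y + lie x z.
Hypothesis lieZr : forall a (x y : g), lie x (a *: y) = a *: lie x y.
Hypothesis h_cartan : cartan_subalgebra h.

Lemma simple_lie_neq0 : exists x : g, x != 0.
Proof.
apply: contrapT => H; case: g_simple => /eqP + _; apply.
apply/eqP; rewrite -subv0; apply/span_subvP => x _; rewrite memv0.
by apply: contrapT => x0; apply: H; exists x; apply/negP.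
Qed.

(** Every element normalizes the zero subspace, so a self-normalizing [h = 0] would force
    [g = 0]. *)
Lemma cartan_neq0 : (0 < \dim h)%N.
Proof.
rewrite lt0n dimv_eq0; apply/eqP => h0; have [x] := simple_lie_neq0.
case: h_cartan => _ _ /(_ x); rewrite h0 memv0 => -> // y.
by rewrite !memv0 => /eqP ->; have := lieZr 0 x 0; rewrite !scale0r => ->.
Qed.

Variable M : lieModType g.
Variables (U : set (weight h)) (d : nat).
Hypothesis U_cofinite : cofinite U.
Hypothesis M_dim : forall lam, U lam -> has_dim (weight_space (M := M) lam) d.+1.

Lemma weight_space_nonzero lam : U lam -> exists2 m : M, weight_space lam m & m <> 0.
Proof.
move=> /M_dim[b bV]; exists (b ord0); first exact: bV.1.
move=> b0; have Vlin := hspace_linear (@iotaU K g h) (uact_action M) lam.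
rewrite -weight_spaceE in Vlin.
have /(basis_inj Vlin bV)/rowP/(_ ord0) :
    \sum_i (delta_mx 0 ord0 : 'rV[K]_d.+1) 0 i *: b i = \sum_i (0 : 'rV[K]_d.+1) 0 i *: b i.
  rewrite [RHS]big1 => [|i _]; last by rewrite mxE scale0r.
  rewrite (bigD1 ord0) //= b0 scaler0 add0r big1 // => i ne.
  by rewrite mxE (negPf ne) andbF scale0r.
by rewrite !mxE !eqxx => /eqP; rewrite oner_eq0.
Qed.

Lemma exists_notin (r : seq K) : exists s, s \notin r.
Proof.
apply: contrapT => H; have /eqP : (1 : {poly K}) = 0.
  by apply: (@poly_eq0_cofinite _ 1 r) => s sr; case: H; exists s.
by rewrite oner_eq0.
Qed.

(** The annihilator of [M] is an ideal, hence zero or everything. If everything, a nonzero weight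
    vector could only have weight 0, whereas [U] contains nonzero multiples of a nonzero weight. *)
Lemma module_faithful (x : g) : (forall m : M, lact x m = 0) -> x = 0.
Proof.
pose P : set g := [set x | forall m : M, lact x m = 0].
have P_lin : linear_subspace P.
  split=> [m|a u v Pu Pv m]; first by have := lactZl 0 (0 : g) m; rewrite !scale0r.
  by rewrite lactDl lactZl Pu Pv scaler0 addr0.
have [W WP] := linear_subspace_vspace P_lin.
case: g_simple => _ /(_ W) [|W0|Wfull].
- apply/span_subvP => _ /allpairsP[[u v] /= [_ /vbasis_mem/WP vP ->]]; apply/WP => m.
  rewrite lact_lie !vP subr0.
  by have := lactZr 0 u (0 : M); rewrite !scale0r.
- by move=> /WP; rewrite W0 memv0 => /eqP.
exfalso; have [nu nu0] := exists_weight_neq0 cartan_neq0.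
have [y] := weight_neq nu0; rewrite lfunE /= subr0 => nuy.
have [r rU] := cofinite_line 0 U_cofinite nu0.
(* Adding 0 to the excluded parameters makes [s *: nu] nonzero at [y]. *)
have [s] := exists_notin (0 :: r); rewrite inE negb_or => /andP[s0 /rU].
rewrite add0r => /weight_space_nonzero[m wm m0]; apply: m0.
have Py : P (vsval y) by apply/WP; rewrite Wfull memvf.
have := wm y; rewrite Py lfunE /= => /esym/eqP.
by rewrite scaler_eq0 mulf_eq0 (negPf s0) (negPf nuy) => /eqP.
Qed.

End CartanNonzero.

(** * The grading of U(g) by weights *)

Section EnvelopeGrading.
Variables (K : closedFieldType) (g : lieAlgType K) (h : {vspace g}).
Hypothesis g_spanned : forall x, weight_sum (h := h) (@ad_g K g h) x.

Lemma Uin0 : Uin (0 : g) = 0.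
Proof. by have := UinZ 0 (0 : g); rewrite !scale0r. Qed.

Lemma homog_Uin al x : weight_vector (@ad_g K g h) al x -> homog (@iotaU K g h) al (Uin x).
Proof.
move=> wx y; apply: etrans (esym (Uin_lie _ _)) _.
by rewrite -UinZ -wx.
Qed.

Lemma Uenv_spanned u : weight_sum (ad_h (@iotaU K g h)) u.
Proof.
have D := ad_hD (@iotaU K g h); have Z := ad_hZ (@iotaU K g h).
elim/Uenv_ind: u => [a u v su sv||x u su].
- exact: (weight_sumD D Z (weight_sumZ Z a su) sv).
- exact: (weight_sum1 (homog1 (@iotaU K g h))).
have [s [f [us wf ->]]] := g_spanned x.
have [t [k [ut wk ->]]] := su.
have -> : Uin (\sum_(lam <- s) f lam) = \sum_(lam <- s) Uin (f lam).
  exact: (big_morph _ (@UinD _ _) Uin0).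
rewrite mulr_suml big_seq; elim/big_ind: _ => [||lam lams].
- exact: weight_sum0.
- by move=> *; exact: (weight_sumD D Z).
rewrite mulr_sumr big_seq; elim/big_ind: _ => [||mu mut].
- exact: weight_sum0.
- by move=> *; exact: (weight_sumD D Z).
apply: (weight_sum1 (lam := lam + mu)); apply: homogM; last exact: wk.
by apply: homog_Uin; exact: wf.
Qed.

End EnvelopeGrading.

(** * Translation between weight modules and actions of U(g) *)

Section CoherentRealization.
Variables (K : numClosedFieldType) (g : lieAlgType K) (h : {vspace g}).
Local Notation iota := (@iotaU K g h).

Lemma weight_traceE (M : lieModType g) u lam :
  weight_trace M u lam = trace_on (hspace iota (@uact K g M) lam) (uact u).
Proof. by rewrite /weight_trace weight_spaceE. Qed.

Lemma weight_module_span (M : lieModType g) : weight_module h M ->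
  forall m, weight_sum (fun y => @uact K g M (iota y)) m.
Proof.
move=> [[Hsum _] _] m; have [s [f [us wf ->]]] := Hsum m.
exists s, f; split=> // lam lams; have := wf lam lams.
by rewrite weight_spaceE.
Qed.

Lemma semisimple_module_action (M : lieModType g) :
  semisimple_module M <-> semisimple_action (@uact K g M).
Proof.
split=> -[I [V [Vs Vd]]]; exists I, V; split=> // t; exact/simple_uact/Vs.
Qed.

Lemma simple_U0E (M : lieModType g) lam :
  simple_U0 M lam <-> simple_at iota (@uact K g M) lam.
Proof.
rewrite /simple_U0 /simple_at weight_spaceE.
suff -> : U0 h = homog iota 0 by [].
by apply/seteqP; split=> u /U0P.
Qed.

Lemma realizes_weight_module Phi d (M : lieModType g) :
  realizes iota Phi d (@uact K g M) -> weight_module h M.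
Proof.
move=> [actP sp dm _ _]; split; last by move=> lam; exists d; rewrite weight_spaceE; exact: dm.
split=> [m|s f us wf s0 lam lams].
  have [s [f [us wf ->]]] := sp m; exists s, f; split=> // lam /wf.
  by rewrite weight_spaceE.
apply: (hspace_free actP us _ s0) => // mu mus; have := wf mu mus; rewrite weight_spaceE; exact.
Qed.

End CoherentRealization.

Theorem exists_unique_semisimple_coherent_family (K : numClosedFieldType)
    (g : lieAlgType K) (h : {vspace g})
    (g_simple : simple_lie g) (g_AC : type_A_or_C g)
    (h_cartan : cartan_subalgebra h)
    (M : lieModType g) (HM : irreducible_almost_coherent_family h M) :
  exists N : lieModType g,
    [/\ irreducible_coherent_family h N, semisimple_module N
      & almost_equivalent h M N] /\
    (forall N' : lieModType g,
       irreducible_coherent_family h N' -> semisimple_module N' ->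
       almost_equivalent h M N' -> module_iso N N').
Proof.
have lieDr := type_AC_lieDr g_AC; have lieZr := type_AC_lieZr g_AC.
have [U [U_cofinite [d [M_weight M_dim M_poly]] [lam0 lam0U lam0_simple]]] := HM.
(* The root lattice contains 0. *)
have Ulam0 : U lam0.
  by rewrite -[lam0]addr0; apply: lam0U => S [[S0 _] _].
(* Degree 0 is excluded: the weight space at [lam0] would be zero, hence not simple. *)
case: d => [|n] in M_dim.
  case: lam0_simple => _ + _; case; have [b [_ bU]] := M_dim lam0 Ulam0.
  apply/seteqP; split=> m /=; first by case/bU => c [-> _]; rewrite big_ord0.
  by move=> -> y; have := lactZr 0 (vsval y) (0 : M); rewrite !scale0r scaler0.
have h_neq0 := cartan_neq0 g_simple lieZr h_cartan.
have M_faithful := module_faithful g_simple lieZr h_cartan U_cofinite M_dim.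
have M_weights (m : M) : weight_sum (h := h) (@lact_h K g h M) m.
  by have [s [f [us wf ->]]] := M_weight.1.1 m; exists s, f.
have h_abelian := cartan_abelian M_faithful M_weights.
have U_spanned := Uenv_spanned (cartan_spanned lieDr lieZr M_faithful M_weights).
pose iota := @iotaU K g h.
have iotaC y y' : iota y * iota y' = iota y' * iota y.
  by apply/subr0_eq; rewrite -Uin_lie h_abelian Uin0.
have M_dim' lam : U lam -> has_dim (hspace iota (@uact K g M) lam) n.+1.
  by rewrite -weight_spaceE; exact: M_dim.
have M_poly' u : homog iota 0 u -> exists2 P, polynomial_fun P &
    forall lam, U lam -> trace_on (hspace iota (@uact K g M) lam) (uact u) = P lam.
  move=> /U0P/M_poly[P HP PE]; exists P => // lam Ulam.
  by rewrite -weight_traceE; exact: PE.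
have [Phi [tf Phi_poly Phi_M]] :=
  exists_trace_family U_spanned iotaC h_neq0 (uact_action M) U_cofinite M_dim' M_poly'.
have [N0 [nact [N_real N_simple N_unique]]] :=
  trace_family_realized U_spanned iotaC tf (ltn0Sn n).
(* [action_module] rebuilds the Lmodule record of [N0] field by field, so the
   record must be exposed for the two structures to be convertible. *)
destruct N0 as [N0 []].
pose N : lieModType g := action_module (rl_action N_real).
have uactE : @uact K g N = nact by apply/funext => u; apply/funext => m; exact: action_uact.
have N_real' : realizes iota Phi n.+1 (@uact K g N) by rewrite uactE; exact: N_real.
have N_trace u lam : U0 h u -> weight_trace N u lam = Phi lam u.
  by move=> /U0P hu; rewrite weight_traceE; exact: (rl_trace N_real').
exists N; split.
  split.
  - split; last first.
      exists lam0; apply/simple_U0E; rewrite uactE.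
      apply: (N_simple M (@uact K g M)); first exact: uact_action.
      + exact: M_dim'.
      + by move=> u hu; exact: Phi_M.
      + exact/simple_U0E.
    exists n.+1; split; first exact: realizes_weight_module N_real'.
      by move=> lam; rewrite weight_spaceE; exact: (rl_dim N_real').
    move=> u u0; rewrite (_ : weight_trace N u = Phi^~ u); last first.
      by apply/funext => lam; exact: N_trace.
    by apply: Phi_poly; apply/U0P.
  - exact/semisimple_module_action/(rl_semisimple N_real').
  - exists U => // lam u Ulam u0; rewrite N_trace // weight_traceE.
    by apply: Phi_M => //; apply/U0P.
move=> N' [[d' [N'_weight N'_dim N'_poly]] _] N'_ss [U' U'_cofinite U'E].
(* Both sides are polynomial in [lam], and they agree on the intersection of [U] and [U'] through
   the trace on [M]. *)
have N'_trace lam u : homog iota 0 u -> weight_trace N' u lam = Phi lam u.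
  move=> hu; have u0 : U0 h u by apply/U0P.
  move: lam; apply: (line_poly_eq h_neq0 (U := U `&` U')).
  - by apply: polynomial_fun_line; exact: N'_poly.
  - by apply: polynomial_fun_line; exact: Phi_poly.
  - exact: cofinite_setI.
  move=> lam [Ulam Ulam']; rewrite -U'E // weight_traceE; exact: Phi_M.
(* Both degrees are the trace of 1 at [lam0]. *)
have d'E : d' = n.+1.
  apply/eqP; rewrite -(eqr_nat K) -(tf_one tf lam0) -N'_trace; last exact: homog1.
  have [b bV] := N'_dim lam0; apply/eqP.
  have Vlin := hspace_linear iota (uact_action N') lam0; rewrite -weight_spaceE in Vlin.
  rewrite -(mxtrace1 K d'); apply/esym/(trace_onE Vlin _ bV) => [c m m'|i].
    by rewrite !uact1.
  by rewrite uact1; exact: (id_matrix b).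
have N'_real : realizes iota Phi n.+1 (@uact K g N').
  split.
  - exact: uact_action.
  - exact: weight_module_span.
  - by move=> lam; rewrite -weight_spaceE -d'E; exact: N'_dim.
  - by move=> lam u hu; rewrite -weight_traceE; exact: N'_trace.
  - exact/semisimple_module_action.
have [f [f_bij fE]] := N_unique N' (@uact K g N') N'_real.
pose f' : {linear N -> N'} := f.
exists f'; split=> // x m; rewrite -(uact_in x (f m)) -fE.
by [].
Qed.

Theorem corollary4p20 (R : realType) (g : lieAlgType R[i]) (h : {vspace g})
    (g_simple : simple_lie g) (g_AC : type_A_or_C g)
    (h_cartan : cartan_subalgebra h)
    (M : lieModType g) (HM : irreducible_almost_coherent_family h M) :
  exists N : lieModType g,
    [/\ irreducible_coherent_family h N, semisimple_module N
      & almost_equivalent h M N] /\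
    (forall N' : lieModType g,
       irreducible_coherent_family h N' -> semisimple_module N' ->
       almost_equivalent h M N' -> module_iso N N').
Proof. exact: exists_unique_semisimple_coherent_family. Qed.
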